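(* Let $P$ be the transition kernel of a $\pi$-irreducible Markov chain that is reversible with respect to its invariant probability measure $\pi$, and let $\widetilde P$ be a transition kernel on the same space with invariant probability measure $\widetilde\pi$. (i) Assume that there exists an accessible atom $A$ such that $M:=\sup_{x\in X}\mathbb{E}_x[\sigma_A]<\infty$, and let $$\varrho=\sup\Bigl\{s<e^{1/M}:\ \sup_{x\in A}\sum_{n=1}^{\infty}s^{2n}F^{2n}(x,A)<1\Bigr\}.$$ Then for all $1<\lambda<e^{1/M}$ and $n\ge1$, $$\|\widetilde P^n-P^n\|\le\begin{cases}\Bigl[\frac{\varrho}{\varrho-1}F_1(1-\varrho^{-n})+\frac{\lambda}{\lambda-1}G_1(1-\lambda^{-n})\Bigr]\|\widetilde P-P\|,&\lambda\ne\varrho;\\[4pt] \frac{\varrho}{\varrho-1}\Bigl[\bigl(J_1+\frac{K_1}{\varrho-1}\bigr)-\bigl(J_1+\frac{K_1}{\varrho-1}+K_1n\bigr)\varrho^{-n}\Bigr]\|\widetilde P-P\|,&\lambda=\varrho,\end{cases}$$ and $$\|\widetilde\pi-\pi\|_{\mathrm{Var}}\le\begin{cases}\Bigl[\frac{\varrho}{\varrho-1}F_1+\frac{\lambda}{\lambda-1}G_1\Bigr]\|\widetilde P-P\|,&\lambda\ne\varrho;\\[4pt] \frac{\varrho}{\varrho-1}\bigl(J_1+\frac{K_1}{\varrho-1}\bigr)\|\widetilde P-P\|,&\lambda=\varrho,\end{cases}$$ where $$F_1=C_1\Bigl(1-\frac{\varrho-1}{\varrho-\lambda}M_1\Bigr),\qquad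 G_1=M_1\Bigl((2-C_1)^+\lambda^{-1}+\frac{\varrho-1}{\varrho-\lambda}C_1\Bigr),$$ $$J_1=C_1+(2-C_1)^+\varrho^{-1}M_1,\qquad K_1=C_1(1-\varrho^{-1})M_1,$$ $$C_1=\bigl(\pi(A)^{-1}-1\bigr)^{1/2},\qquad M_1=\lambda(1-M\log\lambda)^{-1}.$$ (ii) Assume that there exists a set $A\in\mathscr{B}(X)$ with $\pi(A)>0$ such that, for some constant $\delta>0$ and some probability measure $\nu$ on $\mathscr{B}(X)$, $P(x,B)\ge\delta1_A(x)\nu(B)$ for all $x\in X$, $B\in\mathscr{B}(X)$, and $M:=\sup_{x\in X}\mathbb{E}_x[\sigma_A]<\infty$. Then for all $1<\lambda<e^{1/M}$ satisfying $$\sup_{x\in A}\sum_{n=1}^{\infty}\lambda^{2n}F^{2n}(x,A)\le\vartheta\qquad\text{and}\qquad \lambda^2<(1-\vartheta)(1-M\log\lambda)^2\bigl(1+\delta^2\nu(A)\lambda^2\bigr)$$ for some $\vartheta<1$, and all $n\ge1$, $$\|\widetilde P^n-P^n\|\le\frac{\lambda}{\lambda-1}\Bigl[\Bigl(D_3+\frac{E_3}{\lambda-1}\Bigr)-\Bigl(D_3+\frac{E_3}{\lambda-1}+E_3n\Bigr)\lambda^{-n}\Bigr]\|\widetilde P-P\|,$$ and $$\|\widetilde\pi-\pi\|_{\mathrm{Var}}\le\frac{\lambda}{\lambda-1}\Bigl(D_3+\frac{E_3}{\lambda-1}\Bigr)\|\widetilde P-P\|,$$ where $$D_3=C_3\lambda+(2-C_3)^+\lambda^{-1}M_3,\qquad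 E_3=C_3(\lambda-\lambda^{-1})M_3/2,$$ $$C_3=\bigl((\delta^2\nu(A)\pi(A))^{-1}-1\bigr)^{1/2},\qquad M_3=\frac{\delta^2\nu(A)\lambda^2}{(1-\vartheta)(1-M\log\lambda)^2(1+\delta^2\nu(A)\lambda^2)-\lambda^2}.$$
   Context: $\Phi=\{\Phi_n:n\in\mathbb{Z}_+\}$ is a discrete-time homogeneous Markov chain on a general state space $X$ with countably generated $\sigma$-field $\mathscr{B}(X)$ and $n$-step transition kernel $P^n(x,B)=\mathbb{P}_x\{\Phi_n\in B\}$; $\mathbb{P}_x,\mathbb{E}_x$ are probability and expectation given $\Phi_0=x$. The chain has a (unique) invariant probability measure $\pi$ and is $\pi$-irreducible: if $\pi(B)>0$, there exists $n\in\mathbb{N}$ such that $P^n(x,B)>0$ for all $x\in X$. It is assumed that $P^n(x,\cdot)\ll\pi$ ($n\ge1$), with density $p^n(x,y)$. Reversible: $\pi(dx)P(x,dy)=\pi(dy)P(y,dx)$. A set $A\in\mathscr{B}(X)$ is an atom if there is a probability measure $\nu$ on $\mathscr{B}(X)$ with $P(x,B)=\nu(B)$ for all $x\in A$, $B\in\mathscr{B}(X)$; it is an accessible atom if moreover $\pi(A)>0$. $\sigma_A=\inf\{n\ge0:\Phi_n\in A\}$, $\tau_A=\inf\{n\ge1:\Phi_n\in A\}$, $F^n(x,A)=\mathbb{P}_x\{\tau_A=n\}$. For a signed measure $\mu$, $\|\mu\|_{\mathrm{Var}}=\sup_{|f|\le1}|\mu(f)|$; $\|\widetilde P^n-P^n\|=\sup_{x\in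 X}\|\widetilde P^n(x,\cdot)-P^n(x,\cdot)\|_{\mathrm{Var}}$. $a^+=\max\{a,0\}$. In the definition of $\varrho$, $s$ ranges over non-negative reals. *)

(* Defs.v *)
From HB Require Import structures.
From mathcomp Require Import all_boot all_order all_algebra.
From mathcomp Require Import all_classical all_reals all_analysis.

Set Implicit Arguments.
Unset Strict Implicit.
Unset Printing Implicit Defensive.

Import Order.TTheory GRing.Theory Num.Theory.
Import numFieldNormedType.Exports.

Local Open Scope classical_set_scope.
Local Open Scope ring_scope.
Local Open Scope ereal_scope.

Definition countably_generated (d : measure_display) (X : measurableType d) :
    Prop :=
  exists G : set (set X), countable G /\ @measurable d X = <<s G >>.

Section kernels.
Context {R : realType} {d : measure_display} {X : measurableType d}.

Fixpoint kiter (P : R.-pker X ~> X) (n : nat) : R.-spker X ~> X :=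
  if n is m.+1 then mkcomp_noparam P (kiter P m)
  else kdirac (@measurable_id d X setT).

Definition invariant_prob (P : R.-pker X ~> X) (pi : probability X R) : Prop :=
  forall B, measurable B -> pi B = \int[pi]_x P x B.

Definition unique_invariant (P : R.-pker X ~> X) (pi : probability X R) :
    Prop :=
  invariant_prob P pi /\
  forall mu : probability X R, invariant_prob P mu ->
    forall B, measurable B -> mu B = pi B.

(* The same n serves all starting points x; for a reversible chain this rules
   out periodicity. *)
Definition irreducible (P : R.-pker X ~> X) (pi : probability X R) : Prop :=
  forall B, measurable B -> 0 < pi B ->
    exists n, (0 < n)%N /\ forall x, 0 < kiter P n x B.

(* pi(dx) P(x, dy) = pi(dy) P(y, dx), evaluated on rectangles. *)
Definition reversible (P : R.-pker X ~> X) (pi : probability X R) : Prop :=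
  forall B C, measurable B -> measurable C ->
    \int[pi]_(x in B) P x C = \int[pi]_(x in C) P x B.

Definition atom (P : R.-pker X ~> X) (A : set X) : Prop :=
  measurable A /\
  exists nu : probability X R,
    forall x B, A x -> measurable B -> P x B = nu B.

Definition accessible_atom (P : R.-pker X ~> X) (pi : probability X R)
    (A : set X) : Prop :=
  atom P A /\ 0 < pi A.

(* ||mu - nu||_Var = sup_{|f| <= 1} |mu(f) - nu(f)|; for two probability
   measures this is twice the supremum over measurable sets. *)
Definition var_dist (mu nu : {measure set X -> \bar R}) : \bar R :=
  ereal_sup [set `| \int[mu]_x (f x)%:E - \int[nu]_x (f x)%:E |
            | f in [set f : X -> R | measurable_fun setT f /\
                                     forall x, (`|f x| <= 1)%R]].

Definition ker_dist (P Q : X -> {measure set X -> \bar R}) : \bar R :=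
  ereal_sup [set var_dist (P x) (Q x) | x in [set: X]].

End kernels.

Section chain.
Context {R : realType} {d d' : measure_display}.
Context {X : measurableType d} {Omega : measurableType d'}.
Implicit Types (Phi : nat -> Omega -> X) (Pr : X -> probability Omega R).

Definition natural_filtration Phi (n : nat) : set (set Omega) :=
  <<s [set E | exists k B,
         [/\ (k <= n)%N, measurable B & E = Phi k @^-1` B]] >>.

(* Pr x is the law of the chain started at x. The last field says that
   P (Phi n) B is a version of the conditional probability of
   {Phi (n + 1) in B} given Phi 0, ..., Phi n. *)
Record markov_chain (P : R.-pker X ~> X) Pr Phi : Prop := MarkovChain {
  mc_measurable : forall n, measurable_fun setT (Phi n) ;
  mc_init : forall x B, measurable B -> Pr x (Phi 0%N @^-1` B) = dirac x B ;
  mc_step : forall x n E B, natural_filtration Phi n E -> measurable B ->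
    Pr x (E `&` Phi n.+1 @^-1` B) = \int[Pr x]_(w in E) P (Phi n w) B
}.

(* Both hitting times are +oo when the set is never hit. *)
Definition hit_sigma Phi (A : set X) (w : Omega) : \bar R :=
  ereal_inf [set n%:R%:E | n in [set n | A (Phi n w)]].

Definition hit_tau Phi (A : set X) (w : Omega) : \bar R :=
  ereal_inf [set n%:R%:E | n in [set n | (1 <= n)%N /\ A (Phi n w)]].

Definition first_return Pr Phi (n : nat) (x : X) (A : set X) : \bar R :=
  Pr x [set w | hit_tau Phi A w = n%:R%:E].

Definition sup_mean_hit Pr Phi (A : set X) : \bar R :=
  ereal_sup [set \int[Pr x]_w hit_sigma Phi A w | x in [set: X]].

Definition sup_even_return Pr Phi (A : set X) (s : R) : \bar R :=
  ereal_sup [set \sum_(1 <= n <oo)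
                   (s ^+ (2 * n))%:E * first_return Pr Phi (2 * n) x A
            | x in A].

(* In the extended reals M^-1 = +oo for M = 0, so that exp(1/M) = +oo. *)
Definition exp_inv (M : \bar R) : \bar R := expeR M^-1.

(* When sup_mean_hit = 0 the set below may be unbounded, and then sup returns
   the default value 0. But then A = X, hence pi(A) = 1, and every term of the
   bounds in which rho occurs is multiplied by (pi(A)^-1 - 1)^(1/2) = 0. *)
Definition rho Pr Phi (A : set X) : R :=
  sup [set s : R | [/\ (0 <= s)%R,
                       s%:E < exp_inv (sup_mean_hit Pr Phi A) &
                       sup_even_return Pr Phi A s < 1]].

End chain.

(* Main.v *)
Require Import Defs.
From HB Require Import structures.
From mathcomp Require Import all_boot all_order all_algebra.
From mathcomp Require Import all_classical all_reals all_analysis.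
From mathcomp Require Import measurable_realfun.
From mathcomp Require Import ring lra.

Set Implicit Arguments.
Unset Strict Implicit.
Unset Printing Implicit Defensive.

Import Order.TTheory GRing.Theory Num.Theory.
Import numFieldNormedType.Exports.

Local Open Scope classical_set_scope.
Local Open Scope ring_scope.

(** Both parts follow from a bound [|P^n f (x) - pi f| <= beta n], uniform in [x]
    and in [|f| <= 1]. In the telescoping sum
    [Pt^n - P^n = \sum_(k < n) Pt^(n-1-k) (Pt - P) P^k] the difference [Pt - P]
    vanishes on constants, so [P^k f] can be replaced by [P^k f - pi f]; this gives
    [(\sum_(k < n) beta k) * ||Pt - P||], and the invariant measures are compared
    by letting [n] tend to infinity ([ker_dist_iter_le], [invariant_dist_le]). The
    fractions in the theorem are the sums of the sequences [beta], which are
    geometric up to an affine factor.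

    The sequence [beta] comes from regeneration. If a kernel [T] dominates
    [e (x) nu], with residual [K = T - e (x) nu], then splitting at the first
    regeneration gives [T^n f = K^n f + \sum_(j < n) K^j e * nu (T^(n-1-j) f)]
    ([first_regeneration]). Two rates are needed: that of [K^n 1], the tail of the
    regeneration time, and that of [nu (T^m f) - pi f].

    The tails are bounded by exponential moments. A uniform bound [M] on the mean
    hitting times of [A] bounds the moment of base [lam] by [(1 - M * ln lam)^-1],
    through an explicit supersolution ([hitting_gf_le]). Visits to [A] at even times
    are obtained from this and from a bound below 1 on the generating function of
    even return times ([even_hitting_gf_le]), and regenerations that happen with
    probability [q] at such visits from a further first-step inequality
    ([split_survival_le]).

    For the other rate reversibility enters. The law [nu] (or the law from which
    [nu] is reached in one step) has a bounded density [h] with respect to [pi],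
    and [nu (P^k f) - pi f] is, up to a shift of the index, at most the square
    root of [a k = ||P^k (h - 1)||^2], the norm being that of [L^2(pi)]. Since [P] is
    symmetric, [a k ^+ 2 <= a 0 * a (2 k)], so a bound [a k = O(z^k)] improves
    itself to [a k <= a 0 * z^k] ([geometric_decay_constant]). The bound [O(z^k)] is
    read off the first regeneration decomposition of the two-step kernel,
    integrated against [pi]: the quantities [a k] are nonnegative, hence a single
    term of a sum of nonnegative terms is at most the tail of the regeneration
    time ([decay_from_regeneration]). This is where two-step transitions, and hence
    even return times, appear in both parts.

    In the first part every visit to the atom is a regeneration, and the fact that
    [rho > 1] rests on the existence of an odd return time, which irreducibility
    provides ([odd_return], [rho_gt1]). In the second part the two-step kernel
    dominates [delta^2 * nu A * \1_A (x) nu]. *)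

(** * Positive linear functionals on bounded measurable functions *)

Definition bounded_measurable {R : realType} {d} {T : measurableType d} (f : T ->
  R) : Prop :=
  measurable_fun setT f /\ exists c : R, forall x, `|f x| <= c.

Section bounded_measurable_functions.
Context {R : realType} {d : measure_display} {T : measurableType d}.
Implicit Types f g : T -> R.

Lemma bmf_cst (c : R) : bounded_measurable ((fun=> c) : T -> R).
Proof. by split=> //; exists `|c|. Qed.

Lemma bmf_indic (B : set T) : measurable B -> bounded_measurable (\1_B : T -> R).
Proof.
move=> mB; split; first exact: measurable_indic.
by exists 1 => x; rewrite indicE; case: (_ \in _); rewrite ?normr1 ?normr0.
Qed.

Lemma bmfD f g : bounded_measurable f -> bounded_measurable g ->
  bounded_measurable (fun x => f x + g x).
Proof.
move=> [mf [c fc]] [mg [c' gc]]; split; first exact: measurable_funD.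
by exists (c + c') => x; rewrite (le_trans (ler_normD _ _))// lerD.
Qed.

Lemma bmfM f g : bounded_measurable f -> bounded_measurable g ->
  bounded_measurable (fun x => f x * g x).
Proof.
move=> [mf [c fc]] [mg [c' gc]]; split; first exact: measurable_funM.
by exists (c * c') => x; rewrite normrM ler_pM.
Qed.

Lemma bmfZ (a : R) f : bounded_measurable f -> bounded_measurable (fun x => a * f x).
Proof. by move=> bf; apply: bmfM => //; exact: bmf_cst. Qed.

Lemma bmfB f g : bounded_measurable f -> bounded_measurable g ->
  bounded_measurable (fun x => f x - g x).
Proof.
move=> bf bg; have := bmfD bf (bmfZ (-1) bg).
by under [X in bounded_measurable X]funext do rewrite mulN1r.
Qed.

Lemma bmf_sum (I : Type) (s : seq I) (p : pred I) (F : I -> T -> R) :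
  (forall i, bounded_measurable (F i)) -> bounded_measurable (fun x => \sum_(i <- s | p
    i) F i x).
Proof.
move=> bF; elim: s => [|i s IH].
  by under [X in bounded_measurable X]funext do rewrite big_nil; exact: bmf_cst.
under [X in bounded_measurable X]funext do rewrite big_cons.
case: (p i) => //; exact: bmfD.
Qed.

Lemma bmf_comp {d'} {T' : measurableType d'} (h : T' -> T) f :
  measurable_fun setT h -> bounded_measurable f -> bounded_measurable (f \o h).
Proof.
move=> mh [mf [c fc]]; split; first exact: measurableT_comp.
by exists c => x /=.
Qed.

(** Integration against a probability measure, evaluation at a point and all
    their compositions with kernels are of this kind, so that identities between
    measures need only be checked on indicators. *)
Record posfun (phi : (T -> R) -> R) : Prop := Posfun {
  posfun_lin : forall a f g, bounded_measurable f -> bounded_measurable g ->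
    phi (fun x => a * f x + g x) = a * phi f + phi g ;
  posfun_ge0 : forall f, bounded_measurable f -> (forall x, 0 <= f x) -> 0 <= phi f }.

Section posfun_theory.
Variable (phi : (T -> R) -> R) (pphi : posfun phi).

Lemma posfun0 : phi (fun=> 0) = 0.
Proof.
have := posfun_lin pphi (-1) (bmf_cst 0) (bmf_cst 0).
rewrite (_ : (fun x : T => -1 * 0 + 0) = fun=> 0 :> R); last first.
  by apply/funext => x; rewrite mulr0 addr0.
by move=> ->; lra.
Qed.

Lemma posfunZ a f : bounded_measurable f -> phi (fun x => a * f x) = a * phi f.
Proof.
move=> bf; have := posfun_lin pphi a bf (bmf_cst 0).
rewrite posfun0 addr0 => <-; congr phi.
by apply/funext => x; rewrite addr0.
Qed.

Lemma posfunD f g : bounded_measurable f -> bounded_measurable g ->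
  phi (fun x => f x + g x) = phi f + phi g.
Proof.
move=> bf bg; have := posfun_lin pphi 1 bf bg.
by rewrite mul1r => <-; congr phi; apply/funext => x; rewrite mul1r.
Qed.

Lemma posfunB f g : bounded_measurable f -> bounded_measurable g ->
  phi (fun x => f x - g x) = phi f - phi g.
Proof.
move=> bf bg; have := posfun_lin pphi (-1) bg bf.
by rewrite mulN1r addrC => <-; congr phi; apply/funext => x; rewrite mulN1r addrC.
Qed.

Lemma posfun_sum (I : Type) (s : seq I) (p : pred I) (F : I -> T -> R) :
  (forall i, bounded_measurable (F i)) ->
  phi (fun x => \sum_(i <- s | p i) F i x) = \sum_(i <- s | p i) phi (F i).
Proof.
move=> bF; elim: s => [|i s IH].
  by rewrite big_nil -[RHS]posfun0; congr phi; apply/funext => x; rewrite big_nil.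
rewrite big_cons; case: ifPn => pi; last first.
  by rewrite -IH; congr phi; apply/funext => x; rewrite big_cons (negbTE pi).
rewrite -IH -posfunD//; last exact: bmf_sum.
by congr phi; apply/funext => x; rewrite big_cons pi.
Qed.

Lemma posfun_le f g : bounded_measurable f -> bounded_measurable g -> (forall x,
  f x <= g x) -> phi f <= phi g.
Proof.
move=> bf bg fg; rewrite -subr_ge0 -posfunB//; apply: posfun_ge0 => //.
  exact: bmfB.
by move=> x; rewrite subr_ge0.
Qed.

Lemma posfun_cst c : phi (fun=> c) = c * phi (fun=> 1).
Proof.
rewrite -posfunZ; last exact: bmf_cst.
by congr phi; apply/funext => x; rewrite mulr1.
Qed.

Lemma posfun_norm_le f c : bounded_measurable f -> (forall x, `|f x| <= c) ->
  `|phi f| <= c * phi (fun=> 1).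
Proof.
move=> bf fc; rewrite -posfun_cst ler_norml -(mulN1r (phi _)).
rewrite -posfunZ; last exact: bmf_cst.
apply/andP; split; apply: posfun_le => //; try exact: bmf_cst.
- by move=> x; rewrite mulN1r; have := fc x; rewrite ler_norml => /andP[].
- by move=> x; have := fc x; rewrite ler_norml => /andP[].
Qed.

End posfun_theory.

(** A nonnegative bounded [f] is within [1 / N] of the finite layer-cake sum
    [\sum_k (1 / N) * \1_{f >= k / N}], on which [phi] is nonnegative; the
    sup-norm continuity of [phi] then passes this to [f]. *)
Lemma linear_ge0_of_sets (phi : (T -> R) -> R) (C : R) :
  (forall a f g, bounded_measurable f -> bounded_measurable g ->
    phi (fun x => a * f x + g x) = a * phi f + phi g) ->
  (forall f (c : R), bounded_measurable f -> (forall x, `|f x| <= c) -> `|phi f| <=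
    C * c) ->
  (forall B, measurable B -> 0 <= phi \1_B) ->
  forall f, bounded_measurable f -> (forall x, 0 <= f x) -> 0 <= phi f.
Proof.
move=> lin bnd setge f bf f0.
have [mf [c fc]] := bf.
have mlev (r : R) : measurable [set x | r <= f x].
  rewrite (_ : mkset _ = setT `&` f @^-1` `[r, +oo[%classic).
    by apply: mf => //; exact: measurable_itv.
  by rewrite setTI; apply/seteqP; split => x /=; rewrite in_itv/= andbT.
have indic_lev (r : R) x : \1_[set y | r <= f y] x = (r <= f x)%R%:R :> R.
  rewrite indicE; suff -> : (x \in [set y | r <= f y]) = (r <= f x) by [].
  by apply/idP/idP; rewrite inE.
pose lay N K (x : T) : R := \sum_(k < K) N.+1%:R^-1 * \1_[set x | k.+1%:R / N.+1%:R <=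
  f x] x.
have blay N K : bounded_measurable (lay N K).
  by apply: bmf_sum => i; apply/bmfZ/bmf_indic/mlev.
have lay_ge0 N K : 0 <= phi (lay N K).
  elim: K => [|K IH].
    have := bnd (lay N 0%N) 0 (blay _ _); rewrite mulr0 normr_le0.
    move=> h; rewrite (eqP (h _))// => x.
    by rewrite /lay big_ord0 normr0.
  rewrite (_ : lay N K.+1 = fun x => N.+1%:R^-1 *
      \1_[set x | K.+1%:R / N.+1%:R <= f x] x + lay N K x); last first.
    by apply/funext => x; rewrite /lay big_ord_recr/= addrC.
  rewrite lin//; last exact/bmf_indic/mlev.
  by rewrite addr_ge0// mulr_ge0// ?invr_ge0//; exact/setge/mlev.
have layE N K x : lay N K x = (minn K (Num.truncn (f x * N.+1%:R)))%:R / N.+1%:R.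
  rewrite /lay -mulr_sumr mulrC; congr (_ / _).
  elim: K => [|K IH]; first by rewrite big_ord0 min0n.
  rewrite big_ord_recr/= IH indic_lev.
  rewrite ler_pdivrMr// -truncn_ge_nat ?mulr_ge0//.
  have [h|h] := leqP K.+1 (Num.truncn (f x * N.+1%:R)).
    by rewrite (minn_idPl (ltnW h)) natr1.
  by rewrite addr0; rewrite ltnS in h; rewrite (minn_idPr h) .
have C0 : 0 <= C.
  have := bnd (fun=> 1) 1 (bmf_cst 1) (fun _ => _); rewrite mulr1 => h.
  by apply: le_trans (h _) => // ?; rewrite normr1.
have key N : - (C * N.+1%:R^-1) <= phi f.
  pose K := Num.truncn (c * N.+1%:R).
  have -> : phi f = 1 * phi (lay N K) + phi (fun x => f x - lay N K x).
    rewrite -lin//; last exact: bmfB.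
    by congr phi; apply/funext => x; rewrite mul1r addrC subrK.
  rewrite mul1r -[leLHS]add0r lerD//.
  rewrite lerNl (le_trans (ler_norm _))// normrN bnd//; first exact: bmfB.
  move=> x; rewrite layE.
  have fx : f x <= c by rewrite (le_trans (ler_norm _)).
  have c0 : 0 <= c by rewrite (le_trans (f0 x)).
  have/minn_idPr -> : (Num.truncn (f x * N.+1%:R) <= K)%N.
    by apply: le_truncn; rewrite ler_pM2r.
  have := truncn_itv (mulr_ge0 (f0 x) (ler0n R N.+1)) => /andP[h1 h2].
  have N0 : 0 < N.+1%:R :> R by [].
  rewrite ger0_norm; first by rewrite lerBlDr -[X in X <=
    _](mulfK (lt0r_neq0 N0)) -{2}[N.+1%:R^-1]mul1r -mulrDl ler_pM2r ?invr_gt0// addrC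
    natr1 ltW.
  by rewrite subr_ge0 ler_pdivrMr.
rewrite leNgt; apply/negP => neg.
have {neg} p : 0 < - phi f by lra.
have := archi_boundP (ltW (mulr_gt0 (_ : 0 < (C+1)) (_ : 0 < (- phi f)^-1))).
rewrite invr_gt0 => /(_ ltac:(lra) p).
set N := Num.Def.archi_bound _ => hN.
have := key N.
have N1 : 0 < N.+1%:R :> R by [].
have : C + 1 < (- phi f) * N.+1%:R.
  rewrite mulrC -ltr_pdivrMr//; apply: (lt_le_trans hN).
  by rewrite ler_nat.
rewrite lerNl => h1 h2.
have : - phi f * N.+1%:R <= C.
  by rewrite -ler_pdivlMr.
by lra.
Qed.

End bounded_measurable_functions.

Section posfun_sets.
Context {R : realType} {d : measure_display} {T : measurableType d}.
Implicit Types (phi psi : (T -> R) -> R) (f g h : T -> R).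

Lemma posfun_le_of_sets phi psi : posfun phi -> posfun psi ->
  (forall B, measurable B -> phi \1_B <= psi \1_B) ->
  forall f, bounded_measurable f -> (forall x, 0 <= f x) -> phi f <= psi f.
Proof.
move=> hphi hpsi le_sets f bf f0; rewrite -subr_ge0.
apply: (@linear_ge0_of_sets _ _ _ (fun f => psi f - phi f)
  (psi (fun=> 1) + phi (fun=> 1))) => //.
- by move=> a u v bu bv; rewrite !posfun_lin//; ring.
- move=> u c bu uc; rewrite (le_trans (ler_normB _ _))// mulrDl.
  by rewrite ![_ * c]mulrC lerD// posfun_norm_le.
- by move=> B mB; rewrite subr_ge0 le_sets.
Qed.

(** Adding a constant reduces this to nonnegative functions, to which the
    comparison on sets applies in both directions. *)
Lemma posfun_eq_of_sets phi psi : posfun phi -> posfun psi ->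
  (forall B, measurable B -> phi \1_B = psi \1_B) ->
  forall f, bounded_measurable f -> phi f = psi f.
Proof.
move=> hphi hpsi eq_sets f bf.
have eq_ge0 g : bounded_measurable g -> (forall x, 0 <= g x) -> phi g = psi g.
  move=> bg g0; apply/eqP; rewrite eq_le; apply/andP; split;
    by apply: posfun_le_of_sets => // B mB; rewrite eq_sets.
have [_ [c fc]] := bf.
have -> : f = fun x => (f x + `|c|) - `|c| by apply/funext => x; rewrite addrK.
have bfc : bounded_measurable (fun x => f x + `|c|) by apply: bmfD => //; exact: bmf_cst.
rewrite !posfunB//; try exact: bmf_cst.
congr (_ - _); apply: eq_ge0 => //; last exact: bmf_cst.
move=> x; have := fc x; rewrite ler_norml => /andP[h _].
by rewrite -lerBlDr sub0r (le_trans _ h)// lerN2 ler_norm.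
Qed.

Lemma posfun_mul phi h : posfun phi -> bounded_measurable h -> (forall x, 0 <= h x) ->
  posfun (fun f => phi (fun x => h x * f x)).
Proof.
move=> hphi bh h0; split=> [a f g bf bg|f bf f0].
  rewrite -posfun_lin//; try exact: bmfM.
  by congr phi; apply/funext => x; ring.
apply: posfun_ge0 => //; first exact: bmfM.
by move=> x; rewrite mulr_ge0.
Qed.

End posfun_sets.

(** * Positive operators and transition kernels *)

Section posop.
Context {R : realType} {d : measure_display} {T : measurableType d}.
Implicit Types (U : (T -> R) -> T -> R) (f g : T -> R).

Record posop U : Prop := Posop {
  posop_at : forall x, posfun (U^~ x) ;
  posop_bmf : forall f, bounded_measurable f -> bounded_measurable (U f) }.

Lemma posop_iter U n : posop U -> posop (iter n U).
Proof.
move=> hU; elim: n => [|n IH]; first by split.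
split=> [x|f bf]; last by rewrite iterS; apply: (posop_bmf hU); exact: (posop_bmf IH).
split=> [a f g bf bg|f bf f0].
  rewrite !iterS -(posfun_lin (posop_at hU x)); try exact: (posop_bmf IH).
  congr (U _ x); apply/funext => y; exact: (posfun_lin (posop_at IH y)).
rewrite iterS; apply: (posfun_ge0 (posop_at hU x)); first exact: (posop_bmf IH).
by move=> y; apply: (posfun_ge0 (posop_at IH y)).
Qed.

Lemma posop_comp U V : posop U -> posop V -> posop (U \o V).
Proof.
move=> hU hV; split=> [x|f bf /=]; last by apply/(posop_bmf hU)/(posop_bmf hV).
split=> [a f g bf bg|f bf f0] /=.
  rewrite -(posfun_lin (posop_at hU x)); try exact: (posop_bmf hV).
  congr (U _ x); apply/funext => y; exact: (posfun_lin (posop_at hV y)).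
apply: (posfun_ge0 (posop_at hU x)); first exact: (posop_bmf hV).
by move=> y; apply: (posfun_ge0 (posop_at hV y)).
Qed.

Lemma posop_mul U (h : T -> R) : posop U -> bounded_measurable h -> (forall x, 0 <= h x) ->
  posop (fun f x => h x * U f x).
Proof.
move=> hU bh h0; split=> [x|f bf]; last by apply: bmfM => //; exact: (posop_bmf hU).
split=> [a f g bf bg|f bf f0].
  by rewrite (posfun_lin (posop_at hU x))//; ring.
by rewrite mulr_ge0//; exact: (posfun_ge0 (posop_at hU x)).
Qed.

Lemma posfun_comp phi U : posfun phi -> posop U -> posfun (fun f => phi (U f)).
Proof.
move=> hphi hU; split=> [a f g bf bg|f bf f0].
  rewrite -(posfun_lin hphi); try exact: (posop_bmf hU).
  congr phi; apply/funext => x; exact: (posfun_lin (posop_at hU x)).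
apply: (posfun_ge0 hphi); first exact: (posop_bmf hU).
by move=> x; exact: (posfun_ge0 (posop_at hU x)).
Qed.

End posop.

Section avg.
Context {R : realType} {d : measure_display} {T : measurableType d}.
Variable mu : {measure set T -> \bar R}.
Hypothesis mu1 : mu setT = 1%E.
Implicit Types f g : T -> R.

Lemma bmf_integrable f : bounded_measurable f -> mu.-integrable setT (EFin \o f).
Proof.
move=> [mf [c fc]]; apply: measurable_bounded_integrable => //.
  by rewrite mu1 ltry.
by exists c; split; [exact: num_real|move=> y cy x _ /=; rewrite (le_trans (fc x))// ltW].
Qed.

Lemma posfun_avg : posfun (fun f => \int[mu]_x f x).
Proof.
split=> [a f g bf bg|f bf f0]; last exact: Rintegral_ge0.
rewrite RintegralD//; try exact: bmf_integrable.
  by rewrite RintegralZl//; exact: bmf_integrable.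
by apply: bmf_integrable; exact: bmfZ.
Qed.

Lemma avg1 : \int[mu]_x 1 = 1 :> R.
Proof. by rewrite Rintegral_cst// mu1 mulr1. Qed.

Lemma avg_indic B : measurable B -> \int[mu]_x \1_B x = fine (mu B).
Proof. by move=> mB; rewrite /Rintegral integral_indic// setIT. Qed.

Lemma EFin_avg f : bounded_measurable f -> (\int[mu]_x f x)%:E = (\int[mu]_x (f x)%:E)%E.
Proof.
by move=> bf; rewrite fineK//; apply: integrable_fin_num => //; exact: bmf_integrable.
Qed.

End avg.

Section kop.
Context {R : realType} {d : measure_display} {X : measurableType d}.
Implicit Types (f g : X -> R).

Definition kop (k : X -> {measure set X -> \bar R}) f x : R := \int[k x]_y f y.

Lemma prob_kerT (P : R.-pker X ~> X) x : P x setT = 1%E.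
Proof. exact: prob_kernel. Qed.

Lemma pker_fin_num (P : R.-pker X ~> X) x B : measurable B ->
  P x B \is a fin_num.
Proof.
move=> mB; rewrite ge0_fin_numE//; apply: (@le_lt_trans _ _ (P x setT)).
  by apply: le_measure; rewrite ?inE.
by rewrite prob_kerT ltry.
Qed.

(** Measurability of [kop P f] is known for nonnegative integrands, whence the
    shift by a constant. *)
Lemma posop_kop (P : R.-pker X ~> X) : posop (kop P).
Proof.
split=> [x|f bf]; first by apply: posfun_avg; exact: prob_kerT.
have [mf [c fc]] := bf.
have fc0 x : 0 <= f x + c.
  by have := fc x; rewrite ler_norml => /andP[+ _]; rewrite -lerBlDr sub0r.
split; last first.
  exists c => x; rewrite -[leRHS]mulr1 -(avg1 (prob_kerT P x)).
  by apply: (posfun_norm_le (posfun_avg (prob_kerT P x))).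
have bfc : bounded_measurable (fun x => f x + c) by apply: bmfD => //; exact: bmf_cst.
rewrite (_ : kop P f = fun x => fine (\int[P x]_y (f y + c)%:E)%E - c).
  apply: measurable_funB => //; apply: measurableT_comp => //.
  apply: measurable_fun_integral_kernel.
  - by move=> U mU; exact: measurable_kernel.
  - by move=> y; rewrite lee_fin.
  - by apply/measurable_EFinP; case: bfc.
apply/funext => x; rewrite /kop; apply/eqP; rewrite eq_sym subr_eq.
rewrite -/(Rintegral (P x) setT (fun y => f y + c)).
have pa := posfun_avg (prob_kerT P x).
rewrite (posfunD pa)//; last exact: bmf_cst.
by rewrite (posfun_cst pa) avg1 ?mulr1//; exact: prob_kerT.
Qed.

Lemma kop1 (P : R.-pker X ~> X) : kop P (fun=> 1) = fun=> 1.
Proof. by apply/funext => x; rewrite /kop avg1//; exact: prob_kerT. Qed.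

Lemma iter_kop1 (P : R.-pker X ~> X) n : iter n (kop P) (fun=> 1) = fun=> 1.
Proof. by elim: n => // n IH; rewrite iterS IH kop1. Qed.

Lemma kop_indic (P : R.-pker X ~> X) B x : measurable B ->
  kop P \1_B x = fine (P x B).
Proof. by move=> mB; rewrite /kop avg_indic. Qed.

Lemma kiter_indic (P : R.-pker X ~> X) n B x : measurable B ->
  kiter P n x B = (iter n (kop P) \1_B x)%:E.
Proof.
move=> mB; elim: n x => [x|n IH x]; first by rewrite /= /kdirac diracE indicE.
rewrite /= /mkcomp_noparam /= /kcomp_noparam /kop EFin_avg//; last 2 first.
- exact: prob_kerT.
- exact: (posop_bmf (posop_iter n (posop_kop P)) (bmf_indic mB)).
by apply: eq_integral => y _; rewrite IH.
Qed.

Lemma kiterT (P : R.-pker X ~> X) n x : kiter P n x setT = 1%E.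
Proof.
rewrite kiter_indic// (_ : \1_setT = fun=> 1 :> R) ?iter_kop1//.
by apply/funext => y; rewrite indicT.
Qed.

Lemma kop_kiter (P : R.-pker X ~> X) n f : bounded_measurable f ->
  kop (kiter P n) f = iter n (kop P) f.
Proof.
move=> bf; apply/funext => x.
apply: (@posfun_eq_of_sets _ _ _ (fun g => \int[kiter P n x]_y g y)
  (fun g => iter n (kop P) g x)) => //.
- by apply: posfun_avg; exact: kiterT.
- exact: (posop_at (posop_iter n (posop_kop P)) x).
- by move=> B mB; rewrite avg_indic// kiter_indic.
Qed.

Lemma invariantE (P : R.-pker X ~> X) (pi : probability X R) f :
  invariant_prob P pi -> bounded_measurable f -> \int[pi]_x kop P f x = \int[pi]_x f x.
Proof.
move=> hinv bf; have pT := @probability_setT _ _ _ pi.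
apply: (@posfun_eq_of_sets _ _ _ (fun g => \int[pi]_x kop P g x)
  (fun g => \int[pi]_x g x)) => //.
- by apply: posfun_comp (posop_kop P); exact: posfun_avg.
- exact: posfun_avg.
- move=> B mB; transitivity (fine (pi B)); last exact/esym/avg_indic.
  rewrite (hinv B mB) /Rintegral; congr fine.
  apply: eq_integral => x _; rewrite kop_indic// fineK//.
  exact: pker_fin_num.
Qed.

Lemma reversible_invariant (P : R.-pker X ~> X) (pi : probability X R) :
  reversible P pi -> invariant_prob P pi.
Proof.
move=> hrev B mB; have := hrev _ _ measurableT mB => ->.
under eq_integral do rewrite prob_kernel.
by rewrite integral_cst// mul1e.
Qed.

(** Reversibility is the case of two indicators; both arguments are extended in
    turn. Positivity of the multiplier is required for the second extension, and
    a constant is added to obtain it, at the cost of using invariance. *)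
Lemma kop_sym (P : R.-pker X ~> X) (pi : probability X R) f g :
  reversible P pi -> bounded_measurable f -> bounded_measurable g ->
  \int[pi]_x (f x * kop P g x) = \int[pi]_x (g x * kop P f x).
Proof.
move=> hrev bf bg; have pT := @probability_setT _ _ _ pi.
have pP := posop_kop P.
have ppi := posfun_avg pT.
have int_indic B C : measurable B -> measurable C ->
    \int[pi]_x (\1_B x * kop P \1_C x) = fine (\int[pi]_(x in B) P x C)%E.
  move=> mB mC; rewrite integral_mkcond /Rintegral; congr fine.
  apply: eq_integral => x _; rewrite /patch; case: ifPn => xB.
    rewrite indicE xB mul1r kop_indic// fineK//; exact: pker_fin_num.
  by rewrite indicE (negbTE xB) mul0r.
have sym_indic C u : measurable C -> bounded_measurable u ->
    \int[pi]_x (\1_C x * kop P u x) = \int[pi]_x (u x * kop P \1_C x).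
  move=> mC bu.
  transitivity (\int[pi]_x (kop P \1_C x * u x)); last first.
    by apply: eq_Rintegral => x _; rewrite mulrC.
  apply: (@posfun_eq_of_sets _ _ _ (fun g => \int[pi]_x (\1_C x * kop P g x))
    (fun g => \int[pi]_x (kop P \1_C x * g x))) => //.
  - by apply: (posfun_comp (phi := fun v => \int[pi]_x (\1_C x * v x))) => //;
      apply: posfun_mul => //; exact: bmf_indic.
  - apply: posfun_mul => //; first exact: (posop_bmf pP (bmf_indic mC)).
    by move=> x; apply: (posfun_ge0 (posop_at pP x)) => //; exact: bmf_indic.
  - move=> B mB; rewrite int_indic// hrev// -int_indic//.
    by apply: eq_Rintegral => x _; rewrite mulrC.
have sym_ge0 u v : bounded_measurable u -> bounded_measurable v -> (forall x, 0 <= u x) ->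
    \int[pi]_x (u x * kop P v x) = \int[pi]_x (v x * kop P u x).
  move=> bu bv u0.
  transitivity (\int[pi]_x (kop P u x * v x)); last first.
    by apply: eq_Rintegral => x _; rewrite mulrC.
  apply: (@posfun_eq_of_sets _ _ _ (fun v => \int[pi]_x (u x * kop P v x))
    (fun v => \int[pi]_x (kop P u x * v x))) => //.
  - by apply: (posfun_comp (phi := fun v => \int[pi]_x (u x * v x))) => //;
      exact: posfun_mul.
  - apply: posfun_mul => //; first exact: (posop_bmf pP).
    by move=> x; exact: (posfun_ge0 (posop_at pP x)).
  - move=> B mB; rewrite -sym_indic//.
    by apply: eq_Rintegral => x _; rewrite mulrC.
have [_ [c fc]] := bf.
have bfc : bounded_measurable (fun x => f x + c) by apply: bmfD => //; exact: bmf_cst.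
have fc0 x : 0 <= f x + c.
  by have := fc x; rewrite ler_norml => /andP[+ _]; rewrite -lerBlDr sub0r.
have := sym_ge0 _ _ bfc bg fc0.
have -> : \int[pi]_x ((f x + c) * kop P g x) =
    \int[pi]_x (f x * kop P g x) + c * \int[pi]_x g x.
  rewrite -(invariantE (reversible_invariant hrev) bg).
  have bPg := posop_bmf pP bg.
  rewrite -(posfunZ ppi)// -(posfunD ppi); [|exact: bmfM|exact: bmfZ].
  by apply: eq_Rintegral => x _; rewrite mulrDl.
have -> : \int[pi]_x (g x * kop P (fun x => f x + c) x) =
    \int[pi]_x (g x * kop P f x) + c * \int[pi]_x g x.
  have bPf := posop_bmf pP bf.
  rewrite -(posfunZ ppi)// -(posfunD ppi); [|exact: bmfM|exact: bmfZ].
  apply: eq_Rintegral => x _.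
  rewrite (posfunD (posop_at pP x))//; last exact: bmf_cst.
  rewrite (posfun_cst (posop_at pP x)) kop1; ring.
by move/addIr.
Qed.

End kop.

(** * First regeneration decomposition *)

Section regeneration.
Context {R : realType} {d : measure_display} {X : measurableType d}.
Implicit Types (f g : X -> R).
Variables (T K : (X -> R) -> X -> R) (e : X -> R) (nu : (X -> R) -> R).
Hypotheses (pT : posop T) (pK : posop K) (pnu : posfun nu).
Hypotheses (be : bounded_measurable e) (e0 : forall x, 0 <= e x).
Hypothesis splitT : forall f x, bounded_measurable f -> T f x = K f x + e x * nu f.
Hypotheses (T1 : T (fun=> 1) = fun=> 1) (nu1 : nu (fun=> 1) = 1).

Let bT n f : bounded_measurable f -> bounded_measurable (iter n T f) := @posop_bmf _ _
  _ _ (posop_iter n pT) f.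
Let bK n f : bounded_measurable f -> bounded_measurable (iter n K f) := @posop_bmf _ _
  _ _ (posop_iter n pK) f.

#[local] Hint Extern 0 (bounded_measurable _) => solve [exact: bT | exact: bK | exact:
  bmf_cst] : core.

(** When [T] dominates [e (x) nu], a step of [T] from [x] can be performed by
    drawing the next state from [nu] with probability [e x], and from the residual
    kernel [K] otherwise. The sum runs over the time [j] of the first draw from
    [nu]. *)
Lemma first_regeneration n f x : bounded_measurable f ->
  iter n T f x = iter n K f x +
    \sum_(j < n) iter j K e x * nu (iter (n - j.+1) T f).
Proof.
move=> bf; elim: n x => [|n IH] x; first by rewrite big_ord0 addr0.
rewrite iterS splitT// big_ord_recl/= subSS subn0.
have -> : iter n T f = fun y => iter n K f y +
    \sum_(j < n) nu (iter (n - j.+1) T f) * iter j K e y.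
  by apply/funext => y; rewrite IH; congr (_ + _); apply: eq_bigr => j _; rewrite mulrC.
have pKx := posop_at pK x.
rewrite (posfunD pKx)//; last by apply: bmf_sum => j; exact/bmfZ/bK.
rewrite (posfun_sum pKx); last by move=> j; exact/bmfZ/bK.
rewrite -addrA; congr (_ + _); rewrite addrC; congr (_ + _).
by apply: eq_bigr => j _; rewrite (posfunZ pKx)// mulrC subSS.
Qed.

Lemma residual_one x : K (fun=> 1) x = 1 - e x.
Proof.
have := splitT x (bmf_cst 1); rewrite T1 nu1 mulr1 => h.
by apply/eqP; rewrite eq_sym subr_eq; exact/eqP.
Qed.

(** [iter j K 1] is the probability that no regeneration occurs before time [j],
    and [iter j K e] is the probability that the first one occurs at time [j]. *)
Lemma regeneration_time j x :
  iter j K e x = iter j K (fun=> 1) x - iter j.+1 K (fun=> 1) x.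
Proof.
rewrite iterSr -(posfunB (posop_at (posop_iter j pK) x)).
- by congr (iter j K _ x); apply/funext => y; rewrite residual_one opprB addrC subrK.
- exact: bmf_cst.
- exact: (posop_bmf pK (bmf_cst 1)).
Qed.

Section stationary.
Variable pi : (X -> R) -> R.
Hypotheses (ppi : posfun pi) (pi1 : pi (fun=> 1) = 1).
Hypothesis invT : forall f, bounded_measurable f -> pi (T f) = pi f.

(** Integrating the first regeneration decomposition of [T^(m+1) f] and of the
    constant 1 against the invariant [pi] and subtracting gives
    [\sum_j pi (K^j e) (nu (T^(m-j) f) - pi f) <= pi f * pi (K^(m+1) 1)].
    All terms on the left are nonnegative, hence the one with [j = 0] is already
    bounded by the right-hand side. This positivity replaces the study of the
    zeros of the renewal generating function: the excess over equilibrium decays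
    at least as fast as the tail of the regeneration time. *)
Lemma decay_from_regeneration f m : bounded_measurable f -> (forall x, 0 <= f x) ->
  (forall k, pi f <= nu (iter k T f)) ->
  pi e * (nu (iter m T f) - pi f) <= pi f * pi (iter m.+1 K (fun=> 1)).
Proof.
move=> bf f0 nuf.
have invTn n : pi (iter n T f) = pi f.
  by elim: n => // n IH; rewrite iterS invT//.
have decomp : pi f = pi (iter m.+1 K f) +
    \sum_(j < m.+1) nu (iter (m.+1 - j.+1) T f) * pi (iter j K e).
  rewrite -{1}(invTn m.+1).
  rewrite (_ : iter m.+1 T f = fun x => iter m.+1 K f x +
      \sum_(j < m.+1) nu (iter (m.+1 - j.+1) T f) * iter j K e x); last first.
    apply/funext => x; rewrite first_regeneration//; congr (_ + _).
    by apply: eq_bigr => j _; rewrite mulrC.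
  rewrite (posfunD ppi)//; last by apply: bmf_sum => j; exact/bmfZ/bK.
  rewrite (posfun_sum ppi); last by move=> j; exact/bmfZ/bK.
  by congr (_ + _); apply: eq_bigr => j _; rewrite (posfunZ ppi)//.
have decomp1 : 1 = pi (iter m.+1 K (fun=> 1)) + \sum_(j < m.+1) pi (iter j K e).
  pose t j := pi (iter j K (fun=> 1)).
  have tE j : pi (iter j K e) = t j - t j.+1.
    rewrite -(posfunB ppi)//.
    by congr pi; apply/funext => x; rewrite regeneration_time.
  have -> : \sum_(j < m.+1) pi (iter j K e) = t 0%N - t m.+1.
    elim: m.+1 => [|k IH]; first by rewrite big_ord0 subrr.
    by rewrite big_ord_recr/= IH tE addrA subrK.
  by rewrite addrC subrK /t /= pi1.
have pKe j : 0 <= pi (iter j K e).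
  apply: (posfun_ge0 ppi); first exact: bK.
  by move=> x; apply: (posfun_ge0 (posop_at (posop_iter j pK) x)).
have : \sum_(j < m.+1) (nu (iter (m.+1 - j.+1) T f) - pi f) * pi (iter j K e)
    <= pi f * pi (iter m.+1 K (fun=> 1)).
  under eq_bigr do rewrite mulrBl.
  rewrite sumrB -mulr_sumr.
  have : 0 <= pi (iter m.+1 K f).
    apply: (posfun_ge0 ppi); first exact: bK.
    by move=> x; apply: (posfun_ge0 (posop_at (posop_iter m.+1 pK) x)).
  by move: decomp decomp1; set a := \sum_(_ < _) _; set b := \sum_(_ < _) _; nra.
apply: le_trans; rewrite big_ord_recl/= subSS subn0 mulrC lerDl.
apply: sumr_ge0 => j _; apply: mulr_ge0; last exact: (pKe j.+1).
by rewrite subr_ge0; exact: nuf.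
Qed.

Variable phi : (X -> R) -> R.
Hypotheses (pphi : posfun phi) (phi1 : phi (fun=> 1) = 1).

(** The first regeneration decomposition of [f - pi f]: before regeneration the
    difference is at most 2, afterwards it is controlled by [D]. *)
Lemma mixing_from_regeneration f n (D : nat -> R) :
  bounded_measurable f -> (forall x, `|f x| <= 1) ->
  (forall m, `|nu (iter m T f) - pi f| <= D m) ->
  `|phi (iter n T f) - pi f| <= 2 * phi (iter n K (fun=> 1)) +
    \sum_(j < n) (phi (iter j K (fun=> 1)) - phi (iter j.+1 K (fun=> 1))) *
                 D (n - j.+1)%N.
Proof.
move=> bf f1 nuD.
pose g x := f x - pi f.
have bg : bounded_measurable g by apply: bmfB => //; exact: bmf_cst.
have Tn1 k : iter k T (fun=> 1) = fun=> 1.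
  by elim: k => // k IH; rewrite iterS IH T1.
have Tng k : iter k T g = fun x => iter k T f x - pi f.
  apply/funext => x; have pk := posop_at (posop_iter k pT) x.
  by rewrite (posfunB pk)// (posfun_cst pk) Tn1 mulr1.
have nug k : nu (iter k T g) = nu (iter k T f) - pi f.
  rewrite Tng (posfunB pnu)//.
  by rewrite (posfun_cst pnu) nu1 mulr1.
have -> : phi (iter n T f) - pi f = phi (iter n T g).
  rewrite Tng (posfunB pphi)//.
  by rewrite (posfun_cst pphi) phi1 mulr1.
have pif1 : `|pi f| <= 1 by have := posfun_norm_le ppi bf f1; rewrite pi1 mul1r.
rewrite (_ : iter n T g = fun x => iter n K g x +
    \sum_(j < n) nu (iter (n - j.+1) T g) * iter j K e x); last first.
  apply/funext => x; rewrite first_regeneration//; congr (_ + _).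
  by apply: eq_bigr => j _; rewrite mulrC.
rewrite (posfunD pphi)//; last by apply: bmf_sum => j; exact/bmfZ/bK.
rewrite (posfun_sum pphi); last by move=> j; exact/bmfZ/bK.
rewrite (le_trans (ler_normD _ _))// lerD//.
  have pphiK := posfun_comp pphi (posop_iter n pK).
  apply: (posfun_norm_le pphiK) => // x; rewrite /g.
  by rewrite (le_trans (ler_normB _ _))// -[2]/(1 + 1) lerD.
rewrite (le_trans (ler_norm_sum _ _ _))//; apply: ler_sum => j _.
rewrite (posfunZ pphi)// normrM mulrC nug.
have -> : phi (iter j K (fun=> 1)) - phi (iter j.+1 K (fun=> 1)) = phi (iter j K e).
  rewrite -(posfunB pphi)//.
  by congr phi; apply/funext => x; rewrite regeneration_time.
rewrite ger0_norm; last first.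
  apply: (posfun_ge0 pphi); first exact: bK.
  by move=> x; apply: (posfun_ge0 (posop_at (posop_iter j pK) x)).
apply: ler_wpM2l => //.
apply: (posfun_ge0 pphi); first exact: bK.
by move=> x; apply: (posfun_ge0 (posop_at (posop_iter j pK) x)).
Qed.

End stationary.
End regeneration.

(** * Two facts about real sequences *)

(** Summation by parts; the right-hand side is monotone in the tails [t], which
    can therefore be replaced by upper bounds. *)
Lemma abel_geometric (R : realType) (t : nat -> R) (y : R) n : t 0%N = 1 ->
  \sum_(j < n) (t j - t j.+1) * y ^+ (n - j) + t n =
  y ^+ n + (1 - y) * \sum_(j < n) t j.+1 * y ^+ (n - j.+1).
Proof.
move=> t0; elim: n => [|n IH]; first by rewrite !big_ord0 t0 expr0; ring.
rewrite !big_ord_recr/= subSn// subnn expr1 subnn expr0.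
have -> : \sum_(j < n) (t j - t j.+1) * y ^+ (n.+1 - j) =
    y * \sum_(j < n) (t j - t j.+1) * y ^+ (n - j).
  rewrite mulr_sumr; apply: eq_bigr => j _.
  by rewrite (subSn (ltnW (ltn_ord j))) exprS mulrCA.
have -> : \sum_(j < n) t j.+1 * y ^+ (n.+1 - j.+1) =
    y * \sum_(j < n) t j.+1 * y ^+ (n - j.+1).
  rewrite mulr_sumr; apply: eq_bigr => j _.
  by rewrite (subSn (ltn_ord j)) exprS mulrCA.
rewrite exprS; move: IH.
set s1 := \sum_(_ < _) _; set s2 := \sum_(_ < _) _ => IH.
have -> : s1 = y ^+ n + (1 - y) * s2 - t n by rewrite -IH addrK.
by set p := y ^+ n; ring.
Qed.

(** The squared ratio inequality gives [b k ^+ (2 ^ m) <= b (2 ^ m * k)] for the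
    normalised sequence [b k = a k / (a 0 * z ^+ k)]; if [b k > 1] the left-hand
    side is unbounded in [m]. Thus a geometric bound with some constant holds with
    the optimal constant [a 0]. *)
Lemma geometric_decay_constant (R : realType) (a : nat -> R) (C z : R) :
  0 < z -> (forall k, 0 <= a k) ->
  (forall k, a k ^+ 2 <= a 0%N * a k.*2) ->
  (forall k, a k <= C * z ^+ k) ->
  forall k, a k <= a 0%N * z ^+ k.
Proof.
move=> z0 a0 lc bnd k.
have [//|lt_ak] := leP (a k) (a 0%N * z ^+ k).
have zk m : 0 < z ^+ m by rewrite exprn_gt0.
have a00 : 0 < a 0%N.
  rewrite lt_neqAle a0 andbT eq_sym; apply/negP => /eqP a00.
  have := lc k; rewrite a00 mul0r real_exprn_even_le0//= => /eqP ak.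
  by move: lt_ak; rewrite a00 ak mul0r ltxx.
pose b m := a m / (a 0%N * z ^+ m).
have b2 m : b m ^+ 2 <= b m.*2.
  rewrite /b exprMn exprVn exprMn -exprM muln2 -addnn exprD.
  rewrite ler_pdivrMr; last by rewrite mulr_gt0// ?exprn_gt0// mulr_gt0.
  apply: (le_trans (lc m)); rewrite addnn le_eqVlt; apply/orP; left; apply/eqP.
  by field; rewrite !gt_eqF.
have bC m : b m <= C / a 0%N.
  rewrite /b ler_pdivrMr ?mulr_gt0//; apply: (le_trans (bnd m)).
  by rewrite mulrA divfK ?gt_eqF.
have b1 : 1 < b k by rewrite /b ltr_pdivlMr ?mulr_gt0// mul1r.
have grow m : 1 + m%:R * (b k - 1) <= b (2 ^ m * k)%N.
  suff : 1 + (2 ^ m)%:R * (b k - 1) <= b (2 ^ m * k)%N.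
    apply: le_trans; rewrite lerD2l ler_pM2r ?subr_gt0// ler_nat.
    by rewrite ltnW// ltn_expl.
  elim: m => [|m IH]; first by rewrite expn0 mul1n mul1r addrC subrK.
  rewrite expnS -mulnA (mul2n (2 ^ m * k)) (le_trans _ (b2 _))//.
  have : 0 <= (2 ^ m)%:R * (b k - 1) by rewrite mulr_ge0// subr_ge0 ltW.
  rewrite natrM; move: IH; set u := b (2 ^ m * k)%N; set v := (2 ^ m)%:R => IH v0.
  have : (1 + v * (b k - 1)) ^+ 2 <= u ^+ 2.
    by rewrite !expr2; apply: ler_pM => //; lra.
  by apply: le_trans; nra.
have /archi_boundP : 0 <= (C / a 0%N) / (b k - 1).
  rewrite divr_ge0//; last by rewrite subr_ge0 ltW.
  by rewrite (le_trans _ (bC k))// ltW// (lt_trans _ b1).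
set N := Num.Def.archi_bound _; rewrite ltr_pdivrMr ?subr_gt0// => hN.
by have := le_trans (grow N) (bC _); lra.
Qed.

(** * Exponential moments of hitting times *)

Section indic.
Context {R : realType} {T : Type}.
Lemma indic_in (A : set T) x : A x -> \1_A x = 1 :> R.
Proof. by move=> Ax; rewrite indicE mem_set. Qed.
Lemma indic_notin (A : set T) x : ~ A x -> \1_A x = 0 :> R.
Proof. by move=> Ax; rewrite indicE memNset. Qed.
Lemma indic_ge0 (A : set T) x : 0 <= \1_A x :> R.
Proof. by rewrite indicE. Qed.
Lemma indicC (A : set T) x : \1_(~` A) x = 1 - \1_A x :> R.
Proof.
have [Ax|Ax] := pselect (A x); last by rewrite indic_in// indic_notin// subr0.
by rewrite indic_notin ?indic_in ?subrr//; apply.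
Qed.
End indic.

Section hitting.
Context {R : realType} {d : measure_display} {X : measurableType d}.
Implicit Types (f g : X -> R).
Variables (P : (X -> R) -> X -> R) (A : set X).
Hypotheses (pP : posop P) (P1 : P (fun=> 1) = fun=> 1) (mA : measurable A).

(** The kernel [U] with the transitions from points of [A] removed: for [U = P],
    [iter n (killed P) 1 x] is the probability that the chain started at [x] avoids
    [A] at the times [0, ..., n - 1]. *)
Definition killed (U : (X -> R) -> X -> R) f x : R := \1_(~` A) x * U f x.

Lemma killed_in U f x : A x -> killed U f x = 0.
Proof. by move=> Ax; rewrite /killed indic_notin ?mul0r//; apply. Qed.

Lemma killed_out U f x : ~ A x -> killed U f x = U f x.
Proof. by move=> Ax; rewrite /killed indic_in ?mul1r. Qed.

Lemma posop_killed U : posop U -> posop (killed U).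
Proof.
by move=> pU; apply: posop_mul => //; exact/bmf_indic/measurableC.
Qed.

Let Q := killed P.
Let pQ : posop Q := posop_killed pP.
Let bP f : bounded_measurable f -> bounded_measurable (P f) := @posop_bmf _ _ _ _ pP f.
Let bQ f : bounded_measurable f -> bounded_measurable (Q f) := @posop_bmf _ _ _ _ pQ f.
Let bQn n f : bounded_measurable f -> bounded_measurable (iter n Q f) := @posop_bmf _ _
  _ _ (posop_iter n pQ) f.
Let bA : bounded_measurable (\1_A : X -> R) := bmf_indic mA.
#[local] Hint Extern 0 (bounded_measurable _) => solve [exact: bA | exact: bQn | exact:
  bQ | exact: bP | exact: bmf_cst] : core.

Let Qge0 n f x : bounded_measurable f -> (forall y, 0 <= f y) -> 0 <= iter n Q f x.
Proof. by move=> bf f0; apply: (posfun_ge0 (posop_at (posop_iter n pQ) x)). Qed.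

Let Ple f g x : bounded_measurable f -> bounded_measurable g -> (forall y, f y <=
  g y) -> P f x <= P g x.
Proof. exact: (posfun_le (posop_at pP x)). Qed.

(** The expectation of [lam ^+ min (sigma, n)], with [sigma] the hitting time of
    [A], through its one-step recursion. *)
Definition hitting_gf (lam : R) n : X -> R :=
  iter n (fun v x => \1_A x + lam * Q v x) (fun=> 1).

Let bhit lam n : bounded_measurable (hitting_gf lam n).
Proof. by elim: n => [|n IH] //=; apply: bmfD => //; exact: bmfZ. Qed.

(** With [U] the truncated mean hitting time, [1 + c * U] is a supersolution of
    the recursion that defines [hitting_gf], provided that [U <= M] and
    [c = (1 - lam^-1) / (1 - (1 - lam^-1) * M)]. The value of the bound is
    [1 + c * M]. *)
Lemma hitting_gf_le (lam M : R) : 1 < lam -> (1 - lam^-1) * M < 1 ->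
  (forall n x, \sum_(j < n) iter j.+1 Q (fun=> 1) x <= M) ->
  forall n x, hitting_gf lam n x <= (1 - (1 - lam^-1) * M)^-1.
Proof.
move=> lam1 kM UM n x.
pose U n x := \sum_(j < n) iter j.+1 Q (fun=> 1) x.
have bU m : bounded_measurable (U m) by apply: bmf_sum => j; exact: bQn.
have U0 m y : 0 <= U m y by apply: sumr_ge0 => j _; exact: (@Qge0 j.+1).
have l0 : 0 < lam by lra.
have k0 : 0 < 1 - lam^-1 by rewrite subr_gt0 invf_lt1.
set k := 1 - lam^-1 in kM k0 *.
have D0 : 0 < 1 - k * M by lra.
set D := 1 - k * M in D0 *.
(* the value for which the supersolution inequality is tight at U = M *)
pose c := k / D.
have c0 : 0 < c by rewrite divr_gt0.
have main m y : hitting_gf lam m y <= 1 + c * U m y.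
  elim: m y => [|m IH] y; first by rewrite /= lerDl mulr_ge0// ltW.
  rewrite /hitting_gf iterS -/(hitting_gf lam m).
  have [Ay|Ay] := pselect (A y).
    by rewrite indic_in// /Q killed_in// mulr0 lerD2l mulr_ge0// ltW.
  rewrite indic_notin// add0r /Q killed_out//.
  have UE : U m.+1 y = 1 + P (U m) y.
    rewrite /U big_ord_recl/= /Q killed_out// P1; congr (_ + _).
    rewrite (posfun_sum (posop_at pP y)); last by move=> j; exact: (@bQn j.+1).
    by apply: eq_bigr => j _; rewrite -[LHS]/(Q _ y) /Q killed_out.
  have h1 : P (hitting_gf lam m) y <= 1 + c * P (U m) y.
    have -> : 1 + c * P (U m) y = P (fun x => c * U m x + 1) y.
      by rewrite (posfun_lin (posop_at pP y))// P1 addrC.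
    apply: Ple => //; first by apply: bmfD => //; exact: bmfZ.
    by move=> z; rewrite addrC.
  rewrite (le_trans (ler_wpM2l (ltW l0) h1))// UE.
  have := UM m.+1 y; rewrite -/(U m.+1 y) UE.
  set w := P (U m) y => hw.
  have cD : c * D = k by rewrite /c divfK// gt_eqF.
  have kE : lam * k = lam - 1 by rewrite /k mulrBr mulr1 divff ?gt_eqF.
  have : c * (D - 1 + k * (1 + w)) <= 0.
    rewrite pmulr_rle0// /D.
    have : k * (1 + w) <= k * M by rewrite ler_pM2l.
    by lra.
  move=> h; rewrite -subr_le0.
  have -> : lam * (1 + c * w) - (1 + c * (1 + w)) = lam * (c * (D - 1 + k * (1 + w))).
    have -> : lam * (c * (D - 1 + k * (1 + w))) = lam * (c * D) - lam * c + c * (1 + w)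
      * (lam * k) by ring.
    rewrite cD kE; ring.
  by rewrite pmulr_rle0.
apply: (le_trans (main n x)).
have -> : D^-1 = 1 + c * M by rewrite /c /D; field; rewrite gt_eqF.
by rewrite lerD2l ler_pM2l// UM.
Qed.

Lemma survival_le_hitting_gf lam n x : 0 < lam ->
  lam ^+ n * iter n Q (fun=> 1) x <= hitting_gf lam n x.
Proof.
move=> l0; elim: n x => [|n IH] x; first by rewrite expr0 mul1r.
rewrite /hitting_gf [in leRHS]iterS -/(hitting_gf lam n) exprS -mulrA.
have [Ax|Ax] := pselect (A x).
  by rewrite iterS /Q !killed_in// !mulr0 addr0 indic_ge0.
rewrite indic_notin// add0r ler_pM2l// iterS /Q !killed_out//.
rewrite -(posfunZ (posop_at pP x))//; apply: Ple => //.
by apply: bmfZ => //; apply: bQn.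
Qed.

(** The expectation of [lam ^+ min (sigma', m)], where [sigma'] is the first even
    time ([even = true]) or the first odd time ([even = false]) at which the chain
    is in [A]. *)
Fixpoint even_hitting_gf (lam : R) m (even : bool) (x : X) : R :=
  if m is m'.+1 then
    if even then \1_A x + lam * Q (even_hitting_gf lam m' false) x
    else lam * P (even_hitting_gf lam m' true) x
  else 1.

Let bev lam m b : bounded_measurable (even_hitting_gf lam m b).
Proof. by elim: m b => [|m IH] [] //=; [apply: bmfD => //|]; exact: bmfZ. Qed.

(** The part of the generating function of the hitting time of [A] that comes
    from hitting times smaller than [m] of the given parity. *)
Definition parity_gf (lam : R) m (even : bool) (x : X) : R :=
  \sum_(j < m | odd j == ~~ even) lam ^+ j * iter j Q \1_A x.

Let bpg lam m b : bounded_measurable (parity_gf lam m b).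
Proof. by apply: bmf_sum => j; exact: bmfZ. Qed.

Let pg_ge0 lam m b x : 0 <= lam -> 0 <= parity_gf lam m b x.
Proof.
move=> l0; apply: sumr_ge0 => j _; rewrite mulr_ge0 ?exprn_ge0//.
by apply: Qge0 => // y; exact: indic_ge0.
Qed.

Let pgS lam m b x :
  parity_gf lam m.+1 b x = (if b then \1_A x else 0) + lam * Q (parity_gf lam m (~~ b)) x.
Proof.
rewrite /parity_gf (posfun_sum (posop_at pQ x)); last by move=> j; exact: bmfZ.
rewrite mulr_sumr.
have E : lam * 0 = 0 by rewrite mulr0.
transitivity ((if b then \1_A x else 0) + \sum_(j < m | odd j.+1 == ~~ b)
   lam ^+ j.+1 * iter j.+1 Q \1_A x).
  rewrite big_mkcond big_ord_recl/= expr0 mul1r -big_mkcond/=.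
  by case: b.
congr (_ + _); apply: eq_big => [j|j _] /=; first by case: b; case: (odd j).
by rewrite (posfunZ (posop_at pQ x))// exprS mulrA.
Qed.

(** If the first visit to [A] has the wrong parity, the chain restarts from a
    point of [A] and has to return after an odd number of steps. From [A], an even
    return leaves the parity unchanged and has weight at most [th], so the cost
    [dd] of being in [A] with the wrong parity satisfies
    [dd <= lam * S - th + th * dd]. *)
Lemma even_hitting_gf_le (lam th S : R) : 1 < lam -> 0 <= th -> th < 1 ->
  (forall n x, hitting_gf lam n x <= S) ->
  (forall m x, A x -> \sum_(j < m | odd j) lam ^+ j.+1 * P (iter j Q \1_A) x <= th) ->
  forall m b x, even_hitting_gf lam m b x <= lam * S ^+ 2 / (1 - th).
Proof.
move=> lam1 th0 th1 hS hth m0 b0 x0.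
have l0 : 0 < lam by lra.
have S1 : 1 <= S by exact: (hS 0%N x0).
pose r m x := lam ^+ m * iter m Q (fun=> 1) x.
have br m : bounded_measurable (r m) by apply: bmfZ => //.
have r0 m x : 0 <= r m x by rewrite mulr_ge0 ?exprn_ge0 ?Qge0// ltW.
have rS m x : r m.+1 x = lam * Q (r m) x.
  by rewrite /r (posfunZ (posop_at pQ x))// iterS exprS mulrA.
have total m x : parity_gf lam m true x + parity_gf lam m false x + r m x = hitting_gf
  lam m x.
  elim: m x => [|m IH] x.
    by rewrite /parity_gf !big_ord0 /r expr0 /= !add0r mul1r.
  rewrite !pgS rS /hitting_gf iterS -/(hitting_gf lam m) /=.
  rewrite (_ : hitting_gf lam m = fun y => parity_gf lam m true y + parity_gf lam m
    false y + r m y); last first.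
    by apply/funext => y; rewrite IH.
  have pQx := posop_at pQ x.
  rewrite (posfunD pQx)//; last exact: bmfD.
  rewrite (posfunD pQx)//; ring.
(* the fixed point of dd = lam * S - th + th * dd *)
pose dd := (lam * S - th) / (1 - th).
have dE : dd * (1 - th) = lam * S - th by rewrite /dd divfK// gt_eqF// subr_gt0.
have d1 : 1 <= dd.
  rewrite /dd ler_pdivlMr ?subr_gt0// mul1r lerD2r.
  by rewrite (le_trans (ltW lam1))// ler_peMr // ltW.
have main m : (forall x, even_hitting_gf lam m true x <=
       parity_gf lam m true x + dd * parity_gf lam m false x + r m x) /\
     (forall x, even_hitting_gf lam m false x <=
       parity_gf lam m false x + dd * parity_gf lam m true x + r m x) /\
     (forall x, A x -> even_hitting_gf lam m false x <= dd).
  elim: m => [|m [IHt [IHf IHA]]].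
    split; [|split] => x; last by [].
      by rewrite /parity_gf !big_ord0 /r /= expr0 mul1r; lra.
    by rewrite /parity_gf !big_ord0 /r /= expr0 mul1r; lra.
  have bt : bounded_measurable (fun y => parity_gf lam m true y + dd * parity_gf lam m
    false y + r m y).
    by apply: bmfD => //; apply: bmfD => //; exact: bmfZ.
  have bf : bounded_measurable (fun y => parity_gf lam m false y + dd * parity_gf lam m
    true y + r m y).
    by apply: bmfD => //; apply: bmfD => //; exact: bmfZ.
  have onA x : A x -> even_hitting_gf lam m.+1 false x <= dd.
    move=> Ax /=.
    have h1 : P (even_hitting_gf lam m true) x <= P (hitting_gf lam m) x +
        (dd - 1) * P (parity_gf lam m false) x.
      rewrite -(posfunZ (posop_at pP x))// -(posfunD (posop_at pP x))//; last exact: bmfZ.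
      apply: Ple => //; first by apply: bmfD => //; exact: bmfZ.
      by move=> y; rewrite -total; have := IHt y; lra.
    have h2 : lam * P (parity_gf lam m false) x <= th.
      rewrite (posfun_sum (posop_at pP x)); last by move=> j; exact: bmfZ.
      rewrite mulr_sumr; apply: le_trans (hth m x Ax).
      rewrite le_eqVlt; apply/orP; left; apply/eqP.
      apply: eq_big => [j|j _]; first by rewrite eqb_id.
      by rewrite (posfunZ (posop_at pP x))// exprS mulrA.
    have h3 : P (hitting_gf lam m) x <= S.
      have -> : S = P (fun=> S) x by rewrite (posfun_cst (posop_at pP x)) P1 mulr1.
      by apply: Ple => //; exact: hS.
    have : lam * P (even_hitting_gf lam m true) x <= lam * S + (dd - 1) * th.
      have : (dd - 1) * (lam * P (parity_gf lam m false) x) <= (dd - 1) * th.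
        by rewrite ler_wpM2l// subr_ge0.
      have : lam * P (even_hitting_gf lam m true) x <= lam * (P (hitting_gf lam m) x +
        (dd - 1) * P (parity_gf lam m false) x) by rewrite ler_pM2l.
      have : lam * P (hitting_gf lam m) x <= lam * S by rewrite ler_pM2l.
      by lra.
    by lra.
  split; [|split] => // x.
  - rewrite !pgS rS /=.
    have [Ax|Ax] := pselect (A x).
      by rewrite indic_in// /Q !killed_in// !mulr0 !addr0 mulr0 addr0.
    rewrite indic_notin// !add0r /Q !killed_out//.
    have := Ple x (bev lam m false) bf IHf.
    rewrite (posfunD (posop_at pP x))//; last by apply: bmfD => //; exact: bmfZ.
    rewrite (posfunD (posop_at pP x))//; last exact: bmfZ.
    rewrite (posfunZ (posop_at pP x))//= => h.
    by rewrite [X in _ <= X](_ : _ = lam * (P (parity_gf lam m false) x +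
      dd * P (parity_gf lam m true) x + P (r m) x)); [rewrite ler_pM2l|ring].
  - have [Ax|Ax] := pselect (A x).
      apply: (le_trans (onA x Ax)).
      rewrite !pgS rS indic_in// /Q !killed_in//= !mulr0 !addr0 add0r mulr1.
      by [].
    rewrite !pgS rS /=.
    rewrite indic_notin// !add0r /Q !killed_out//.
    have := Ple x (bev lam m true) bt IHt.
    rewrite (posfunD (posop_at pP x))//; last by apply: bmfD => //; exact: bmfZ.
    rewrite (posfunD (posop_at pP x))//; last exact: bmfZ.
    rewrite (posfunZ (posop_at pP x))//= => h.
    by rewrite [X in _ <= X](_ : _ = lam * (P (parity_gf lam m true) x +
      dd * P (parity_gf lam m false) x + P (r m) x)); [rewrite ler_pM2l|ring].
have dS : dd * S <= lam * S ^+ 2 / (1 - th).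
  rewrite /dd mulrAC ler_pM2r ?invr_gt0 ?subr_gt0//.
  have S0 : 0 <= S by rewrite (le_trans _ S1).
  by rewrite expr2 mulrBl mulrA lerBlDr lerDl mulr_ge0.
apply: le_trans dS.
have {main} [ht [hf _]] := main m0.
have tot := total m0 x0; have hSx := hS m0 x0.
have p1 := pg_ge0 m0 true x0 (ltW l0); have p2 := pg_ge0 m0 false x0 (ltW l0).
have r0x := r0 m0 x0.
have : even_hitting_gf lam m0 b0 x0 <= dd * hitting_gf lam m0 x0.
  rewrite -tot; case: b0.
    apply: (le_trans (ht x0)).
    have : 0 <= (dd - 1) * (parity_gf lam m0 true x0 + r m0 x0).
      by apply: mulr_ge0; [rewrite subr_ge0|exact: addr_ge0].
    by lra.
  apply: (le_trans (hf x0)).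
  have : 0 <= (dd - 1) * (parity_gf lam m0 false x0 + r m0 x0).
    by apply: mulr_ge0; [rewrite subr_ge0|exact: addr_ge0].
  by lra.
by move=> h; apply: (le_trans h); rewrite ler_wpM2l//; lra.
Qed.

Lemma even_hitting_gfSS lam n x :
  even_hitting_gf lam n.+1.*2 true x =
  \1_A x + \1_(~` A) x * (lam ^+ 2 * P (P (even_hitting_gf lam n.*2 true)) x).
Proof.
rewrite doubleS /=; congr (_ + _).
by rewrite /Q /killed (posfunZ (posop_at pP x))//; ring.
Qed.

(** Markov's inequality for the hitting time of [A] by the two-step chain. *)
Lemma even_survival_le lam n x : 0 < lam ->
  lam ^+ n.*2 * iter n (killed (P \o P)) (fun=> 1) x <= even_hitting_gf lam n.*2 true x.
Proof.
have pPP : posop (killed (P \o P)) by apply: posop_killed; exact: posop_comp.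
have bPP k : bounded_measurable (iter k (killed (P \o P)) (fun=> 1)).
  exact: (posop_bmf (posop_iter k pPP) (bmf_cst 1)).
move=> l0; elim: n x => [|n IH] x; first by rewrite expr0 mul1r.
rewrite even_hitting_gfSS.
have [Ax|Ax] := pselect (A x).
  by rewrite iterS killed_in// mulr0 addr_ge0 ?indic_ge0// indic_notin ?mul0r//; apply.
rewrite indic_notin// indic_in// add0r mul1r iterS killed_out//= doubleS.
rewrite -[n.*2.+2]add2n exprD -mulrA ler_pM2l ?exprn_gt0//.
rewrite -(posfunZ (posop_at pP x))// -?(posfunZ (posop_at pP _))//.
have -> : (fun y => lam ^+ n.*2 * P (iter n (killed (P \o P)) (fun=> 1)) y) =
    P (fun y => lam ^+ n.*2 * iter n (killed (P \o P)) (fun=> 1) y).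
  by apply/funext => y; rewrite (posfunZ (posop_at pP y)).
apply: Ple => //; first by apply/bP/bmfZ.
by move=> y; apply: Ple => //; apply: bmfZ.
Qed.

Section regeneration_on_hitting.
Variables (K : (X -> R) -> X -> R) (nu : (X -> R) -> R) (q lam b : R).
Hypotheses (pK : posop K) (pnu : posfun nu) (nu1 : nu (fun=> 1) = 1).
Hypotheses (q0 : 0 <= q) (q1 : q <= 1) (lam1 : 1 < lam).
Hypothesis splitPP : forall f x, bounded_measurable f ->
  P (P f) x = K f x + q * \1_A x * nu f.
Hypothesis hb : forall m c x, even_hitting_gf lam m c x <= b / lam.
Hypothesis b_lt : b < 1 + q * lam ^+ 2.

Let w := q / (1 + q * lam ^+ 2 - b).

(** At each visit of the two-step chain to [A] a regeneration takes place with
    probability [q]. Starting in [A], the generating function [w] of the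
    regeneration time satisfies [w <= q + (b - q * lam ^+ 2) * w]: the excursions
    of the two-step chain from [A] have generating function at most [b], from which
    those that begin with a regeneration are removed; as these take at least one
    transition, their contribution is at least [q * lam ^+ 2]. *)
Lemma split_survival_le n x :
  lam ^+ n.*2 * iter n K (fun=> 1) x <= w * even_hitting_gf lam n.*2 true x.
Proof.
have l0 : 0 < lam := lt_trans ltr01 lam1.
have hq0 := q0; have hq1 := q1; have hb_lt := b_lt.
have z1 : 1 < lam ^+ 2 by rewrite exprn_egt1.
have bKn k : bounded_measurable (iter k K (fun=> 1)).
  exact: (posop_bmf (posop_iter k pK) (bmf_cst 1)).
pose e y := q * \1_A y.
have be : bounded_measurable e by exact: bmfZ.
have e0 y : 0 <= e y by rewrite mulr_ge0// indic_ge0.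
have K1 y : K (fun=> 1) y = 1 - e y.
  have := splitPP y (bmf_cst 1); rewrite !P1 nu1 mulr1 => h.
  by apply/eqP; rewrite eq_sym subr_eq; exact/eqP.
have bL k : bounded_measurable (even_hitting_gf lam k true) by [].
have L1 k y : 1 <= even_hitting_gf lam k.*2 true y.
  elim: k y => [|k IH] y //; rewrite even_hitting_gfSS.
  have [Ay|Ay] := pselect (A y).
    by rewrite indic_in// indic_notin ?mul0r ?addr0//; apply.
  rewrite indic_notin// indic_in// add0r mul1r.
  have : 1 <= P (P (even_hitting_gf lam k.*2 true)) y.
    have -> : 1 = P (P (fun=> 1)) y by rewrite !P1.
    by apply: Ple => // u; apply: Ple.
  by move=> h; rewrite -[1]mulr1 ler_pM// ltW.
have onA k y : lam ^+ 2 * P (P (even_hitting_gf lam k.*2 true)) y <= b.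
  have -> : lam ^+ 2 * P (P (even_hitting_gf lam k.*2 true)) y =
      lam * P (even_hitting_gf lam k.*2.+1 false) y.
    by rewrite /= (posfunZ (posop_at pP y))//; ring.
  have : P (even_hitting_gf lam k.*2.+1 false) y <= b / lam.
    have -> : b / lam = P (fun=> b / lam) y.
      by rewrite (posfun_cst (posop_at pP y)) P1 mulr1.
    by apply: Ple.
  by rewrite ler_pdivlMr// mulrC.
have bz : lam ^+ 2 <= b.
  apply: le_trans (onA 0%N x).
  by rewrite /= !P1 mulr1.
have q_gt0 : 0 < q.
  rewrite lt_neqAle q0 andbT; apply/negP => /eqP q00.
  by move: hb_lt; rewrite -q00 mul0r addr0; lra.
have D0 : 0 < 1 + q * lam ^+ 2 - b by lra.
have wE : w * (1 + q * lam ^+ 2 - b) = q by rewrite /w divfK// gt_eqF.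
have w1 : 1 <= w.
  rewrite /w ler_pdivlMr// mul1r.
  have : 0 <= (1 - q) * (lam ^+ 2 - 1) by rewrite mulr_ge0// subr_ge0// ltW.
  by lra.
(* generating function of the regeneration time, stopped after k two-step transitions *)
pose Z := fun k => iter k (fun v y => e y + lam ^+ 2 * K v y) (fun=> 1).
have bZ k : bounded_measurable (Z k).
  elim: k => [|k IH] //=; apply: bmfD => //; apply: bmfZ; exact: (posop_bmf pK).
have ZS k y : Z k.+1 y = e y + lam ^+ 2 * K (Z k) y by [].
have Z1 k y : 1 <= Z k y.
  elim: k y => [|k IH] y //; rewrite ZS.
  have : K (fun=> 1) y <= K (Z k) y by apply: (posfun_le (posop_at pK y)).
  have K10 : 0 <= K (fun=> 1) y by apply: (posfun_ge0 (posop_at pK y)).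
  rewrite K1 in K10 *.
  move=> h; have : lam ^+ 2 * (1 - e y) <= lam ^+ 2 * K (Z k) y by rewrite ler_pM2l//
    (lt_trans _ z1).
  have : 0 <= (lam ^+ 2 - 1) * (1 - e y) by rewrite mulr_ge0// subr_ge0 ltW.
  by lra.
have main k y : Z k y <= w * even_hitting_gf lam k.*2 true y.
  elim: k y => [|k IH] y; first by rewrite /= mulr1.
  rewrite ZS even_hitting_gfSS.
  have KZ : K (Z k) y <= w * K (even_hitting_gf lam k.*2 true) y.
    rewrite -(posfunZ (posop_at pK y))//.
    by apply: (posfun_le (posop_at pK y)) => //; exact: bmfZ.
  have z0 : 0 < lam ^+ 2 by lra.
  have [Ay|Ay] := pselect (A y).
    rewrite /e (indic_in Ay) indic_notin; last by apply.
    rewrite mul0r addr0 !mulr1.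
    have h1 := onA k y.
    have h2 := splitPP y (bL k.*2).
    rewrite (indic_in Ay) mulr1 in h2.
    have h3 : 1 <= nu (even_hitting_gf lam k.*2 true).
      by rewrite -nu1; apply: (posfun_le pnu).
    have h4 : lam ^+ 2 * K (Z k) y <= w * (b - lam ^+ 2 * q).
      apply: (le_trans (ler_wpM2l (ltW z0) KZ)).
      rewrite mulrCA ler_pM2l; last by rewrite (lt_le_trans _ w1).
      have : lam ^+ 2 * (q * 1) <= lam ^+ 2 * (q * nu (even_hitting_gf lam k.*2 true)).
        by rewrite ler_pM2l// ler_pM2l.
      rewrite h2 mulrDr in h1.
      by lra.
    by lra.
  rewrite /e (indic_notin Ay) indic_in// mulr0 !add0r mul1r.
  have -> : P (P (even_hitting_gf lam k.*2 true)) y = K (even_hitting_gf lam k.*2 true) y.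
    by rewrite splitPP// indic_notin// mulr0 mul0r addr0.
  by rewrite mulrCA ler_pM2l.
apply: le_trans (main n x).
elim: n x => [|n IH] x; first by rewrite expr0 mul1r.
rewrite ZS iterS doubleS -[n.*2.+2]add2n exprD -mulrA.
have z0 : 0 < lam ^+ 2 by lra.
apply: (@le_trans _ _ (lam ^+ 2 * K (Z n) x)); last by rewrite lerDr.
rewrite ler_pM2l// -(posfunZ (posop_at pK x))//.
by apply: (posfun_le (posop_at pK x)) => //; exact: bmfZ.
Qed.

(** The odd exponent in the second bound accounts for one step of [P] taken
    before the two-step chain starts. *)
Lemma split_survival_bounds n x :
  lam ^+ n.*2 * iter n K (fun=> 1) x <= w * b / lam /\
  lam ^+ n.*2.+1 * P (iter n K (fun=> 1)) x <= w * b / lam.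
Proof.
have l0 : 0 < lam := lt_trans ltr01 lam1.
have hb_lt := b_lt.
have q_ge0 : 0 <= w by rewrite divr_ge0//; lra.
have bKn k : bounded_measurable (iter k K (fun=> 1)).
  exact: (posop_bmf (posop_iter k pK) (bmf_cst 1)).
split.
  apply: (le_trans (split_survival_le n x)).
  by rewrite -mulrA ler_wpM2l.
have : P (fun y => lam ^+ n.*2 * iter n K (fun=> 1) y) x <=
    P (fun y => w * even_hitting_gf lam n.*2 true y) x.
  apply: Ple => //; [exact: bmfZ|exact: bmfZ|].
  by move=> y; exact: split_survival_le.
rewrite !(posfunZ (posop_at pP x))// exprS -mulrA -(ler_pM2l l0) => h.
apply: (le_trans h); rewrite mulrCA -[X in _ <= X]mulrA ler_wpM2l//.
exact: (hb n.*2.+1 false x).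
Qed.

End regeneration_on_hitting.

End hitting.

(** * Perturbation of iterates and of invariant measures *)

Section distances.
Context {R : realType} {d : measure_display} {X : measurableType d}.
Implicit Types (f g : X -> R) (mu nu : {measure set X -> \bar R}).

Lemma avg_le_var_dist mu nu f : mu setT = 1%E -> nu setT = 1%E ->
  bounded_measurable f -> (forall x, `|f x| <= 1) ->
  (`|\int[mu]_x f x - \int[nu]_x f x|%:E <= var_dist mu nu)%E.
Proof.
move=> mu1 nu1 bf f1; apply: ereal_sup_ubound; exists f; first by split; case: bf.
by rewrite -!EFin_avg// -EFinB.
Qed.

Lemma var_dist_le mu nu r : mu setT = 1%E -> nu setT = 1%E ->
  (forall f, bounded_measurable f -> (forall x, `|f x| <= 1) ->
    `|\int[mu]_x f x - \int[nu]_x f x| <= r) ->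
  (var_dist mu nu <= r%:E)%E.
Proof.
move=> mu1 nu1 h; apply: ge_ereal_sup => _ [f [mf f1] <-].
have bf : bounded_measurable f by split=> //; exists 1.
by rewrite -!EFin_avg// -EFinB/= lee_fin h.
Qed.

Variables (P Pt : R.-pker X ~> X) (pi : probability X R).

Lemma ker_dist_ge0 : (0 <= ker_dist Pt P)%E.
Proof.
apply: (@le_trans _ _ (var_dist (Pt point) (P point))).
  apply: (le_trans _ (@avg_le_var_dist _ _ (fun=> 0) _ _ _ _)) => //.
  - exact: prob_kerT.
  - exact: prob_kerT.
  - exact: bmf_cst.
  - by move=> x; rewrite normr0.
by apply: ereal_sup_ubound; exists point.
Qed.

Lemma ker_dist_fin_num : ker_dist Pt P \is a fin_num.
Proof.
rewrite ge0_fin_numE ?ker_dist_ge0//; apply: (@le_lt_trans _ _ 2%:E); last by rewrite ltry.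
apply: ge_ereal_sup => _ [x _ <-]; apply: var_dist_le; try exact: prob_kerT.
move=> f bf f1; rewrite (le_trans (ler_normB _ _))// -[2]/(1 + 1) lerD//.
- have := posfun_norm_le (posfun_avg (prob_kerT Pt x)) bf f1.
  by rewrite avg1 ?mulr1//; exact: prob_kerT.
- have := posfun_norm_le (posfun_avg (prob_kerT P x)) bf f1.
  by rewrite avg1 ?mulr1//; exact: prob_kerT.
Qed.

Let Delta := fine (ker_dist Pt P).

Let Delta_ge0 : 0 <= Delta.
Proof. by rewrite fine_ge0// ker_dist_ge0. Qed.

Lemma kop_dist_le f c x : bounded_measurable f -> 0 <= c -> (forall y, `|f y| <= c) ->
  `|kop Pt f x - kop P f x| <= c * Delta.
Proof.
move=> bf c0 fc; have := c0; rewrite le_eqVlt => /predU1P[c00|cpos].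
  rewrite -c00 mul0r normr_le0.
  have -> : f = fun=> 0.
    by apply/funext => y; apply/eqP; rewrite -normr_le0 c00 fc.
  by rewrite (posfun0 (posop_at (posop_kop Pt) x)) (posfun0 (posop_at (posop_kop P) x))
    subrr.
have bg : bounded_measurable (fun y => c^-1 * f y) by exact: bmfZ.
have g1 y : `|c^-1 * f y| <= 1.
  by rewrite normrM gtr0_norm ?invr_gt0// mulrC ler_pdivrMr// mul1r.
have : `|kop Pt (fun y => c^-1 * f y) x - kop P (fun y => c^-1 * f y) x| <= Delta.
  rewrite -lee_fin /Delta fineK ?ker_dist_fin_num//.
  apply: (@le_trans _ _ (var_dist (Pt x) (P x))).
    by apply: avg_le_var_dist => //; exact: prob_kerT.
  by apply: ereal_sup_ubound; exists x.
rewrite (posfunZ (posop_at (posop_kop Pt) x))// (posfunZ (posop_at (posop_kop P) x))//.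
by rewrite -mulrBr normrM gtr0_norm ?invr_gt0// mulrC ler_pdivrMr// mulrC.
Qed.

Variable beta : nat -> R.
Hypothesis hbeta : forall k x f, bounded_measurable f -> (forall y, `|f y| <= 1) ->
  `|iter k (kop P) f x - \int[pi]_y f y| <= beta k.

Let beta_ge0 k : 0 <= beta k.
Proof.
apply: (le_trans _ (@hbeta k point (fun=> 0) _ _)) => //; first exact: bmf_cst.
by move=> y; rewrite normr0.
Qed.

(** In [Pt^(n+1) - P^(n+1) = Pt (Pt^n - P^n) + (Pt - P) P^n] the last factor
    [P^n f] can be replaced by [P^n f - pi f], since [Pt - P] vanishes on
    constants. *)
Lemma iter_kop_dist_le n x f : bounded_measurable f -> (forall y, `|f y| <= 1) ->
  `|iter n (kop Pt) f x - iter n (kop P) f x| <= (\sum_(k < n) beta k) * Delta.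
Proof.
move=> bf f1; elim: n x => [|n IH] x; first by rewrite big_ord0 mul0r subrr normr0.
have pPt := posop_at (posop_kop Pt) x; have pP := posop_at (posop_kop P) x.
have bt : bounded_measurable (iter n (kop Pt) f) := posop_bmf (posop_iter n (posop_kop
  Pt)) bf.
have bp : bounded_measurable (iter n (kop P) f) := posop_bmf (posop_iter n (posop_kop
  P)) bf.
set c := \int[pi]_y f y.
have -> : iter n.+1 (kop Pt) f x - iter n.+1 (kop P) f x =
   kop Pt (fun y => iter n (kop Pt) f y - iter n (kop P) f y) x +
   (kop Pt (fun y => iter n (kop P) f y - c) x - kop P (fun y => iter n (kop P) f y - c) x).
  rewrite !iterS (posfunB pPt)// (posfunB pPt)//; last exact: bmf_cst.
  rewrite (posfunB pP)//; last exact: bmf_cst.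
  by rewrite (posfun_cst pPt) (posfun_cst pP) !kop1; ring.
rewrite (le_trans (ler_normD _ _))// big_ord_recr/= mulrDl lerD//.
  have := posfun_norm_le pPt (bmfB bt bp) IH.
  by rewrite kop1 mulr1.
apply: kop_dist_le => //; first by apply: bmfB => //; exact: bmf_cst.
by move=> y; exact: hbeta.
Qed.

Lemma ker_dist_iter_le n :
  (ker_dist (kiter Pt n) (kiter P n) <= (\sum_(k < n) beta k)%:E * ker_dist Pt P)%E.
Proof.
rewrite -(fineK ker_dist_fin_num) -/Delta -EFinM.
apply: ge_ereal_sup => _ [x _ <-]; apply: var_dist_le; try exact: kiterT.
move=> f bf f1.
rewrite -/(kop (kiter Pt n) f x) -/(kop (kiter P n) f x) !kop_kiter//.
exact: iter_kop_dist_le.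
Qed.

Variables (pit : probability X R) (S : R).
Hypothesis hpit : invariant_prob Pt pit.
Hypothesis hS : (fun n => \sum_(k < n) beta k) @ \oo --> S.

(** [pit] is invariant for every [Pt^n], so its distance to [pi] is at most that
    of [Pt^n] to [P^n] plus that of [P^n] to [pi]. The latter is [beta n], a
    difference of partial sums, and vanishes in the limit. *)
Lemma invariant_dist_le : (var_dist pit pi <= S%:E * ker_dist Pt P)%E.
Proof.
rewrite -(fineK ker_dist_fin_num) -/Delta -EFinM.
have pT := @probability_setT _ _ _ pi; have ptT := @probability_setT _ _ _ pit.
apply: var_dist_le => // f bf f1.
pose s n := \sum_(k < n) beta k.
have step n : `|\int[pit]_x f x - \int[pi]_x f x| <= s n * Delta + (s n.+1 - s n).
  have bt : bounded_measurable (iter n (kop Pt) f) := posop_bmf (posop_iter n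
    (posop_kop Pt)) bf.
  have bp : bounded_measurable (iter n (kop P) f) := posop_bmf (posop_iter n (posop_kop
    P)) bf.
  have ppt := posfun_avg ptT.
  have -> : \int[pit]_x f x = \int[pit]_x iter n (kop Pt) f x.
    elim: n {bp} bt => // n IH _.
    have b' : bounded_measurable (iter n (kop Pt) f) := posop_bmf (posop_iter n
      (posop_kop Pt)) bf.
    by rewrite iterS invariantE// -IH.
  set c := \int[pi]_x f x.
  have -> : \int[pit]_x iter n (kop Pt) f x - c =
     \int[pit]_x (iter n (kop Pt) f x - iter n (kop P) f x) +
     \int[pit]_x (iter n (kop P) f x - c).
    rewrite (posfunB ppt)// (posfunB ppt)//; last exact: bmf_cst.
    by rewrite (posfun_cst ppt) avg1//; ring.
  rewrite (le_trans (ler_normD _ _))// lerD//.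
    have := posfun_norm_le ppt (bmfB bt bp) (fun x => iter_kop_dist_le n x bf f1).
    by rewrite avg1// mulr1.
  rewrite /s big_ord_recr/= addrAC subrr add0r.
  have bpc : bounded_measurable (fun x => iter n (kop P) f x - c) by apply: bmfB => //;
    exact: bmf_cst.
  have := posfun_norm_le ppt bpc (fun x => hbeta n x bf f1).
  by rewrite avg1// mulr1.
have lim : (fun n => s n * Delta + (s n.+1 - s n)) @ \oo --> S * Delta + (S - S).
  apply: cvgD; first by apply: cvgMl.
  apply: cvgB => //.
  by have := hS; rewrite -(cvg_shiftS s).
rewrite subrr addr0 in lim.
rewrite -(cvg_lim _ lim)//; apply: limr_ge; first by apply/cvg_ex; exists (S * Delta).
by near=> n; exact: step.
Unshelve. all: by end_near. Qed.

End distances.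

(** * Laws of hitting and return times of the chain *)

Section chain_law.
Context {R : realType} {d d' : measure_display}.
Context {X : measurableType d} {Omega : measurableType d'}.
Variables (P : R.-pker X ~> X) (Pr : X -> probability Omega R).
Variables (Phi : nat -> Omega -> X) (A : set X).
Hypotheses (hchain : markov_chain P Pr Phi) (mA : measurable A).

Let mPhi n : measurable_fun setT (Phi n) := mc_measurable hchain n.
Let pP : posop (kop P) := posop_kop P.
Let Q := killed A (kop P).
Let pQ : posop Q := posop_killed mA pP.
Let PrT x : Pr x setT = 1%E := @probability_setT _ _ _ (Pr x).
Let pE x : posfun (fun f : Omega -> R => \int[Pr x]_w f w) := posfun_avg (PrT x).

Let mPhiB n B : measurable B -> measurable (Phi n @^-1` B).
Proof. by move=> mB; rewrite -[X in measurable X]setTI; exact: mPhi. Qed.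

Let bPhi n (f : X -> R) : bounded_measurable f -> bounded_measurable (fun w => f (Phi n w)).
Proof. by move=> bf; exact: (bmf_comp (mPhi n) bf). Qed.

Let bP f : bounded_measurable f -> bounded_measurable (kop P f) := @posop_bmf _ _ _ _ pP f.
Let bQ f : bounded_measurable f -> bounded_measurable (Q f) := @posop_bmf _ _ _ _ pQ f.
Let bQn n f : bounded_measurable f -> bounded_measurable (iter n Q f) := @posop_bmf _ _
  _ _ (posop_iter n pQ) f.

Lemma natural_filtration_event n k B : (k <= n)%N -> measurable B ->
  natural_filtration Phi n (Phi k @^-1` B).
Proof. by move=> kn mB; apply: sub_sigma_algebra; exists k, B. Qed.

Lemma natural_filtrationI n E F : natural_filtration Phi n E ->
  natural_filtration Phi n F -> natural_filtration Phi n (E `&` F).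
Proof. exact: (@measurableI _ (g_sigma_algebraType _)). Qed.

Lemma natural_filtration_le m n E : (m <= n)%N -> natural_filtration Phi m E ->
  natural_filtration Phi n E.
Proof.
move=> mn; apply: sub_sigma_algebra2 => _ [k [B [km mB ->]]].
by exists k, B; split => //; exact: leq_trans mn.
Qed.

Lemma natural_filtration_measurable n E : natural_filtration Phi n E -> measurable E.
Proof.
apply: smallest_sub; first exact: sigma_algebra_measurable.
by move=> _ [k [B [_ mB ->]]]; exact: mPhiB.
Qed.

(** The defining property of the chain is the case where [g] is an indicator. *)
Lemma markov_property x n E g : natural_filtration Phi n E -> bounded_measurable g ->
  \int[Pr x]_w (\1_E w * g (Phi n.+1 w)) =
  \int[Pr x]_w (\1_E w * kop P g (Phi n w)).
Proof.
move=> FE bg; have mE := natural_filtration_measurable FE.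
have bE : bounded_measurable (\1_E : Omega -> R) := bmf_indic mE.
have E0 w : 0 <= \1_E w :> R := indic_ge0 E w.
have posPhi k : posfun (fun u : X -> R => \int[Pr x]_w (\1_E w * u (Phi k w))).
  split=> [a u v bu bv|u bu u0]; last by apply: Rintegral_ge0 => w _; rewrite mulr_ge0.
  rewrite -(posfun_lin (posfun_mul (pE x) bE E0)); try exact: bPhi.
  by [].
apply: (posfun_eq_of_sets (posPhi n.+1) (posfun_comp (posPhi n) pP)) => // B mB.
transitivity (fine (Pr x (E `&` Phi n.+1 @^-1` B))).
  rewrite -avg_indic; last by apply: measurableI => //; exact: mPhiB.
  by apply: eq_Rintegral => w _; rewrite indicI.
rewrite (mc_step hchain x FE mB) integral_mkcond /Rintegral; congr fine.
apply: eq_integral => w _; rewrite /patch; case: ifPn => wE.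
  by rewrite indicE wE mul1r kop_indic// fineK//; exact: pker_fin_num.
by rewrite indicE (negbTE wE) mul0r.
Qed.

Lemma initial_law x g : bounded_measurable g -> \int[Pr x]_w g (Phi 0 w) = g x.
Proof.
move=> bg.
have pos0 : posfun (fun u : X -> R => \int[Pr x]_w u (Phi 0 w)).
  split=> [a u v bu bv|u bu u0]; last exact: Rintegral_ge0.
  by rewrite -(posfun_lin (pE x)); try exact: bPhi.
have posx : posfun (fun u : X -> R => u x) by split.
apply: (posfun_eq_of_sets pos0 posx) => // B mB.
transitivity (fine (Pr x (Phi 0%N @^-1` B))).
  by rewrite -avg_indic; [|exact: mPhiB].
by rewrite (mc_init hchain)// diracE indicE.
Qed.

Definition avoid j : set Omega := [set w | forall i, (1 <= i <= j)%N -> ~ A (Phi i w)].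

Lemma avoid0 : avoid 0 = setT.
Proof. by apply/seteqP; split => // w _ [|i]. Qed.

Lemma avoidS j : avoid j.+1 = avoid j `&` Phi j.+1 @^-1` (~` A).
Proof.
apply/seteqP; split => w /=.
  move=> h; split; last by apply: (h j.+1); rewrite /= leqnn.
  by move=> i /andP[i1 ij]; apply: h; rewrite i1 ltnW.
move=> [h hj] i /andP[i1]; rewrite leq_eqVlt => /predU1P[->//|ij].
by apply: h; rewrite i1.
Qed.

Lemma natural_filtration_avoid j : natural_filtration Phi j (avoid j).
Proof.
elim: j => [|j IH].
  by rewrite avoid0; exact: (@measurableT _ (g_sigma_algebraType _)).
rewrite avoidS; apply: natural_filtrationI; first exact: natural_filtration_le IH.
by apply: natural_filtration_event => //; exact: measurableC.
Qed.

(** One step of the Markov property at a time, the last one first: the factor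
    [\1_(~` A) (Phi j.+1)] and the following transition are absorbed in [g]. *)
Lemma avoid_law x C j g : measurable C -> bounded_measurable g ->
  \int[Pr x]_w (\1_(Phi 0%N @^-1` C `&` avoid j) w * kop P g (Phi j w)) =
  \1_C x * kop P (iter j Q g) x.
Proof.
move=> mC; elim: j g => [|j IH] g bg.
  rewrite avoid0 setIT -(@initial_law x (fun y => \1_C y * kop P g y))//.
  by apply: bmfM; [exact: bmf_indic|exact: bP].
rewrite iterSr -IH; last exact: bQ.
have FC k : natural_filtration Phi k (Phi 0%N @^-1` C `&` avoid k).
  apply: natural_filtrationI; last exact: natural_filtration_avoid.
  exact: natural_filtration_event.
rewrite -(markov_property x (FC j) (bQ bg)).
apply: eq_Rintegral => w _; rewrite avoidS setIA indicI /= -mulrA.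
congr (_ * _); rewrite /Q /killed.
Qed.

Lemma ereal_inf_nat_min (p : set nat) m : p m -> (forall k, p k -> (m <= k)%N) ->
  ereal_inf [set n%:R%:E | n in p] = m%:R%:E :> \bar R.
Proof.
move=> pm hm; apply/eqP; rewrite eq_le; apply/andP; split.
  by apply: ereal_inf_lbound; exists m.
by apply: le_ereal_inf_tmp => _ [k pk <-]; rewrite lee_fin ler_nat hm.
Qed.

(** The infimum that defines the return time is attained, because it is taken
    over a set of natural numbers. *)
Lemma hit_tau_event n :
  [set w | hit_tau Phi A w = n.+1%:R%:E :> \bar R] = avoid n `&` Phi n.+1 @^-1` A.
Proof.
apply/seteqP; split => w /=.
  move=> hw.
  have [k [k1 Ak]] : exists k, (1 <= k)%N /\ A (Phi k w).
    apply/not_existsP => hn; move: hw; rewrite /hit_tau.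
    rewrite (_ : [set _ | _] = set0) ?image_set0 ?ereal_inf0//.
    by apply/seteqP; split => // k /hn.
  have exk : exists k, (1 <= k)%N && `[< A (Phi k w) >].
    by exists k; rewrite k1; exact/asboolP.
  have [m /andP[m1 /asboolP Am] mmin] := ex_minnP exk.
  have mm k' : (1 <= k')%N /\ A (Phi k' w) -> (m <= k')%N.
    by move=> [k'1 Ak']; apply: mmin; rewrite k'1; exact/asboolP.
  move: hw; rewrite /hit_tau (@ereal_inf_nat_min _ m)// => -[] /eqP.
  rewrite eqr_nat => /eqP mn; split; last by rewrite -mn.
  move=> i /andP[i1 iN] Ai; have := mm i (conj i1 Ai).
  by rewrite mn ltnNge iN.
move=> [hav hA]; apply: ereal_inf_nat_min => // k [k1 Ak].
by rewrite ltnNge; apply/negP => kn; apply: (hav k) => //; rewrite k1.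
Qed.

Lemma first_returnE x n :
  first_return Pr Phi n.+1 x A = (kop P (iter n Q \1_A) x)%:E.
Proof.
have bA : bounded_measurable (\1_A : X -> R) := bmf_indic mA.
have -> : kop P (iter n Q \1_A) x = \1_setT x * kop P (iter n Q \1_A) x.
  by rewrite indicT mul1r.
rewrite -avoid_law// -markov_property//; last first.
  rewrite preimage_setT setTI; exact: natural_filtration_avoid.
rewrite /first_return hit_tau_event preimage_setT setTI.
have mE : measurable (avoid n `&` Phi n.+1 @^-1` A).
  apply: measurableI; last exact: mPhiB.
  exact: (natural_filtration_measurable (@natural_filtration_avoid n)).
transitivity ((fine (Pr x (avoid n `&` Phi n.+1 @^-1` A)))%:E).
  by rewrite fineK//; exact: fin_num_measure.
rewrite -avg_indic//.
by congr EFin; apply: eq_Rintegral => w _; rewrite indicI.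
Qed.

(** The hitting time is the infimum over [n] of the functions equal to [n] on
    [Phi n \in A] and to [+oo] elsewhere. *)
Lemma measurable_hit_sigma :
  measurable_fun setT (hit_sigma Phi A : Omega -> \bar R).
Proof.
(* by the convention +oo * 0 = 0, u n w is n when Phi n w is in A and +oo otherwise *)
pose u (n : nat) (w : Omega) : \bar R :=
  (n%:R%:E + +oo * (\1_(~` A) (Phi n w))%:E)%E.
have uA n w : A (Phi n w) -> u n w = n%:R%:E.
  by move=> h; rewrite /u indic_notin ?mule0 ?adde0//; apply.
have uN n w : ~ A (Phi n w) -> u n w = +oo%E.
  by move=> h; rewrite /u indic_in// mule1 addey.
rewrite (_ : hit_sigma Phi A = fun w => einfs (u ^~ w) 0%N).
  apply: measurable_fun_einfs => k; apply: emeasurable_funD => //.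
  apply: measurable_funeM; apply/measurable_EFinP.
  by have [] := bPhi k (bmf_indic (measurableC mA)).
apply/funext => w; rewrite /einfs/=; apply/eqP; rewrite eq_le; apply/andP; split.
  apply: le_ereal_inf_tmp => _ [k _ <-].
  have [h|h] := pselect (A (Phi k w)); last by rewrite uN// leey.
  by rewrite uA//; apply: ereal_inf_lbound; exists k.
apply: le_ereal_inf_tmp => _ [k /= h <-].
by rewrite -(uA k w)//; apply: ereal_inf_lbound; exists k.
Qed.

(** The sum of the indicators of the events that the hitting time exceeds [j],
    for [j < N], is the minimum of the hitting time and [N]. *)
Lemma mean_hit_partial N x :
  ((\sum_(j < N) iter j.+1 Q (fun=> 1) x)%:E <= \int[Pr x]_w hit_sigma Phi A w)%E.
Proof.
pose E j := Phi 0%N @^-1` (~` A) `&` avoid j.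
have mE j : measurable (E j).
  apply: measurableI; first exact/mPhiB/measurableC.
  exact: (natural_filtration_measurable (@natural_filtration_avoid j)).
have bs : bounded_measurable (fun w => \sum_(j < N) \1_(E j) w : R).
  by apply: bmf_sum => j; exact: bmf_indic.
have -> : \sum_(j < N) iter j.+1 Q (fun=> 1) x = \int[Pr x]_w \sum_(j < N) \1_(E j) w.
  rewrite (posfun_sum (pE x)); last by move=> j; exact: bmf_indic.
  apply: eq_bigr => j _; rewrite /= /Q /killed -avoid_law//; last 2 first.
  - exact: measurableC.
  - exact: bmf_cst.
  by apply: eq_Rintegral => w _; rewrite kop1 mulr1.
rewrite (EFin_avg (PrT x) bs); apply: ge0_le_integral => //.
- by move=> w _; rewrite lee_fin sumr_ge0// => j _; exact: indic_ge0.
- by apply/measurable_EFinP; case: bs.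
- exact: measurable_hit_sigma.
move=> w _; apply: le_ereal_inf_tmp => _ [k /= Ak <-]; rewrite lee_fin.
have E0 j : (k <= j)%N -> \1_(E j) w = 0 :> R.
  move=> kj; rewrite indic_notin// => -[h0 hav].
  by case: k Ak kj => [|k] Ak kj; [exact: h0|exact: (hav k.+1)].
elim: N {bs} => [|N IH]; first by rewrite big_ord0.
have [kN|Nk] := leqP k N; first by rewrite big_ord_recr/= E0// addr0.
apply: (@le_trans _ _ (N.+1)%:R); last by rewrite ler_nat.
rewrite -[leRHS](_ : \sum_(j < N.+1) 1 = _); last by rewrite sumr_const card_ord.
by apply: ler_sum => j _; rewrite indicE; case: (_ \in _).
Qed.

Lemma hit_sigma_ge0 w : (0 <= hit_sigma Phi A w :> \bar R)%E.
Proof. by apply: le_ereal_inf_tmp => _ [k _ <-]; rewrite lee_fin. Qed.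

Lemma sup_mean_hit_ge0 : (0 <= sup_mean_hit Pr Phi A)%E.
Proof.
apply: (@le_trans _ _ (\int[Pr point]_w hit_sigma Phi A w)%E).
  by apply: integral_ge0 => w _; exact: hit_sigma_ge0.
by apply: ereal_sup_ubound; exists point.
Qed.

Lemma sum_survival_le N x : (sup_mean_hit Pr Phi A < +oo)%E ->
  \sum_(j < N) iter j.+1 Q (fun=> 1) x <= fine (sup_mean_hit Pr Phi A).
Proof.
move=> fin; rewrite -lee_fin fineK; last by rewrite ge0_fin_numE ?sup_mean_hit_ge0.
apply: (le_trans (mean_hit_partial N x)).
by apply: ereal_sup_ubound; exists x.
Qed.

Let even_term_ge0 (s : R) n x : 0 <= s ->
  (0 <= (s ^+ (2 * n))%:E * first_return Pr Phi (2 * n) x A)%E.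
Proof.
by move=> s0; rewrite mule_ge0 ?lee_fin ?exprn_ge0// /first_return measure_ge0.
Qed.

Let even_partial (s : R) N x :
  (\sum_(1 <= n < N.+1) (s ^+ (2 * n))%:E * first_return Pr Phi (2 * n) x A)%E =
  (\sum_(j < N.*2 | odd j) s ^+ j.+1 * kop P (iter j Q \1_A) x)%:E.
Proof.
elim: N => [|N IH]; first by rewrite big_geq// big_ord0.
have oddS (F : nat -> R) : \sum_(j < N.+1.*2 | odd j) F j =
    \sum_(j < N.*2 | odd j) F j + F N.*2.+1.
  rewrite doubleS [LHS]big_mkcond !big_ord_recr/= -big_mkcond/=.
  by rewrite odd_double/= addr0.
rewrite big_nat_recr//= IH (oddS (fun j => s ^+ j.+1 * kop P (iter j Q \1_A) x)).
by rewrite mulnS add2n first_returnE mul2n EFinD EFinM.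
Qed.

(** The partial sums over even return times [2 n] are re-indexed by [j = 2 n - 1],
    the number of times spent outside [A] before the return. *)
Lemma even_return_ub (s th : R) : 0 <= s ->
  (sup_even_return Pr Phi A s <= th%:E)%E ->
  forall m x, A x -> \sum_(j < m | odd j) s ^+ j.+1 * kop P (iter j Q \1_A) x <= th.
Proof.
move=> s0 hs m x Ax.
apply: (@le_trans _ _ (\sum_(j < m.*2 | odd j) s ^+ j.+1 * kop P (iter j Q \1_A) x)).
  have -> : m.*2 = (m + m)%N by rewrite addnn.
  rewrite big_split_ord/= lerDl; apply: sumr_ge0 => j _.
  rewrite mulr_ge0 ?exprn_ge0//; apply: (posfun_ge0 (posop_at pP x)).
    exact/bQn/bmf_indic.
  move=> y; apply: (posfun_ge0 (posop_at (posop_iter _ pQ) y)); first exact: bmf_indic.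
  by move=> z; exact: indic_ge0.
rewrite -lee_fin -even_partial; apply: le_trans hs.
apply: (@le_trans _ _ (\sum_(1 <= n <oo)
    (s ^+ (2 * n))%:E * first_return Pr Phi (2 * n) x A)%E).
  by apply: nneseries_lim_ge => n _ _; exact: even_term_ge0.
by apply: ereal_sup_ubound; exists x.
Qed.

Lemma even_return_lub (s th : R) : 0 <= s ->
  (forall m x, A x -> \sum_(j < m | odd j) s ^+ j.+1 * kop P (iter j Q \1_A) x <= th) ->
  (sup_even_return Pr Phi A s <= th%:E)%E.
Proof.
move=> s0 hs; apply: ge_ereal_sup => _ [x Ax <-].
apply: lime_le; first by apply: is_cvg_nneseries => n _ _; exact: even_term_ge0.
near=> n; have [m ->] : exists m, n = m.+1.
  by exists n.-1; rewrite prednK//; near: n; exists 1%N.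
by rewrite even_partial lee_fin; exact: hs.
Unshelve. all: by end_near. Qed.

End chain_law.

(** * Mean-square decay for reversible kernels *)

(** Positivity of [phi ((f - t * g) ^+ 2)] for all [t]; when [phi (g ^+ 2)]
    vanishes, it is affine in [t]. *)
Lemma cauchy_schwarz {R : realType} {d} {T : measurableType d}
    (phi : (T -> R) -> R) (f g : T -> R) : posfun phi -> bounded_measurable f ->
      bounded_measurable g ->
  phi (fun x => f x * g x) ^+ 2 <= phi (fun x => f x ^+ 2) * phi (fun x => g x ^+ 2).
Proof.
move=> pphi bf bg.
have b2 (h : T -> R) : bounded_measurable h -> bounded_measurable (fun x => h x ^+ 2).
  by move=> bh; under [X in bounded_measurable X]funext do rewrite expr2; exact: bmfM.
have bfg : bounded_measurable (fun x => f x * g x) by exact: bmfM.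
have bf2 := b2 _ bf; have bg2 := b2 _ bg.
set a := phi (fun x => f x ^+ 2); set c := phi (fun x => g x ^+ 2).
set b := phi (fun x => f x * g x).
have quad t : 0 <= a - 2 * t * b + t ^+ 2 * c.
  have -> : a - 2 * t * b + t ^+ 2 * c = phi (fun x => (f x - t * g x) ^+ 2).
    have -> : (fun x => (f x - t * g x) ^+ 2) =
        fun x => t ^+ 2 * g x ^+ 2 + ((- 2 * t) * (f x * g x) + f x ^+ 2).
      by apply/funext => x; ring.
    rewrite (posfun_lin pphi)//; last by apply: bmfD => //; exact: bmfZ.
    by rewrite (posfun_lin pphi)// -/a -/b -/c; ring.
  apply: (posfun_ge0 pphi); last by move=> x; exact: sqr_ge0.
  by apply: b2; apply: bmfB => //; exact: bmfZ.
have a0 : 0 <= a by apply: (posfun_ge0 pphi) => // x; exact: sqr_ge0.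
have c0 : 0 <= c by apply: (posfun_ge0 pphi) => // x; exact: sqr_ge0.
move: c0; rewrite le_eqVlt => /predU1P[c00|cpos].
  have [->|bn0] := eqVneq b 0; first by rewrite expr0n/= mulr_ge0// -c00.
  have := quad ((a + 1) / (2 * b)); rewrite -c00 mulr0 addr0.
  have -> : 2 * ((a + 1) / (2 * b)) * b = a + 1 by field.
  by lra.
have := quad (b / c).
have -> : a - 2 * (b / c) * b + (b / c) ^+ 2 * c = (a * c - b ^+ 2) / c.
  by field; rewrite gt_eqF.
by rewrite pmulr_lge0 ?invr_gt0// subr_ge0.
Qed.

Section reversible_decay.
Context {R : realType} {d : measure_display} {X : measurableType d}.
Variables (P : R.-pker X ~> X) (pi : probability X R).
Hypothesis hrev : reversible P pi.
Implicit Types f g h : X -> R.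

Let pP : posop (kop P) := posop_kop P.
Let pT := @probability_setT _ _ _ pi.
Let ppi : posfun (fun f : X -> R => \int[pi]_x f x) := posfun_avg pT.
Let bPn n f : bounded_measurable f -> bounded_measurable (iter n (kop P) f) :=
  @posop_bmf _ _ _ _ (posop_iter n pP) f.

Lemma iter_kop_sym n f g : bounded_measurable f -> bounded_measurable g ->
  \int[pi]_x (f x * iter n (kop P) g x) = \int[pi]_x (iter n (kop P) f x * g x).
Proof.
elim: n f => [//|n IH] f bf bg.
rewrite iterS kop_sym//; last exact: bPn.
rewrite iterSr -IH//; last exact: (posop_bmf pP).
by apply: eq_Rintegral => x _; rewrite mulrC.
Qed.

Lemma iter_invariant n f : bounded_measurable f ->
  \int[pi]_x iter n (kop P) f x = \int[pi]_x f x.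
Proof.
move=> bf; elim: n => // n IH.
by rewrite iterS invariantE//; [exact: reversible_invariant|exact: bPn].
Qed.

Lemma iter_two_step n f : iter n (kop P \o kop P) f = iter n.*2 (kop P) f.
Proof. by elim: n => // n IH; rewrite doubleS 3!iterS -IH. Qed.

Section density.
Variable h : X -> R.
Hypotheses (bh : bounded_measurable h) (pih : \int[pi]_x h x = 1).

(** The squared distance to equilibrium, in mean square, of the chain started
    with density [h] after [k] steps. *)
Definition energy k : R := \int[pi]_x (iter k (kop P) (fun y => h y - 1) x) ^+ 2.

Let bg : bounded_measurable (fun y => h y - 1).
Proof. by apply: bmfB => //; exact: bmf_cst. Qed.

Let iter_g k x : iter k (kop P) (fun y => h y - 1) x = iter k (kop P) h x - 1.
Proof.
have pk := posop_at (posop_iter k pP) x.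
by rewrite (posfunB pk)//; [rewrite iter_kop1|exact: bmf_cst].
Qed.

(** By symmetry the energy after [k] steps is a value of the chain after [2 k]
    steps; this is how decay of even-time probabilities controls mean squares, and
    why the excess in [decay_from_regeneration] is nonnegative for two-step
    kernels. *)
Lemma energyE k : energy k = \int[pi]_x (h x * iter k.*2 (kop P) h x) - 1.
Proof.
rewrite /energy.
have -> : \int[pi]_x (iter k (kop P) (fun y => h y - 1) x) ^+ 2 =
   \int[pi]_x (iter k (kop P) (fun y => h y - 1) x * iter k (kop P) (fun y => h y - 1) x).
  by apply: eq_Rintegral => x _; rewrite expr2.
rewrite -iter_kop_sym//; last exact: bPn.
rewrite -iterD addnn.
have -> : \int[pi]_x ((h x - 1) * iter k.*2 (kop P) (fun y => h y - 1) x) =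
   \int[pi]_x ((h x * iter k.*2 (kop P) h x - h x) - (iter k.*2 (kop P) h x - 1)).
  by apply: eq_Rintegral => x _; rewrite iter_g; ring.
have b1 := bPn k.*2 bh.
have b2 := bmfM bh b1.
rewrite (posfunB ppi)//; last 2 first.
- exact: bmfB.
- by apply: bmfB => //; exact: bmf_cst.
rewrite (posfunB ppi)// (posfunB ppi)//; last exact: bmf_cst.
by rewrite iter_invariant// pih avg1//; ring.
Qed.

Lemma energy_ge0 k : 0 <= energy k.
Proof. by apply: Rintegral_ge0 => x _; exact: sqr_ge0. Qed.

(** Symmetry and the Cauchy-Schwarz inequality: [energy k] is the scalar product
    of [h - 1] with [P^(2 k) (h - 1)]. *)
Lemma energy_sqr_le k : energy k ^+ 2 <= energy 0 * energy k.*2.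
Proof.
have -> : energy k = \int[pi]_x ((h x - 1) * iter k.*2 (kop P) (fun y => h y - 1) x).
  rewrite /energy -addnn iterD iter_kop_sym//; last exact: bPn.
by apply: (cauchy_schwarz ppi bg); exact: bPn.
Qed.

Lemma energy_decay C z : 0 < z -> (forall k, energy k <= C * z ^+ k) ->
  forall k, energy k <= energy 0 * z ^+ k.
Proof.
move=> z0 hC; apply: geometric_decay_constant => //.
- exact: energy_ge0.
- exact: energy_sqr_le.
Qed.

Lemma density_mixing k f : bounded_measurable f -> (forall x, `|f x| <= 1) ->
  `|\int[pi]_x (h x * iter k (kop P) f x) - \int[pi]_x f x| <= Num.sqrt (energy k).
Proof.
move=> bf f1.
have -> : \int[pi]_x (h x * iter k (kop P) f x) - \int[pi]_x f x =
   \int[pi]_x (iter k (kop P) (fun y => h y - 1) x * f x).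
  rewrite iter_kop_sym// -(posfunB ppi)//; last by apply: bmfM => //; exact: bPn.
  by apply: eq_Rintegral => x _; rewrite iter_g; ring.
rewrite -sqrtr_sqr; apply: ler_wsqrtr.
apply: (le_trans (cauchy_schwarz ppi (bPn k bg) bf)).
rewrite -/(energy k) -[leRHS]mulr1 ler_wpM2l ?energy_ge0//.
rewrite -(avg1 pT); apply: (posfun_le ppi).
- by under [X in bounded_measurable X]funext do rewrite expr2; exact: bmfM.
- exact: bmf_cst.
- by move=> x; rewrite -[f x ^+ 2]ger0_norm ?sqr_ge0// normrX expr_le1.
Qed.

End density.
End reversible_decay.

(** * Rates of convergence from an atom *)

Lemma posfun_at {R : realType} {d} {X : measurableType d} (x : X) :
  posfun (fun f : X -> R => f x).
Proof. by split. Qed.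

(** Writing [2 <= C + Num.max (2 - C) 0] lets the contribution of the time before
    regeneration be merged with the sum, to which summation by parts applies. *)
Lemma mixing_summation (R : realType) (t : nat -> R) (C S u y v : R) n :
  t 0%N = 1 -> 0 <= C -> 0 <= y <= 1 -> (forall j, t j <= S * u ^+ j) ->
  v <= 2 * t n + C * \sum_(j < n) (t j - t j.+1) * y ^+ (n - j) ->
  0 <= t n ->
  v <= C * (y ^+ n + (1 - y) * \sum_(j < n) S * u ^+ j.+1 * y ^+ (n - j.+1)) +
       Num.max (2 - C) 0 * (S * u ^+ n).
Proof.
move=> t0 C0 /andP[y0 y1] tS hv tn0.
have := abel_geometric y n t0.
set s1 := \sum_(j < n) _; set s2 := \sum_(j < n) _ => ab.
set s3 := \sum_(j < n) _.
have s23 : s2 <= s3.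
  by apply: ler_sum => j _; apply: ler_wpM2r; [exact: exprn_ge0|exact: tS].
have h1 : C * (s1 + t n) <= C * (y ^+ n + (1 - y) * s3).
  by rewrite ab ler_wpM2l// lerD2l ler_wpM2l// subr_ge0.
have h2 : (2 - C) * t n <= Num.max (2 - C) 0 * (S * u ^+ n).
  apply: (@le_trans _ _ (Num.max (2 - C) 0 * t n)).
    by rewrite ler_wpM2r// le_max lexx.
  by rewrite ler_wpM2l// le_max lexx orbT.
rewrite -/s1 in hv.
by apply: (le_trans hv); rewrite mulrDr in h1; lra.
Qed.

(** Convexity of the power function between 1 and [s]. *)
Lemma expr_convex (R : realType) (t s : R) n : 0 <= t <= 1 -> 1 <= s ->
  (1 - t + t * s) ^+ n <= 1 - t + t * s ^+ n.
Proof.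
move=> /andP[t0 t1] s1; elim: n => [|n IH]; first by rewrite !expr0; lra.
have s0 : 0 <= s by lra.
rewrite exprS; apply: (@le_trans _ _ ((1 - t + t * s) * (1 - t + t * s ^+ n))).
  by rewrite ler_wpM2l//; have := mulr_ge0 t0 s0; lra.
have : 0 <= t * (1 - t) * ((s - 1) * (s ^+ n - 1)).
  by rewrite !mulr_ge0// subr_ge0// exprn_ege1.
by rewrite exprS; nra.
Qed.

Section atom.
Context {R : realType} {d : measure_display} {X : measurableType d}.
Variables (P : R.-pker X ~> X) (pi nu : probability X R) (A : set X).
Hypotheses (hrev : reversible P pi) (mA : measurable A).
Hypothesis atomA : forall x B, A x -> measurable B -> P x B = nu B.
Implicit Types f : X -> R.

Let pA := fine (pi A).
Hypothesis pA0 : 0 < pA.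

Let pP : posop (kop P) := posop_kop P.
Let pT := @probability_setT _ _ _ pi.
Let nuT := @probability_setT _ _ _ nu.
Let ppi : posfun (fun f : X -> R => \int[pi]_x f x) := posfun_avg pT.
Let pnu : posfun (fun f : X -> R => \int[nu]_x f x) := posfun_avg nuT.
Let bPn n f : bounded_measurable f -> bounded_measurable (iter n (kop P) f) :=
  @posop_bmf _ _ _ _ (posop_iter n pP) f.
Let Q := killed A (kop P).
Let pQ : posop Q := posop_killed mA pP.
Let bQn n f : bounded_measurable f -> bounded_measurable (iter n Q f) := @posop_bmf _ _
  _ _ (posop_iter n pQ) f.
Let bA : bounded_measurable (\1_A : X -> R) := bmf_indic mA.
Let A0 x : 0 <= \1_A x :> R := indic_ge0 A x.

Lemma kop_atom f x : A x -> kop P f x = \int[nu]_y f y.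
Proof.
move=> Ax; rewrite /kop /Rintegral; congr fine.
by apply: eq_measure_integral => B mB _; exact: atomA.
Qed.

(** At an atom every step is a regeneration. *)
Lemma kop_atom_split f x :
  kop P f x = Q f x + \1_A x * \int[nu]_y f y.
Proof.
rewrite /Q /killed indicC; have [Ax|Ax] := pselect (A x).
  by rewrite (indic_in Ax) kop_atom//; ring.
by rewrite indic_notin//; ring.
Qed.

Let h x : R := pA^-1 * \1_A x.
Let bh : bounded_measurable h. Proof. exact: bmfZ. Qed.
Let h0 x : 0 <= h x. Proof. by rewrite /h mulr_ge0// invr_ge0 ltW. Qed.

Let pih : \int[pi]_x h x = 1.
Proof. by rewrite (posfunZ ppi)// avg_indic// mulVf// gt_eqF. Qed.

Let pi_h_kop f : bounded_measurable f -> \int[pi]_x (h x * kop P f x) = \int[nu]_x f x.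
Proof.
move=> bf; have -> : \int[pi]_x (h x * kop P f x) = \int[pi]_x ((\int[nu]_x f x) * h x).
  apply: eq_Rintegral => x _; rewrite /h.
  have [Ax|Ax] := pselect (A x); first by rewrite kop_atom//; ring.
  by rewrite indic_notin//; ring.
by rewrite (posfunZ ppi)// pih mulr1.
Qed.

Lemma atom_energy0 : energy P pi h 0 = pA^-1 - 1.
Proof.
rewrite energyE//=; congr (_ - _).
have -> : \int[pi]_x (h x * h x) = \int[pi]_x (pA^-1 * h x).
  apply: eq_Rintegral => x _; rewrite /h.
  have [Ax|Ax] := pselect (A x); first by rewrite (indic_in Ax); ring.
  by rewrite indic_notin//; ring.
by rewrite (posfunZ ppi)// pih mulr1.
Qed.

(** Applies [decay_from_regeneration] to the two-step kernel, which regenerates on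
    [A] with law [nu P]. The test function is the density [h] of the restriction of
    [pi] to the atom, normalised, for which the excess at step [k] is
    [energy k.+1]. *)
Lemma atom_energy_decay s B : 0 < s ->
  (forall n x, s ^+ n.*2 * iter n (killed A (kop P \o kop P)) (fun=> 1) x <= B) ->
  forall k, energy P pi h k <= energy P pi h 0 * (s ^- 2) ^+ k.
Proof.
move=> s0 hB; apply: (@energy_decay _ _ _ _ _ hrev _ bh (energy P pi h 0 + pA^-1 * B)).
  by rewrite invr_gt0 exprn_gt0.
have s2 k : (s ^- 2) ^+ k = (s ^+ k.*2)^-1 by rewrite exprVn -exprM mul2n.
have B0 : 0 <= B.
  by apply: le_trans (hB 0%N point); rewrite expr0 mul1r.
case=> [|m].
  rewrite expr0 mulr1 lerDl mulr_ge0// invr_ge0 ltW//.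
have pPP : posop (kop P \o kop P) by exact: posop_comp.
have pK : posop (killed A (kop P \o kop P)) by exact: posop_killed.
pose nu' f := \int[nu]_x kop P f x.
have pnu' : posfun nu' by exact: posfun_comp.
have nu'h k : nu' (iter k (kop P \o kop P) h) - 1 = energy P pi h k.+1.
  rewrite energyE// doubleS; congr (_ - _).
  rewrite /nu' iter_two_step -pi_h_kop; last exact: (posop_bmf pP (bPn _ bh)).
  by [].
have := @decay_from_regeneration _ _ _ (kop P \o kop P) (killed A (kop P \o kop P))
  (\1_A) nu' pPP pK bA A0 _ _ _ (fun f => \int[pi]_x f x) ppi _ _ h m bh h0 _.
rewrite pih avg_indic// -/pA => main.
have {}main : pA * (nu' (iter m (kop P \o kop P) h) - 1) <=
    1 * \int[pi]_x iter m.+1 (killed A (kop P \o kop P)) (fun=> 1) x.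
  apply: main.
  - move=> f x bf; rewrite /killed indicC /nu'.
    have [Ax|Ax] := pselect (A x).
      by rewrite (indic_in Ax) /= kop_atom//; ring.
    by rewrite indic_notin//; ring.
  - by rewrite /= !kop1.
  - by rewrite /nu' kop1 avg1.
  - by rewrite avg1.
  - move=> f bf /=; rewrite !invariantE//; try exact: reversible_invariant.
    exact: (posop_bmf pP).
  - by move=> k; rewrite -subr_ge0 nu'h; exact: energy_ge0.
rewrite nu'h mul1r in main.
have bK : bounded_measurable (iter m.+1 (killed A (kop P \o kop P)) (fun=> 1)).
  exact: (posop_bmf (posop_iter m.+1 pK) (bmf_cst 1)).
have le2 : \int[pi]_x iter m.+1 (killed A (kop P \o kop P)) (fun=> 1) x <=
    B * (s ^- 2) ^+ m.+1.
  rewrite -[leRHS](_ : \int[pi]_x (B * (s ^- 2) ^+ m.+1) = _); last first.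
    by rewrite (posfun_cst ppi) avg1// mulr1.
  apply: (posfun_le ppi) => //; first exact: bmf_cst.
  by move=> x; rewrite s2 ler_pdivlMr ?exprn_gt0// mulrC hB.
have : energy P pi h m.+1 <= pA^-1 * (B * (s ^- 2) ^+ m.+1).
  by rewrite -(ler_pM2l pA0) mulVKf ?gt_eqF// (le_trans main).
move=> hm; apply: (le_trans hm); rewrite mulrDl -mulrA lerDr.
by rewrite mulr_ge0 ?energy_ge0// exprn_ge0// invr_ge0 exprn_ge0// ltW.
Qed.

(** After one step from the atom the law is [nu], whether the chain starts at a
    point of [A] or from the density [h]. Hence [nu P^m] is the law at time [m + 1]
    of the chain started from [h]. *)
Lemma atom_mixing y m f : 0 <= y ->
  (forall k, energy P pi h k <= energy P pi h 0 * (y ^+ 2) ^+ k) ->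
  bounded_measurable f -> (forall x, `|f x| <= 1) ->
  `|\int[nu]_x iter m (kop P) f x - \int[pi]_x f x| <=
    Num.sqrt (pA^-1 - 1) * y ^+ m.+1.
Proof.
move=> y0 hy bf f1.
rewrite -pi_h_kop; last exact: bPn.
apply: (le_trans (density_mixing hrev bh m.+1 bf f1)).
apply: (@le_trans _ _ (Num.sqrt (energy P pi h 0 * (y ^+ 2) ^+ m.+1))).
  exact: ler_wsqrtr.
rewrite sqrtrM ?energy_ge0// atom_energy0 -exprM mulnC exprM sqrtr_sqr.
by rewrite ger0_norm// exprn_ge0.
Qed.

Lemma atom_convergence C y S u : 0 <= C -> 0 <= y <= 1 ->
  (forall m f, bounded_measurable f -> (forall x, `|f x| <= 1) ->
    `|\int[nu]_x iter m (kop P) f x - \int[pi]_x f x| <= C * y ^+ m.+1) ->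
  (forall j x, iter j Q (fun=> 1) x <= S * u ^+ j) ->
  forall n x f, bounded_measurable f -> (forall x, `|f x| <= 1) ->
  `|iter n (kop P) f x - \int[pi]_y f y| <=
    C * (y ^+ n + (1 - y) * \sum_(j < n) S * u ^+ j.+1 * y ^+ (n - j.+1)) +
       Num.max (2 - C) 0 * (S * u ^+ n).
Proof.
move=> C0 y01 hmix hS n x f bf f1.
apply: (@mixing_summation _ (fun j => iter j Q (fun=> 1) x)) => //; last first.
  by apply: (posfun_ge0 (posop_at (posop_iter n pQ) x)) => //; exact: bmf_cst.
apply: (le_trans (@mixing_from_regeneration _ _ _ (kop P) Q \1_A
  (fun f => \int[nu]_x f x) pP pQ pnu bA A0 _ _ _ (fun f => \int[pi]_x f x) ppi
  _ (fun f => f x) (posfun_at x) _ f n (fun m => C * y ^+ m.+1) bf f1 _)) => //.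
- by move=> g z _; exact: kop_atom_split.
- exact: kop1.
- exact: avg1.
- exact: avg1.
- by move=> m; exact: hmix.
rewrite lerD2l mulr_sumr le_eqVlt; apply/orP; left; apply/eqP.
by apply: eq_bigr => j _; rewrite -subSn ?subSS// mulrCA.
Qed.

(** If all returns to the atom took an even time, then the chain started at [nu]
    would avoid [A] at every even time. Irreducibility provides [n] such that [A]
    is reached in [n] steps from every point; starting in [A] this forces [n] to
    be even, and starting from [nu] it then gives a contradiction. *)
Lemma odd_return : irreducible P pi ->
  exists j, ~~ odd j /\ 0 < \int[nu]_x iter j Q \1_A x.
Proof.
move=> hirr.
have piA : (0 < pi A)%E.
  by rewrite -[pi A]fineK ?lte_fin//; exact: fin_num_measure.
have [x0 Ax0] : exists x, A x.
  apply/not_existsP => hn; move: piA.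
  by rewrite (_ : A = set0) ?measure0 ?ltxx//; apply/seteqP; split => // x /hn.
have [n [n0 hn]] := hirr A mA piA.
have {}hn x : 0 < iter n (kop P) \1_A x.
  by have := hn x; rewrite kiter_indic// lte_fin.
apply/not_existsP => hno.
have Qn0 j : 0 <= \int[nu]_x iter j Q \1_A x.
  by apply: Rintegral_ge0 => x _; apply: (posfun_ge0 (posop_at (posop_iter j pQ) x)).
have phi0 j : ~~ odd j -> \int[nu]_x iter j Q \1_A x = 0.
  move=> oj; apply/eqP; rewrite eq_le Qn0 andbT leNgt; apply/negP => hj.
  by apply: (hno j).
have p0 m : ~~ odd m -> \int[nu]_x iter m (kop P) \1_A x = 0.
  (* m is even: for even j the return at the odd time j + 1 has probability 0,
    for odd j the remaining time m - j - 1 is even *)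
  have [k] := ubnP m; elim: k m => // k IH m mk om.
  rewrite (_ : iter m (kop P) \1_A = fun x => iter m Q \1_A x +
      \sum_(j < m) (\int[nu]_y iter (m - j.+1) (kop P) \1_A y) * iter j Q \1_A x);
        last first.
    apply/funext => x.
    rewrite (@first_regeneration _ _ _ (kop P) Q \1_A (fun f => \int[nu]_x f x) pP pQ bA)//.
      by congr (_ + _); apply: eq_bigr => j _; rewrite mulrC.
    by move=> g z _; exact: kop_atom_split.
  rewrite (posfunD pnu); last 2 first.
  - exact: bQn.
  - by apply: bmf_sum => j; exact/bmfZ/bQn.
  rewrite phi0// add0r (posfun_sum pnu); last by move=> j; exact/bmfZ/bQn.
  rewrite big1// => j _; rewrite (posfunZ pnu); last exact: bQn.
  have [oj|oj] := boolP (odd j); last by rewrite phi0// mulr0.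
  rewrite IH ?mul0r//.
    apply: (@leq_trans m); last by rewrite -ltnS.
    by rewrite ltn_subrL/= (leq_ltn_trans _ (ltn_ord j)).
  by rewrite oddB ?ltn_ord//= oj (negbTE om).
have n_even : ~~ odd n.
  case: n n0 hn {p0}(p0) => // n _ hn p0; apply/negP => /= on.
  have := hn x0; rewrite iterS kop_atom// p0 ?ltxx//.
have bn := bPn n bA.
have int0 : (\int[nu]_x (iter n (kop P) \1_A x)%:E = 0)%E.
  by rewrite -EFin_avg// p0.
have /ae_eq_integral_abs : measurable_fun setT (EFin \o iter n (kop P) \1_A).
  by apply/measurable_EFinP; case: bn.
move=> /(_ nu measurableT)[+ _].
have -> : (\int[nu]_x `|(EFin \o iter n (kop P) (\1_A)%R) x| = 0)%E.
  rewrite -[RHS]int0; apply: eq_integral => x _ /=.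
  by rewrite ger0_norm// ltW.
move=> /(_ erefl) [N [mN N0 sub]].
have NT : N = setT.
  apply/seteqP; split => // x _; apply: sub => /=.
  move=> /(_ Logic.I)/eqP; rewrite eqe => /eqP hx.
  by have := hn x; rewrite hx ltxx.
have : 1%E = 0%E :> \bar R by rewrite -nuT -N0 NT.
by move/eqP; rewrite onee_eq0.
Qed.

(** An odd return has positive probability, so even returns have total mass less
    than 1 at [s = 1]. The generating function of even return times is convex and
    finite up to [lam], hence stays below 1 slightly to the right of 1. *)
Lemma even_return_gf_lt1 lam S : irreducible P pi -> 1 < lam ->
  (forall j x, iter j Q (fun=> 1) x <= S * lam ^- j) ->
  exists s th, [/\ 1 < s, s < lam, th < 1 &
    forall m, \sum_(j < m | odd j) s ^+ j.+1 * \int[nu]_x iter j Q \1_A x <= th].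
Proof.
move=> hirr lam1 hS.
have [j0 [oj0 phij0]] := odd_return hirr.
pose phi j := \int[nu]_x iter j Q \1_A x.
have phi0 j : 0 <= phi j.
  by apply: Rintegral_ge0 => x _; apply: (posfun_ge0 (posop_at (posop_iter j pQ) x)).
rewrite -/(phi j0) in phij0.
have bone : bounded_measurable ((fun=> 1) : X -> R) := bmf_cst 1.
have sum1 N : \sum_(j < N) phi j <= 1.
  have tE j : phi j = \int[nu]_x iter j Q (fun=> 1) x - \int[nu]_x iter j.+1 Q (fun=> 1) x.
    rewrite -(posfunB pnu); [|exact: bQn|exact: bQn].
    apply: eq_Rintegral => x _.
    apply: (@regeneration_time _ _ _ (kop P) Q \1_A (fun f => \int[nu]_x f x) pQ).
    - by move=> g z _; exact: kop_atom_split.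
    - exact: kop1.
    - exact: avg1.
  have -> : \sum_(j < N) phi j = 1 - \int[nu]_x iter N Q (fun=> 1) x.
    elim: N => [|N IH]; first by rewrite big_ord0 /= avg1// subrr.
    by rewrite big_ord_recr/= IH tE addrA subrK.
  rewrite gerBl; apply: Rintegral_ge0 => x _.
  exact: (posfun_ge0 (posop_at (posop_iter N pQ) x)).
have odd1 m : \sum_(j < m | odd j) phi j <= 1 - phi j0.
  rewrite lerBrDr; apply: le_trans (sum1 (m + j0.+1)%N).
  rewrite [leRHS](bigID (fun j : 'I_(m + j0.+1) => odd j))/= lerD//.
    rewrite big_split_ord/= lerDl; exact: sumr_ge0.
  have j0lt : (j0 < m + j0.+1)%N by rewrite addnS ltnS leq_addl.
  by rewrite (bigD1 (Ordinal j0lt))//= lerDl; exact: sumr_ge0.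
have lam0 : 0 < lam by lra.
(* any point strictly between 1 and lam, where the generating function is finite *)
pose s0 := (1 + lam) / 2.
have s01 : 1 < s0 by rewrite /s0; lra.
have s0lam : s0 < lam by rewrite /s0; lra.
clearbody s0.
have S0 : 0 <= S.
  by have := hS 0%N point; rewrite expr0 invr1 mulr1 /=; apply: le_trans.
have phiS j : phi j <= S * lam ^- j.
  apply: (@le_trans _ _ (\int[nu]_x iter j Q (fun=> 1) x)).
    apply: (posfun_le pnu); [exact: bQn|exact: bQn|] => x.
    have le1 z : \1_A z <= 1 :> R by rewrite indicE; case: (_ \in _).
        exact: (posfun_le (posop_at (posop_iter j pQ) x) bA bone le1).
  rewrite -[leRHS](_ : \int[nu]_x (S * lam ^- j) = _).
    by apply: (posfun_le pnu); [exact: bQn|exact: bmf_cst|].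
  by rewrite (posfun_cst pnu) avg1// mulr1.
pose r := s0 / lam.
have r0 : 0 <= r by rewrite divr_ge0; lra.
have r1 : r < 1 by rewrite /r ltr_pdivrMr// mul1r.
pose B := s0 * S / (1 - r).
have geo m : \sum_(j < m | odd j) s0 ^+ j.+1 * phi j <= B.
  apply: (@le_trans _ _ (\sum_(j < m) s0 * S * r ^+ j)).
    rewrite [leRHS](bigID (fun j : 'I_m => odd j))/= -[leLHS]addr0 lerD//.
      apply: ler_sum => j _; rewrite exprS -!mulrA ler_pM2l; last by lra.
      have -> : S * r ^+ j = s0 ^+ j * (S * lam ^- j) by rewrite /r expr_div_n mulrCA.
          by apply: ler_wpM2l; [apply: exprn_ge0; lra|exact: phiS].
    by apply: sumr_ge0 => j _; rewrite mulr_ge0 ?exprn_ge0// mulr_ge0//; lra.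
  rewrite -mulr_sumr /B; apply: ler_wpM2l; first by rewrite mulr_ge0//; lra.
  have r1' : 0 < 1 - r by lra.
  have -> : \sum_(j < m) r ^+ j = (1 - r ^+ m) / (1 - r).
    have := subrX1 r m; set ss := \sum_(_ < _) _ => hss.
    by rewrite -opprB hss; field; rewrite subr_eq0 gt_eqF.
  by rewrite ler_pdivrMr// mulVf ?gt_eqF// gerBl exprn_ge0.
have B0 : 0 <= B by apply: le_trans (geo 0%N); rewrite big_ord0.
(* small enough for the convex combination at t to lose at most phi j0 / 2 *)
pose t := phi j0 / (2 * (B + 1)).
have eps1 : phi j0 <= 1.
  by have := odd1 0%N; rewrite big_ord0 subr_ge0.
have tE : t * (2 * (B + 1)) = phi j0 by rewrite /t divfK// gt_eqF//; lra.
have t0 : 0 < t by rewrite divr_gt0//; lra.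
have t1 : t < 1 by rewrite /t ltr_pdivrMr; lra.
exists (1 - t + t * s0), (1 - phi j0 / 2); split.
- have : 0 < t * (s0 - 1) by rewrite mulr_gt0// subr_gt0.
  by lra.
- have : 0 < (1 - t) * (s0 - 1) by rewrite mulr_gt0// subr_gt0.
  by lra.
- by lra.
move=> m.
apply: (@le_trans _ _ (\sum_(j < m | odd j) ((1 - t) * phi j + t * (s0 ^+ j.+1 * phi j)))).
  apply: ler_sum => j _.
  have -> : (1 - t) * phi j + t * (s0 ^+ j.+1 * phi j) = (1 - t + t * s0 ^+ j.+1) * phi
    j by ring.
  by apply: ler_wpM2r; [exact: phi0|apply: expr_convex; lra].
rewrite big_split/= -!mulr_sumr.
have h1 : (1 - t) * \sum_(j < m | odd j) phi j <= (1 - t) * (1 - phi j0).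
  by rewrite ler_wpM2l//; lra.
have h2 : t * \sum_(j < m | odd j) (s0 ^+ j.+1 * phi j) <= t * B.
  by rewrite ler_wpM2l// ltW.
have h3 : 0 <= t * (1 - phi j0) by rewrite mulr_ge0//; lra.
by lra.
Qed.

End atom.

(** * Rates of convergence from a small set *)

(** The Radon-Nikodym derivative is at most [c] almost everywhere: its excess over
    [c] has nonpositive integral on the set where it is positive. Truncating it at
    [c] makes the bound hold everywhere. *)
Lemma bounded_density {R : realType} {d} {X : measurableType d}
    (nu pi : probability X R) (c : R) : 0 <= c ->
  (forall B, measurable B -> (nu B <= c%:E * pi B)%E) ->
  exists n : X -> R, [/\ bounded_measurable n, forall x, 0 <= n x &
    forall f, bounded_measurable f -> \int[nu]_x f x = \int[pi]_x (n x * f x)].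
Proof.
move=> c0 nupi.
have pT := @probability_setT _ _ _ pi; have nuT := @probability_setT _ _ _ nu.
have dom : nu `<< pi.
  move=> N hN B mB BN; apply/eqP; rewrite eq_le measure_ge0 andbT.
  by have := nupi B mB; rewrite (hN B mB BN) mule0.
pose f0 := Radon_Nikodym_SigmaFinite.f nu pi.
have f0_ge0 x : (0 <= f0 x)%E by exact: Radon_Nikodym_SigmaFinite.f_ge0.
have f0_fin x : f0 x \is a fin_num by exact: Radon_Nikodym_SigmaFinite.f_fin_num.
have f0_int := Radon_Nikodym_SigmaFinite.f_integrable dom.
have f0E := Radon_Nikodym_SigmaFinite.f_integral dom.
rewrite -/f0 in f0_int f0E.
have mf0 : measurable_fun setT f0 := measurable_int _ f0_int.
pose n1 x := fine (f0 x).
have mn1 : measurable_fun setT n1 by exact: measurableT_comp.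
have n1E x : (n1 x)%:E = f0 x by rewrite fineK.
have n1_ge0 x : 0 <= n1 x by rewrite fine_ge0.
(* truncation only changes the density on a null set *)
pose n x := Num.min (n1 x) c.
have bn : bounded_measurable n.
  split; first by apply: measurable_minr.
  by exists c => x; rewrite ger0_norm ?le_min ?n1_ge0// ge_min lexx orbT.
have n0 x : 0 <= n x by rewrite le_min n1_ge0.
pose D := [set x | c < n1 x].
have mD : measurable D.
  rewrite (_ : D = setT `&` n1 @^-1` `]c, +oo[%classic).
    by apply: mn1 => //; exact: measurable_itv.
  by rewrite setTI; apply/seteqP; split => x /=; rewrite in_itv/= andbT.
have intD : (\int[pi]_(x in D) `|(n1 x - c)%:E| = 0)%E.
  apply/eqP; rewrite eq_le integral_ge0// andbT.
  have -> : (\int[pi]_(x in D) `|(n1 x - c)%:E| = \int[pi]_(x in D) (f0 x - c%:E))%E.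
    apply: eq_integral => x; rewrite inE => xD.
    by rewrite gee0_abs ?lee_fin ?subr_ge0 ?ltW// EFinB n1E.
  rewrite integralB//; last 2 first.
  - exact: (integrableS measurableT).
  - apply: (integrableS measurableT) => //.
    exact: (bmf_integrable pT (bmf_cst c)).
  by rewrite -f0E// integral_cst// leeBlDr ?add0e ?nupi// fin_numM// fin_num_measure.
have aeD : {ae pi, forall x, (n x)%:E = f0 x}.
  have mg : measurable_fun D (fun x => (n1 x - c)%:E).
    apply/measurable_EFinP; apply: measurable_funB => //.
    exact: measurable_funTS.
  have [+ _] := ae_eq_integral_abs pi mD mg.
  move=> /(_ intD); apply: filterS => x h; rewrite -n1E /n.
  have [//|cn] := leP (n1 x) c.
  have := h cn; rewrite /= => -[] /eqP; rewrite subr_eq0 => /eqP e.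
  by move: cn; rewrite e ltxx.
exists n; split => // f bf.
have posn : posfun (fun f : X -> R => \int[pi]_x (n x * f x)).
  by apply: posfun_mul => //; exact: posfun_avg.
apply: (posfun_eq_of_sets (posfun_avg nuT) posn) => // B mB.
transitivity (fine (nu B)); first exact: avg_indic.
rewrite (f0E _ mB) /Rintegral; congr fine.
transitivity (\int[pi]_x (f0 \_ B) x)%E; first by rewrite integral_mkcond.
apply: (@ae_eq_integral _ _ _ pi setT) => //.
- by apply/(measurable_restrictT _ _).1 => //; exact: measurable_funTS.
- by apply/measurable_EFinP; have [] := bmfM bn (bmf_indic mB).
apply: filterS aeD => x /= h _; rewrite /patch; case: ifPn => xB.
  by rewrite indicE xB mulr1 h.
by rewrite indicE (negbTE xB) mulr0.
Qed.

Lemma posfun_dist_le2 {R : realType} {d} {X : measurableType d}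
    (phi psi : (X -> R) -> R) f : posfun phi -> posfun psi ->
  phi (fun=> 1) = 1 -> psi (fun=> 1) = 1 -> bounded_measurable f -> (forall x,
    `|f x| <= 1) ->
  `|phi f - psi f| <= 2.
Proof.
move=> pphi ppsi phi1 psi1 bf f1; rewrite (le_trans (ler_normB _ _))// -[2]/(1 + 1) lerD//.
  by have := posfun_norm_le pphi bf f1; rewrite phi1 mulr1.
by have := posfun_norm_le ppsi bf f1; rewrite psi1 mulr1.
Qed.

Section small_set.
Context {R : realType} {d : measure_display} {X : measurableType d}.
Variables (P : R.-pker X ~> X) (pi nu : probability X R) (A : set X) (delta : R).
Hypotheses (hrev : reversible P pi) (mA : measurable A) (delta0 : 0 < delta).
Hypothesis minor : forall x B, measurable B ->
  ((delta * \1_A x)%:E * nu B <= P x B)%E.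
Implicit Types f : X -> R.

Let pA := fine (pi A).
Hypothesis pA0 : 0 < pA.
Let q := delta ^+ 2 * fine (nu A).

Let pP : posop (kop P) := posop_kop P.
Let pPP : posop (kop P \o kop P) := posop_comp pP pP.
Let pT := @probability_setT _ _ _ pi.
Let nuT := @probability_setT _ _ _ nu.
Let ppi : posfun (fun f : X -> R => \int[pi]_x f x) := posfun_avg pT.
Let pnu : posfun (fun f : X -> R => \int[nu]_x f x) := posfun_avg nuT.
Let bP f : bounded_measurable f -> bounded_measurable (kop P f) := @posop_bmf _ _ _ _ pP f.
Let bPn n f : bounded_measurable f -> bounded_measurable (iter n (kop P) f) :=
  @posop_bmf _ _ _ _ (posop_iter n pP) f.
Let bA : bounded_measurable (\1_A : X -> R) := bmf_indic mA.
Let A0 x : 0 <= \1_A x :> R := indic_ge0 A x.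

Lemma minorization f x : bounded_measurable f -> (forall y, 0 <= f y) ->
  delta * \1_A x * \int[nu]_y f y <= kop P f x.
Proof.
move=> bf f0.
have a0 : 0 <= delta * \1_A x by rewrite mulr_ge0// ltW.
have pos1 : posfun (fun g : X -> R => delta * \1_A x * \int[nu]_y g y).
  split=> [a u v bu bv|u bu u0]; first by rewrite (posfun_lin pnu)//; ring.
  by rewrite mulr_ge0// Rintegral_ge0.
apply: (posfun_le_of_sets pos1 (posop_at pP x)) => // B mB.
rewrite kop_indic// avg_indic// -lee_fin fineK ?pker_fin_num//.
by rewrite EFinM fineK ?minor//; exact: fin_num_measure.
Qed.

Let nuA0 : 0 <= fine (nu A).
Proof. by rewrite fine_ge0. Qed.

Let nuA1 : fine (nu A) <= 1.
Proof.
rewrite -lee_fin fineK; first exact: probability_le1.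
exact: fin_num_measure.
Qed.

Lemma small_set_nonempty : exists x, A x.
Proof.
apply/not_existsP => hn; move: pA0; rewrite /pA.
by rewrite (_ : A = set0) ?measure0 ?ltxx//; apply/seteqP; split => // x /hn.
Qed.

Lemma minorization_mass_le1 : delta <= 1.
Proof.
have [x Ax] := small_set_nonempty.
have := @minorization (fun=> 1) x (bmf_cst 1) (fun _ => ler01).
by rewrite kop1 avg1// (indic_in Ax) !mulr1.
Qed.

Let q0 : 0 <= q. Proof. by rewrite /q mulr_ge0// sqr_ge0. Qed.

(** Both [delta] and [nu A] are at most 1. The norm of the density of [nu] is
    bounded in terms of [delta], the constant of the rate in terms of [q]. *)
Lemma two_step_mass_le : q <= delta.
Proof.
have h : delta * fine (nu A) <= 1 * 1.
  by apply: ler_pM => //; [exact: ltW|exact: minorization_mass_le1].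
by rewrite /q expr2 -mulrA -[leRHS]mulr1 ler_pM2l// (le_trans h)// mulr1.
Qed.

(** The two-step kernel goes from [x] in [A] to [A] under [nu], then regenerates
    again: it dominates [q * \1_A (x) nu], and this is what remains. *)
Definition residual2 f x : R :=
  kop P (kop P f) x - delta ^+ 2 * fine (nu A) * \1_A x * \int[nu]_y f y.

Let K := residual2.

Lemma posop_residual2 : posop K.
Proof.
split=> [x|f bf]; last first.
  apply: bmfB; first exact/bP/bP.
  have -> : (fun x => delta ^+ 2 * fine (nu A) * \1_A x * \int[nu]_y f y) =
     fun x => (delta ^+ 2 * fine (nu A) * \int[nu]_y f y) * \1_A x.
    by apply/funext => x; ring.
  exact: bmfZ.
split=> [a f g bf bg|f bf f0].
  rewrite /K /residual2 (posfun_lin pnu)//.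
  have -> : kop P (kop P (fun y => a * f y + g y)) x =
      a * kop P (kop P f) x + kop P (kop P g) x.
    exact: (posfun_lin (posop_at pPP x) a bf bg).
  ring.
rewrite /K /residual2 subr_ge0.
have Pf0 y : 0 <= kop P f y by apply: (posfun_ge0 (posop_at pP y)).
apply: le_trans (minorization x (bP bf) Pf0).
have : (delta * \int[nu]_y f y) * fine (nu A) <= \int[nu]_y kop P f y.
  rewrite -(avg_indic nu mA) -(posfunZ pnu)//.
  apply: (posfun_le pnu); [exact: bmfZ|exact: bP|] => y.
  by have := minorization y bf f0; lra.
move=> h.
have a0 : 0 <= delta * \1_A x by rewrite mulr_ge0// ltW.
by have := ler_wpM2l a0 h; apply: le_trans; rewrite le_eqVlt; apply/orP; left;
  apply/eqP; ring.
Qed.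

Let pK := posop_residual2.
Let bKn n f : bounded_measurable f -> bounded_measurable (iter n K f) := @posop_bmf _ _
  _ _ (posop_iter n pK) f.

Lemma residual2_split f x : kop P (kop P f) x = K f x + q * \1_A x * \int[nu]_y f y.
Proof. by rewrite /K /residual2 subrK. Qed.

Lemma two_step_mass_le1 : q <= 1.
Proof. exact: le_trans two_step_mass_le minorization_mass_le1. Qed.

Let e x := q * \1_A x.
Let be : bounded_measurable e. Proof. exact: bmfZ. Qed.
Let e0 x : 0 <= e x. Proof. by rewrite mulr_ge0. Qed.

Section mixing.
Variables (z W : R).
Hypotheses (q_gt0 : 0 < q) (z1 : 1 < z).
Hypothesis hW : forall n x, z ^+ n * iter n K (fun=> 1) x <= W.

Let C3 := Num.sqrt ((q * pA)^-1 - 1).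

Let z0 : 0 < z. Proof. exact: lt_trans z1. Qed.

(** By reversibility, integrating the minorization over [A] yields
    [delta * pi A * nu <= (kop P \1_A) * pi], so that [nu] has a bounded density
    with respect to [pi], of squared norm at most [(delta * pi A)^-1]. The
    mean-square decay of this density is obtained from [decay_from_regeneration],
    whose excess is exactly the energy when the test function is the density
    itself. *)
Lemma minorizing_law_mixing k f : bounded_measurable f -> (forall x, `|f x| <= 1) ->
  `|\int[nu]_x iter k (kop P \o kop P) f x - \int[pi]_x f x| <= C3 * z^-1 ^+ k.
Proof.
move=> bf f1.
have PA1 x : kop P \1_A x <= 1.
  have -> : 1 = kop P (fun=> 1) x by rewrite kop1.
  have le1 y : \1_A y <= 1 :> R by rewrite indicE; case: (_ \in _).
  exact: (posfun_le (posop_at pP x) bA (bmf_cst 1) le1).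
have nu_le g : bounded_measurable g -> (forall y, 0 <= g y) ->
    delta * pA * \int[nu]_y g y <= \int[pi]_y g y.
  move=> bg g0.
  apply: (@le_trans _ _ (\int[pi]_x (\1_A x * kop P g x))).
    rewrite -[leLHS](_ : \int[pi]_x ((delta * \int[nu]_y g y) * \1_A x) = _); last first.
      by rewrite (posfunZ ppi)// avg_indic// -/pA; ring.
    apply: (posfun_le ppi); [exact: bmfZ|by apply: bmfM => //; exact: bP|] => x.
    have [Ax|Ax] := pselect (A x); last by rewrite indic_notin// mulr0 mul0r.
    by have := minorization x bg g0; rewrite (indic_in Ax) !mulr1 mul1r.
  rewrite kop_sym//; apply: (posfun_le ppi); [|by []|].
    by apply: bmfM => //; exact: bP.
  by move=> x; rewrite -[leRHS]mulr1 ler_wpM2l.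
pose c := (delta * pA)^-1.
have dp0 : 0 < delta * pA by rewrite mulr_gt0.
have c0 : 0 <= c by rewrite invr_ge0 ltW.
have [n [bn n0 nE]] : exists n : X -> R, [/\ bounded_measurable n, forall x, 0 <= n x &
    forall f, bounded_measurable f -> \int[nu]_x f x = \int[pi]_x (n x * f x)].
  apply: (bounded_density c0) => B mB.
  have := nu_le \1_B (bmf_indic mB) (indic_ge0 B).
  rewrite !avg_indic// -ler_pdivlMl// -/c -lee_fin EFinM.
  by rewrite !fineK//; exact: fin_num_measure.
have pin : \int[pi]_x n x = 1.
  rewrite -(avg1 nuT) nE; last exact: bmf_cst.
  by apply: eq_Rintegral => x _; rewrite mulr1.
have nukE j g : bounded_measurable g -> \int[nu]_x iter j (kop P \o kop P) g x =
    \int[pi]_x (n x * iter j.*2 (kop P) g x).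
  by move=> bg; rewrite iter_two_step nE//; exact: bPn.
have energy00 : energy P pi n 0 <= (q * pA)^-1 - 1.
  rewrite energyE// /= lerD2r -nE//.
  have := nu_le n bn n0; rewrite pin -ler_pdivlMl// mulr1 => /le_trans; apply.
  have qdp : q * pA <= delta * pA by rewrite ler_pM2r//; exact: two_step_mass_le.
  by rewrite lef_pV2// posrE mulr_gt0.
have zk j : 0 < z ^+ j by rewrite exprn_gt0.
have en_bound j : energy P pi n j <= W / (q * pA) * z^-1 ^+ j.
  have W0 : 0 <= W by apply: le_trans (hW 0 point); rewrite expr0 mul1r.
  have := @decay_from_regeneration _ _ _ (kop P \o kop P) K e
    (fun f => \int[nu]_x f x) pPP pK be e0 _ _ _ (fun f => \int[pi]_x f x) ppi _ _ n j
      bn n0 _.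
  rewrite pin mul1r => main.
  have {}main : \int[pi]_x e x * (\int[nu]_x iter j (kop P \o kop P) n x - 1) <=
      \int[pi]_x iter j.+1 K (fun=> 1) x.
    apply: main.
    - by move=> g x _; exact: residual2_split.
    - by rewrite /= !kop1.
    - exact: avg1.
    - exact: avg1.
    - move=> g bg /=; rewrite !invariantE//; try exact: reversible_invariant.
      exact: bP.
    - by move=> k'; rewrite nukE// -subr_ge0 -energyE// energy_ge0.
  rewrite nukE// -energyE// (posfunZ ppi)// avg_indic// -/pA in main.
  have le2 : \int[pi]_x iter j.+1 K (fun=> 1) x <= W * z^-1 ^+ j.
    rewrite -[leRHS](_ : \int[pi]_x (W * z^-1 ^+ j) = _); last first.
      by rewrite (posfun_cst ppi) avg1// mulr1.
    apply: (posfun_le ppi); [exact/bKn/bmf_cst|exact: bmf_cst|] => x.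
    apply: (@le_trans _ _ (W * z^-1 ^+ j.+1)).
      by rewrite exprVn ler_pdivlMr// mulrC hW.
    rewrite ler_wpM2l// exprS ler_piMl ?exprn_ge0 ?invr_ge0 ?ltW//.
    by rewrite invf_lt1.
  have qp : 0 < q * pA := mulr_gt0 q_gt0 pA0.
  rewrite mulrAC ler_pdivlMr// mulrC.
  exact: le_trans main le2.
have zi0 : 0 < z^-1 by rewrite invr_gt0.
have en := energy_decay hrev bn zi0 en_bound.
rewrite nukE//; apply: (le_trans (density_mixing hrev bn k.*2 bf f1)).
apply: (@le_trans _ _ (Num.sqrt (((q * pA)^-1 - 1) * (z^-1 ^+ k) ^+ 2))).
  apply: ler_wsqrtr; apply: (le_trans (en k.*2)).
  by rewrite -exprM muln2 ler_wpM2r// exprn_ge0 ?ltW.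
have C0 : 0 <= (q * pA)^-1 - 1 := le_trans (energy_ge0 P pi n 0) energy00.
by rewrite (sqrtrM _ C0) sqrtr_sqr ger0_norm// exprn_ge0// ltW.
Qed.

Variable phi : (X -> R) -> R.
Hypotheses (pphi : posfun phi) (phi1 : phi (fun=> 1) = 1).

(** The functional [phi] is evaluation at [x] for even times, and [kop P f x]
    for odd ones. *)
Lemma small_set_convergence V k f :
  (forall j, phi (iter j K (fun=> 1)) <= V * z^-1 ^+ j) ->
  bounded_measurable f -> (forall x, `|f x| <= 1) ->
  `|phi (iter k.+1 (kop P \o kop P) f) - \int[pi]_x f x| <=
    C3 * (z^-1 ^+ k * (1 + (1 - z^-1) * k%:R * V)) +
    Num.max (2 - C3) 0 * (V * z^-1 ^+ k.+1).
Proof.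
move=> hV bf f1.
pose t j := phi (iter j K (fun=> 1)).
have pphiK j : posfun (fun f => phi (iter j K f)) by exact: posfun_comp (posop_iter j pK).
have t0 j : 0 <= t j by apply: (posfun_ge0 (pphiK j)) => //; exact: bmf_cst.
have yi : 0 <= z^-1 <= 1 by rewrite invr_ge0 ltW//= invf_le1// ltW.
have C0 : 0 <= C3 by exact: sqrtr_ge0.
apply: (le_trans (@mixing_from_regeneration _ _ _ (kop P \o kop P) K e
  (fun f => \int[nu]_x f x) pPP pK pnu be e0 _ _ _ (fun f => \int[pi]_x f x) ppi
  _ phi pphi phi1 f k.+1 (fun m => C3 * z^-1 ^+ m) bf f1 _)).
- by move=> g x _; exact: residual2_split.
- by rewrite /= !kop1.
- exact: avg1.
- exact: avg1.
- by move=> m; exact: minorizing_law_mixing.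
have -> : \sum_(j < k.+1) (phi (iter j K (fun=> 1)) - phi (iter j.+1 K (fun=> 1))) *
    (C3 * z^-1 ^+ (k.+1 - j.+1)) =
    C3 * (\sum_(j < k) (t j - t j.+1) * z^-1 ^+ (k - j) + (t k - t k.+1)).
  rewrite big_ord_recr/= subnn expr0 mulr1 -/(t k) -/(t k.+1) mulrDr mulr_sumr.
  congr (_ + _); last by rewrite mulrC.
  by apply: eq_bigr => j _; rewrite subSS mulrCA.
have phit0 : t 0%N = 1 by [].
have ab := abel_geometric z^-1 k phit0.
set s1 := \sum_(j < k) _ in ab *; set s2 := \sum_(j < k) _ in ab.
have s2V : s2 <= k%:R * V * z^-1 ^+ k.
  rewrite -[leRHS](_ : \sum_(j < k) V * z^-1 ^+ k = _); last first.
    by rewrite sumr_const card_ord -[LHS]mulr_natl mulrA.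
  apply: ler_sum => j _.
  apply: (@le_trans _ _ (V * z^-1 ^+ j.+1 * z^-1 ^+ (k - j.+1))).
    apply: ler_wpM2r; last exact: hV.
    by apply: exprn_ge0; case/andP: yi.
  by rewrite -mulrA -exprD subnKC.
have h1 : C3 * (s1 + t k) <= C3 * (z^-1 ^+ k * (1 + (1 - z^-1) * k%:R * V)).
  rewrite ab ler_wpM2l//.
  have : (1 - z^-1) * s2 <= (1 - z^-1) * (k%:R * V * z^-1 ^+ k).
    by rewrite ler_wpM2l// subr_ge0; case/andP: yi.
  by set p := z^-1 ^+ k; lra.
have h2 : (2 - C3) * t k.+1 <= Num.max (2 - C3) 0 * (V * z^-1 ^+ k.+1).
  apply: (@le_trans _ _ (Num.max (2 - C3) 0 * t k.+1)).
    by rewrite ler_wpM2r// le_max lexx.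
  by rewrite ler_wpM2l ?hV// le_max lexx orbT.
rewrite -/(t k.+1).
by move: h1 h2; rewrite mulrDr mulrDr; lra.
Qed.

End mixing.
End small_set.

(** * Geometric sums and comparison of constants *)

Section numeric.
Context {R : realType}.
Implicit Types (r D E S u y : R).

Lemma sum_affine_geometric r D E n : 1 < r ->
  \sum_(k < n) (D + E * k%:R) * r ^- k =
  r / (r - 1) * ((D + E / (r - 1)) - (D + E / (r - 1) + E * n%:R) * r ^- n).
Proof.
move=> r1; have r0 : r != 0 by rewrite gt_eqF//; lra.
have r10 : r - 1 != 0 by rewrite subr_eq0 gt_eqF.
elim: n => [|n IH]; first by rewrite big_ord0 expr0 invr1; ring.
rewrite big_ord_recr/= IH exprS invfM -natr1.
by set p := r ^- n; field; rewrite r0 r10.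
Qed.

Lemma sum_two_geometric r1 r2 F G n : 1 < r1 -> 1 < r2 ->
  \sum_(k < n) (F * r1 ^- k + G * r2 ^- k) =
  r1 / (r1 - 1) * F * (1 - r1 ^- n) + r2 / (r2 - 1) * G * (1 - r2 ^- n).
Proof.
move=> h1 h2; rewrite big_split/=.
have gen r H : 1 < r -> \sum_(k < n) H * r ^- k = r / (r - 1) * H * (1 - r ^- n).
  move=> hr; have := sum_affine_geometric H 0 n hr.
  rewrite mul0r !addr0 mul0r addr0 => e.
  transitivity (\sum_(k < n) (H + 0 * k%:R) * r ^- k).
    by apply: eq_bigr => k _; rewrite mul0r addr0.
  by rewrite e; ring.
by rewrite !gen.
Qed.

Lemma cvg_inv_expr r : 1 < r -> (fun n => r ^- n) @ \oo --> (0 : R).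
Proof.
move=> r1; have := @cvg_expr R r^-1.
under [X in X @ _]funext do rewrite exprVn.
by apply; rewrite ger0_norm ?invr_ge0; [rewrite invf_lt1//|]; lra.
Qed.

(** Bernoulli's inequality for the square root [w] of [r] bounds [n / w ^+ n]. *)
Lemma cvg_natr_inv_expr r : 1 < r -> (fun n => n%:R * r ^- n) @ \oo --> (0 : R).
Proof.
move=> r1; have r0 : 0 < r by lra.
(* half of the decay absorbs the factor n, the other half tends to 0 *)
pose w := Num.sqrt r.
have w2 : w ^+ 2 = r by rewrite sqr_sqrtr// ltW.
have w1 : 1 < w by rewrite -sqrtr1 ltr_sqrt.
have w0 : 0 < w by lra.
have bern n : 1 + n%:R * (w - 1) <= w ^+ n.
  elim: n => [|n IH]; first by rewrite mul0r addr0 expr0.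
  rewrite exprS -natr1; have n0 : 0 <= n%:R :> R by [].
  have : w * (1 + n%:R * (w - 1)) <= w * w ^+ n by rewrite ler_pM2l.
  apply: le_trans; rewrite -subr_ge0.
  have -> : w * (1 + n%:R * (w - 1)) - (1 + (n%:R + 1) * (w - 1)) = n%:R * (w - 1) ^+ 2
    by ring.
  by rewrite mulr_ge0// sqr_ge0.
have lim : (fun n => (w - 1)^-1 * w ^- n) @ \oo --> (0 : R).
  by rewrite -(mulr0 (w - 1)^-1); apply: cvgMr; exact: cvg_inv_expr.
apply: (squeeze_cvgr _ (cvg_cst 0) lim).
near=> n; apply/andP; split.
  by apply: mulr_ge0 => //; rewrite invr_ge0 exprn_ge0// ltW.
have wn : 0 < w ^+ n by rewrite exprn_gt0.
have w10 : 0 < w - 1 by lra.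
have -> : r ^- n = w ^- n * w ^- n by rewrite -invfM -expr2 -exprM mulnC exprM w2.
have wi : 0 < w ^- n by rewrite invr_gt0.
rewrite mulrA ler_pM2r// ler_pdivrMr// mulrC ler_pdivlMr//.
by have := bern n; lra.
Unshelve. all: by end_near. Qed.

Lemma geometric_convolution_neq S u y n : u != y ->
  \sum_(j < n) S * u ^+ j.+1 * y ^+ (n - j.+1) = S * u * (u ^+ n - y ^+ n) / (u - y).
Proof.
move=> uy; have uy0 : u - y != 0 by rewrite subr_eq0.
elim: n => [|n IH]; first by rewrite big_ord0 !expr0 subrr mulr0 mul0r.
rewrite big_ord_recr/= subnn expr0 mulr1.
have -> : \sum_(j < n) S * u ^+ j.+1 * y ^+ (n.+1 - j.+1) =
   y * \sum_(j < n) S * u ^+ j.+1 * y ^+ (n - j.+1).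
  rewrite mulr_sumr; apply: eq_bigr => j _.
  by rewrite (subSn (ltn_ord j)) (exprS y) mulrCA.
rewrite IH !exprS; set a := u ^+ n; set b := y ^+ n.
by field; rewrite uy0.
Qed.

Lemma geometric_convolution_eq S u n :
  \sum_(j < n) S * u ^+ j.+1 * u ^+ (n - j.+1) = n%:R * S * u ^+ n.
Proof.
rewrite -[RHS](_ : \sum_(j < n) S * u ^+ n = _); last first.
  by rewrite sumr_const card_ord -[LHS]mulr_natl mulrA.
by apply: eq_bigr => j _; rewrite -mulrA -exprD subnKC.
Qed.

(** Continuity of [s |-> a * s ^+ n] at [r]. *)
Lemma ler_expr_left (a b r : R) n : 1 < r ->
  (forall s, 1 < s -> s < r -> a * s ^+ n <= b) -> a * r ^+ n <= b.
Proof.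
move=> r1 h.
have cv : (fun s => a * s ^+ n) s @[s --> r^'-] --> a * r ^+ n.
  apply: cvg_at_left_filter; apply: cvgMr; exact: exprn_continuous.
rewrite -(cvg_lim _ cv)//; apply: limr_le; first by apply/cvg_ex; eexists; exact: cv.
by near=> s; apply: h; near: s; [exact: nbhs_left_gt|exact: nbhs_left_lt].
Unshelve. all: by end_near. Qed.

(** Compares the bound obtained from an atom with the constants [F1] and [G1]; the
    only loss is the replacement of [S] by [lam * S] in the convolution. *)
Lemma atom_bound_neq (C mx S lam r : R) n : 0 <= C -> 0 <= S -> 1 < lam -> 1 < r ->
  lam != r ->
  C * (r^-1 ^+ n + (1 - r^-1) * \sum_(j < n) S * lam^-1 ^+ j.+1 * r^-1 ^+ (n - j.+1)) +
    mx * (S * lam^-1 ^+ n) <=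
  C * (1 - (r - 1) / (r - lam) * (lam * S)) * r ^- n +
  (lam * S) * (mx * lam^-1 + (r - 1) / (r - lam) * C) * lam ^- n.
Proof.
move=> C0 S0 lam1 r1 lr.
have lam0 : lam != 0 by rewrite gt_eqF//; lra.
have r0 : r != 0 by rewrite gt_eqF//; lra.
have rl : r - lam != 0 by rewrite subr_eq0 eq_sym.
have lpos : 0 < lam by lra.
have rpos : 0 < r by lra.
have ur : lam^-1 != r^-1 by rewrite (inj_eq invr_inj).
have ur0 : lam^-1 - r^-1 != 0 by rewrite subr_eq0.
set X := \sum_(j < n) _.
have X0 : 0 <= X.
  by apply: sumr_ge0 => j _; rewrite !mulr_ge0// exprn_ge0// invr_ge0 ltW.
have XE : X = S * lam^-1 * (lam ^- n - r ^- n) / (lam^-1 - r^-1).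
  by rewrite /X geometric_convolution_neq// !exprVn.
have key : lam * ((1 - r^-1) * X) = (r - 1) / (r - lam) * (lam * S) * (lam ^- n - r ^- n).
  rewrite XE; set a := lam ^- n; set b := r ^- n.
  have -> : (lam^-1 - r^-1) = (r - lam) / (lam * r) by field; rewrite lam0 r0.
  by field; rewrite rl lam0 r0.
rewrite !exprVn.
have -> : C * (1 - (r - 1) / (r - lam) * (lam * S)) * r ^- n +
  (lam * S) * (mx * lam^-1 + (r - 1) / (r - lam) * C) * lam ^- n =
  C * (r ^- n + (r - 1) / (r - lam) * (lam * S) * (lam ^- n - r ^- n)) + mx * (S * lam
    ^- n).
  by set a := lam ^- n; set b := r ^- n; field; rewrite rl lam0.
have Y0 : 0 <= (1 - r^-1) * X.
  by apply: mulr_ge0 => //; rewrite subr_ge0 invf_le1// ltW.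
by rewrite -key lerD2r ler_wpM2l// lerD2l ler_peMl// ltW.
Qed.

Lemma atom_bound_eq (C mx S lam : R) n : 0 <= C -> 0 <= S -> 1 < lam ->
  C * (lam^-1 ^+ n + (1 - lam^-1) * \sum_(j < n) S * lam^-1 ^+ j.+1 * lam^-1 ^+ (n -
    j.+1)) +
    mx * (S * lam^-1 ^+ n) <=
  ((C + mx * lam^-1 * (lam * S)) + C * (1 - lam^-1) * (lam * S) * n%:R) * lam ^- n.
Proof.
move=> C0 S0 lam1; have lpos : 0 < lam by lra.
have lam0 : lam != 0 by rewrite gt_eqF.
rewrite geometric_convolution_eq !exprVn.
have p0 : 0 <= lam ^- n by rewrite invr_ge0 exprn_ge0// ltW.
have i1 : 0 <= 1 - lam^-1 by rewrite subr_ge0 invf_le1// ltW.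
set p := lam ^- n in p0 *.
have e : mx * lam^-1 * (lam * S) = mx * S by field.
rewrite e -subr_ge0.
have -> : (C + mx * S + C * (1 - lam^-1) * (lam * S) * n%:R) * p -
   (C * (p + (1 - lam^-1) * (n%:R * S * p)) + mx * (S * p)) =
   C * (1 - lam^-1) * (S * n%:R * p) * (lam - 1) by ring.
by rewrite !mulr_ge0// subr_ge0 ltW.
Qed.

(** The law [nu P^(2 k)] is controlled only at rate [lam ^- (2 k)], although it
    occurs [k + 1] two-step transitions after the start from the small set. The
    resulting factor [lam ^+ 2] is compensated by the linear term, which involves
    [k] instead of [k + 1], because [M3 >= lam ^+ 2]. *)
Lemma small_set_bound_even (C mx M3 lam : R) k : 0 <= C -> 1 < lam -> lam ^+ 2 <= M3 ->
  C * ((lam ^+ 2)^-1 ^+ k * (1 + (1 - (lam ^+ 2)^-1) * k%:R * (M3 / lam))) +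
    mx * (M3 / lam * (lam ^+ 2)^-1 ^+ k.+1) <=
  ((C * lam + mx * lam^-1 * M3) + C * (lam - lam^-1) * M3 / 2 * (k.+1.*2)%:R) *
    lam ^- k.+1.*2.
Proof.
move=> C0 lam1 M3l; have lpos : 0 < lam by lra.
have lam0 : lam != 0 by rewrite gt_eqF.
have e : lam ^- k.+1.*2 = (lam ^+ 2)^-1 ^+ k * (lam ^+ 2)^-1.
  by rewrite -exprSr exprVn -exprM mul2n.
have p0 : 0 <= (lam ^+ 2)^-1 ^+ k by rewrite exprn_ge0// invr_ge0 exprn_ge0// ltW.
have nk : (k.+1.*2)%:R = 2 * (k%:R + 1) :> R by rewrite -mul2n natrM -[k.+1%:R]natr1.
rewrite e nk (exprSr _ k).
set p := (lam ^+ 2)^-1 ^+ k in p0 *.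
rewrite -subr_ge0.
have -> : (C * lam + mx / lam * M3 + C * (lam - lam^-1) * M3 / 2 * (2 * (k%:R + 1))) *
  (p / lam ^+ 2) -
  (C * (p * (1 + (1 - (lam ^+ 2)^-1) * k%:R * (M3 / lam))) + mx * (M3 / lam * (p / lam
    ^+ 2))) =
  C * (p / lam ^+ 2) * ((lam - lam^-1) * M3 - (lam ^+ 2 - lam)).
  by field.
apply: mulr_ge0; first by rewrite !mulr_ge0// invr_ge0 exprn_ge0// ltW.
have i1 : 0 <= lam - lam^-1.
  by rewrite subr_ge0 (le_trans _ (ltW lam1))// invf_le1// ltW.
have := ler_wpM2l i1 M3l.
have -> : (lam - lam^-1) * lam ^+ 2 = lam ^+ 2 * lam - lam by field.
have : lam ^+ 2 <= lam ^+ 2 * lam by rewrite ler_peMr ?sqr_ge0// ltW.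
by lra.
Qed.

Lemma small_set_bound_odd (C mx M3 lam : R) k : 0 <= C -> 1 < lam -> lam ^+ 2 <= M3 ->
  C * ((lam ^+ 2)^-1 ^+ k * (1 + (1 - (lam ^+ 2)^-1) * k%:R * (M3 / lam ^+ 2))) +
    mx * (M3 / lam ^+ 2 * (lam ^+ 2)^-1 ^+ k.+1) <=
  ((C * lam + mx * lam^-1 * M3) + C * (lam - lam^-1) * M3 / 2 * (k.+1.*2.+1)%:R) *
    lam ^- k.+1.*2.+1.
Proof.
move=> C0 lam1 M3l; have lpos : 0 < lam by lra.
have lam0 : lam != 0 by rewrite gt_eqF.
have e : lam ^- k.+1.*2.+1 = (lam ^+ 2)^-1 ^+ k * (lam ^+ 2)^-1 * lam^-1.
  rewrite exprSr invfM; congr (_ * _).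
  by rewrite -exprSr exprVn -exprM mul2n.
have p0 : 0 <= (lam ^+ 2)^-1 ^+ k by rewrite exprn_ge0// invr_ge0 exprn_ge0// ltW.
have nk : (k.+1.*2.+1)%:R = 2 * (k%:R + 1) + 1 :> R.
  by rewrite -[k.+1.*2.+1]addn1 natrD -mul2n natrM -[k.+1%:R]natr1.
rewrite e nk (exprSr _ k).
set p := (lam ^+ 2)^-1 ^+ k in p0 *.
rewrite -subr_ge0.
have -> : (C * lam + mx / lam * M3 + C * (lam - lam^-1) * M3 / 2 * (2 * (k%:R + 1) +
  1)) * (p / lam ^+ 2 / lam) -
  (C * (p * (1 + (1 - (lam ^+ 2)^-1) * k%:R * (M3 / lam ^+ 2))) + mx * (M3 / lam ^+ 2 *
    (p / lam ^+ 2))) =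
  C * (p / lam ^+ 2 / lam) * ((lam - lam^-1) * M3 * (3 / 2) - (lam ^+ 2 * lam - lam)).
  by field.
apply: mulr_ge0; first by rewrite !mulr_ge0// invr_ge0 ?exprn_ge0// ltW.
have i1 : 0 <= lam - lam^-1.
  by rewrite subr_ge0 (le_trans _ (ltW lam1))// invf_le1// ltW.
have := ler_wpM2l i1 M3l.
have -> : (lam - lam^-1) * lam ^+ 2 = lam ^+ 2 * lam - lam by field.
have : 0 <= (lam - lam^-1) * M3 by rewrite mulr_ge0// (le_trans _ M3l)// sqr_ge0.
by lra.
Qed.

End numeric.

(** * Uniform rates in terms of the mean hitting time *)

Lemma exp_inv_ln {R : realType} (M lam : R) : 0 <= M -> 1 < lam ->
  (lam%:E < exp_inv M%:E)%E -> M * ln lam < 1.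
Proof.
rewrite /exp_inv inver => M0 lam1; have lam0 : 0 < lam by lra.
move: M0; rewrite le_eqVlt => /predU1P[<- _|M0]; first by rewrite mul0r.
rewrite gt_eqF//= lte_fin => h.
have : ln lam < M^-1 by rewrite -[M^-1]expRK ltr_ln ?posrE// expR_gt0.
by rewrite -[M^-1]mul1r ltr_pdivlMr// mulrC.
Qed.

Section chain_rates.
Context {R : realType} {d d' : measure_display}.
Context {X : measurableType d} {Omega : measurableType d'}.
Variables (P : R.-pker X ~> X) (Pr : X -> probability Omega R).
Variables (Phi : nat -> Omega -> X) (A : set X).
Hypotheses (hchain : markov_chain P Pr Phi) (mA : measurable A).
Hypothesis fin : (sup_mean_hit Pr Phi A < +oo)%E.

Let M := fine (sup_mean_hit Pr Phi A).
Let M0 : 0 <= M. Proof. by rewrite fine_ge0// sup_mean_hit_ge0. Qed.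
Let ME : sup_mean_hit Pr Phi A = M%:E.
Proof. by rewrite fineK// ge0_fin_numE// sup_mean_hit_ge0. Qed.
Let Q := killed A (kop P).

Lemma mean_hit_ln lam : 1 < lam -> (lam%:E < exp_inv (sup_mean_hit Pr Phi A))%E ->
  M * ln lam < 1.
Proof. by rewrite ME; exact: exp_inv_ln. Qed.

(** From the bound with [1 - lam^-1], by [1 - lam^-1 <= ln lam]. *)
Lemma hitting_gf_ln_bound lam : 1 < lam -> (lam%:E < exp_inv (sup_mean_hit Pr Phi A))%E ->
  forall n x, hitting_gf (kop P) A lam n x <= (1 - M * ln lam)^-1.
Proof.
move=> lam1 hlam n x; have Mln := mean_hit_ln lam1 hlam.
have lam0 : 0 < lam by lra.
have le_ln : 1 - lam^-1 <= ln lam.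
  have := expR_ge1Dx (- ln lam); rewrite expRN lnK ?posrE//; lra.
have kM : (1 - lam^-1) * M <= M * ln lam by rewrite mulrC ler_wpM2l.
apply: (@le_trans _ _ ((1 - (1 - lam^-1) * M)^-1)).
  apply: (hitting_gf_le (posop_kop P) (kop1 P) mA lam1); first exact: le_lt_trans kM Mln.
  by move=> k y; exact: (sum_survival_le hchain mA).
by rewrite lef_pV2 ?posrE; lra.
Qed.

Lemma survival_ln_bound lam : 1 < lam -> (lam%:E < exp_inv (sup_mean_hit Pr Phi A))%E ->
  forall n x, iter n Q (fun=> 1) x <= (1 - M * ln lam)^-1 * lam^-1 ^+ n.
Proof.
move=> lam1 hlam n x; have lam0 : 0 < lam by lra.
rewrite exprVn ler_pdivlMr ?exprn_gt0// mulrC.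
apply: le_trans (hitting_gf_ln_bound lam1 hlam n x).
exact: (survival_le_hitting_gf (posop_kop P) mA).
Qed.

Lemma even_hitting_gf_ln_bound lam th : 1 < lam ->
  (lam%:E < exp_inv (sup_mean_hit Pr Phi A))%E -> 0 <= th -> th < 1 ->
  (sup_even_return Pr Phi A lam <= th%:E)%E ->
  forall m b x, even_hitting_gf (kop P) A lam m b x <=
    lam * (1 - M * ln lam)^-1 ^+ 2 / (1 - th).
Proof.
move=> lam1 hlam th0 th1 hth.
apply: (even_hitting_gf_le (posop_kop P) (kop1 P) mA lam1 th0 th1).
  exact: hitting_gf_ln_bound.
move=> m x Ax; apply: (even_return_ub hchain mA _ hth) => //.
by rewrite ltW// (lt_trans _ lam1).
Qed.

Lemma even_return_sup_ge0 s x : 0 <= s -> A x -> (0 <= sup_even_return Pr Phi A s)%E.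
Proof.
move=> s0 Ax; apply: (@le_trans _ _ (\sum_(1 <= n <oo)
    (s ^+ (2 * n))%:E * first_return Pr Phi (2 * n) x A)%E).
  apply: nneseries_ge0 => n _ _.
  by rewrite mule_ge0 ?lee_fin ?exprn_ge0// /first_return measure_ge0.
by apply: ereal_sup_ubound; exists x.
Qed.

Section atom_rate.
Variables (pi nu : probability X R).
Hypotheses (hrev : reversible P pi) (hirr : irreducible P pi).
Hypothesis atomA : forall x B, A x -> measurable B -> P x B = nu B.
Let pA := fine (pi A).
Hypothesis pA0 : 0 < pA.
Let h x : R := pA^-1 * \1_A x.

Let exA : exists x, A x.
Proof.
apply/not_existsP => hn; move: pA0; rewrite /pA.
by rewrite (_ : A = set0) ?measure0 ?ltxx//; apply/seteqP; split => // x /hn.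
Qed.

(** A vanishing mean hitting time means that the chain starts in [A] whatever its
    starting point. *)
Lemma atom_of_zero_mean_hit : M = 0 -> pA = 1.
Proof.
move=> M00; suff AT : A = setT by rewrite /pA AT probability_setT.
apply/seteqP; split => // x _.
have := sum_survival_le hchain mA 1 x fin; rewrite -/M M00 big_ord1/=.
rewrite /killed kop1 mulr1 indicC; have [//|nAx] := pselect (A x).
by rewrite indic_notin// subr0 ler10.
Qed.

Let r := rho Pr Phi A.

(** When the mean hitting time is positive, [exp_inv] is finite and bounds the set. *)
Lemma rho_has_sup : 0 < M -> has_sup [set s : R | [/\ 0 <= s,
  (s%:E < exp_inv (sup_mean_hit Pr Phi A))%E & (sup_even_return Pr Phi A s < 1)%E]].
Proof.
move=> Mpos; split.
  exists 0; split => //; first by rewrite ME /exp_inv inver gt_eqF//= lte_fin expR_gt0.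
  apply: le_lt_trans (_ : (0%:E < 1)%E); last by rewrite lte_fin.
  apply: (even_return_lub hchain mA) => // m x _.
  by rewrite big1// => j _; rewrite expr0n/= mul0r.
exists (expR M^-1) => s [_ + _].
by rewrite ME /exp_inv inver gt_eqF//= lte_fin => /ltW.
Qed.

Lemma rho_gt1 lam : 0 < M -> 1 < lam ->
  (lam%:E < exp_inv (sup_mean_hit Pr Phi A))%E -> 1 < r.
Proof.
move=> Mpos lam1 hlam.
have hS n x : iter n (killed A (kop P)) (fun=> 1) x <= (1 - M * ln lam)^-1 * lam ^- n.
  by rewrite -exprVn; exact: survival_ln_bound.
have [s [th [s1 slam th1 hs]]] := even_return_gf_lt1 mA atomA pA0 hirr lam1 hS.
have s0 : 0 <= s by lra.
apply: (lt_le_trans s1); apply: (sup_upper_bound (rho_has_sup Mpos)); split => //.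
  by apply: lt_trans hlam; rewrite lte_fin.
apply: (@le_lt_trans _ _ th%:E); last by rewrite lte_fin.
apply: (even_return_lub hchain mA) => // m x Ax.
rewrite (eq_bigr (fun j : 'I_m => s ^+ j.+1 * \int[nu]_y iter j (killed A (kop P)) \1_A y)).
  exact: hs.
by move=> j _; rewrite (kop_atom atomA).
Qed.

(** The bound holds for every element of the set that defines [rho], hence at its
    supremum by continuity of powers. *)
Lemma atom_energy_rho k : 0 < M -> 1 < r ->
  energy P pi h k <= energy P pi h 0 * (r^-1 ^+ 2) ^+ k.
Proof.
move=> Mpos r1; have r0 : 0 < r by lra.
have [x0 Ax0] := exA.
rewrite -exprM exprVn ler_pdivlMr ?exprn_gt0//.
apply: ler_expr_left => // s s1 sr.
have s0 : 0 < s by lra.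
have rs0 : 0 < r - s by lra.
have [s' [s'0 s'M s'F]] := sup_adherent rs0 (rho_has_sup Mpos).
rewrite -/(rho Pr Phi A) -/r opprB addrC subrK => ss'.
have s'1 : 1 < s' by lra.
pose th := fine (sup_even_return Pr Phi A s').
have F0 := even_return_sup_ge0 s'0 Ax0.
have thE : sup_even_return Pr Phi A s' = th%:E.
  by rewrite fineK// ge0_fin_numE// (lt_trans s'F)// ltry.
have th0 : 0 <= th by rewrite fine_ge0.
have th1 : th < 1 by rewrite -lte_fin -thE.
have hth : (sup_even_return Pr Phi A s' <= th%:E)%E by rewrite thE.
have hB := even_hitting_gf_ln_bound s'1 s'M th0 th1 hth.
have s'pos : 0 < s' by lra.
have hK n x : s' ^+ n.*2 * iter n (killed A (kop P \o kop P)) (fun=> 1) x <=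
    s' * (1 - M * ln s')^-1 ^+ 2 / (1 - th).
  apply: le_trans (hB n.*2 true x).
  by apply: (even_survival_le (posop_kop P) mA).
have := atom_energy_decay hrev mA atomA pA0 s'pos hK k.
rewrite -/h -exprVn -exprM exprVn ler_pdivlMr ?exprn_gt0//.
apply: le_trans; apply: ler_wpM2l; first exact: energy_ge0.
by apply: lerXn2r; rewrite ?nnegrE ltW.
Qed.

Let C1 := Num.sqrt (pA^-1 - 1).

(** If the mean hitting time vanishes, then so does [C1], and the energy is
    identically zero; otherwise [rho] exceeds 1. *)
Lemma atom_rate lam : 1 < lam ->
  (lam%:E < exp_inv (sup_mean_hit Pr Phi A))%E ->
  let S := (1 - M * ln lam)^-1 in
  (C1 = 0 \/ 1 < r) /\ 0 <= S /\
  forall n x f, bounded_measurable f -> (forall x, `|f x| <= 1) ->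
  `|iter n (kop P) f x - \int[pi]_y f y| <=
    C1 * (r^-1 ^+ n + (1 - r^-1) * \sum_(j < n) S * lam^-1 ^+ j.+1 * r^-1 ^+ (n - j.+1)) +
    Num.max (2 - C1) 0 * (S * lam^-1 ^+ n).
Proof.
move=> lam1 hlam S.
have S0 : 0 <= S by rewrite invr_ge0 subr_ge0 ltW// mean_hit_ln.
have hS := survival_ln_bound lam1 hlam.
have := M0; rewrite le_eqVlt => /predU1P[/esym M00|Mpos].
  have C10 : C1 = 0 by rewrite /C1 (atom_of_zero_mean_hit M00) invr1 subrr sqrtr0.
  split; [by left|split] => // n x f bf f1.
  have en k : energy P pi h k <= energy P pi h 0 * (1 ^+ 2) ^+ k.
    have e00 : energy P pi h 0 = 0.
      by rewrite (atom_energy0 hrev mA pA0) -/pA (atom_of_zero_mean_hit M00) invr1 subrr.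
    have bh : bounded_measurable h by apply: bmfZ; exact: bmf_indic.
    have := energy_sqr_le hrev bh k; rewrite e00 mul0r => e2.
    rewrite mul0r; suff -> : energy P pi h k = 0 by [].
    by apply/eqP; rewrite -sqrf_eq0 eq_le e2 sqr_ge0.
  have := @atom_convergence _ _ _ P pi nu A mA atomA C1 1 S lam^-1 _ _ _ hS n x f bf f1.
  rewrite C10 !mul0r => main; apply: main => //; first by rewrite ler01 lexx.
  move=> m g bg g1; have := atom_mixing hrev mA atomA pA0 m ler01 en bg g1.
  by rewrite -/C1 C10 mul0r.
have r1 := rho_gt1 Mpos lam1 hlam.
split; [by right|split] => //.
have ri : 0 <= r^-1 by rewrite invr_ge0; lra.
apply: (atom_convergence mA atomA) => //.
- exact: sqrtr_ge0.
- by rewrite ri invf_le1 ?ltW//; lra.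
- move=> m f bf f1; apply: (atom_mixing hrev mA atomA pA0 m ri _ bf f1) => k.
  exact: atom_energy_rho.
Qed.

End atom_rate.

Section small_set_rate.
Variables (pi nu : probability X R) (delta : R).
Hypotheses (hrev : reversible P pi) (delta0 : 0 < delta).
Hypothesis minor : forall x B, measurable B ->
  ((delta * \1_A x)%:E * nu B <= P x B)%E.
Let pA := fine (pi A).
Hypothesis pA0 : 0 < pA.
Let q := delta ^+ 2 * fine (nu A).
Let C3 := Num.sqrt ((q * pA)^-1 - 1).

(** Even times are reached by the two-step chain started at [x], odd times by the
    two-step chain started after one transition from [x]. This treats both
    parities with the same exponential moment of the regeneration time. *)
Lemma small_set_rate lam th : 1 < lam ->
  (lam%:E < exp_inv (sup_mean_hit Pr Phi A))%E -> th < 1 ->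
  (sup_even_return Pr Phi A lam <= th%:E)%E ->
  lam ^+ 2 < (1 - th) * (1 - M * ln lam) ^+ 2 * (1 + q * lam ^+ 2) ->
  let M3 := q * lam ^+ 2 / ((1 - th) * (1 - M * ln lam) ^+ 2 * (1 + q * lam ^+ 2)
         - lam ^+ 2) in
  let D3 := C3 * lam + Num.max (2 - C3) 0 * lam^-1 * M3 in
  let E3 := C3 * (lam - lam^-1) * M3 / 2 in
  forall n x f, bounded_measurable f -> (forall x, `|f x| <= 1) ->
  `|iter n (kop P) f x - \int[pi]_y f y| <= (D3 + E3 * n%:R) * lam ^- n.
Proof.
move=> lam1 hlam th1 hth hcond M3 D3 E3 n x f bf f1.
have lam0 : 0 < lam by lra.
have [x0 Ax0] := small_set_nonempty pA0.
have th0 : 0 <= th.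
  by rewrite -lee_fin (le_trans _ hth)// (even_return_sup_ge0 _ Ax0)// ltW.
pose L := 1 - M * ln lam.
have L0 : 0 < L by rewrite subr_gt0 mean_hit_ln.
have L1 : L <= 1.
  by rewrite gerBl mulr_ge0// ln_ge0// ltW.
rewrite -/L in M3 D3 E3 hcond *.
have t1 : 0 < 1 - th by lra.
pose b := lam ^+ 2 * L^-1 ^+ 2 / (1 - th).
have hb m c y : even_hitting_gf (kop P) A lam m c y <= b / lam.
  have -> : b / lam = lam * L^-1 ^+ 2 / (1 - th).
    by rewrite /b; field; rewrite !gt_eqF.
  exact: even_hitting_gf_ln_bound.
have z1 : 1 < lam ^+ 2 by rewrite exprn_egt1.
have c0 : 0 < (1 - th) * L ^+ 2 by rewrite mulr_gt0// exprn_gt0.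
have bE : b = lam ^+ 2 / ((1 - th) * L ^+ 2) by rewrite /b; field; rewrite !gt_eqF.
have b_lt : b < 1 + q * lam ^+ 2.
  by rewrite bE ltr_pdivrMr// [_ * ((1 - th) * _)]mulrC.
have bz : lam ^+ 2 <= b.
  rewrite bE ler_pdivlMr// -[leRHS]mulr1 ler_pM2l ?exprn_gt0//.
  rewrite -[leRHS]mulr1; apply: ler_pM; [lra|exact: sqr_ge0|lra|].
  by rewrite expr_le1// ltW.
have q_gt0 : 0 < q.
  have : 0 < q * lam ^+ 2 by lra.
  by rewrite pmulr_lgt0// exprn_gt0.
have q1 : q <= 1 := two_step_mass_le1 mA delta0 minor pA0.
pose w := q / (1 + q * lam ^+ 2 - b).
have D0 : 0 < 1 + q * lam ^+ 2 - b by lra.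
have M3E : M3 = w * b.
  have d0 : 0 < (1 - th) * L ^+ 2 * (1 + q * lam ^+ 2) - lam ^+ 2 by lra.
  rewrite /M3 /w.
  have -> : 1 + q * lam ^+ 2 - b =
      ((1 - th) * L ^+ 2 * (1 + q * lam ^+ 2) - lam ^+ 2) / ((1 - th) * L ^+ 2).
    by rewrite bE; field; rewrite !gt_eqF.
  rewrite bE; move: (gt_eqF d0) (gt_eqF c0).
  set u := _ - lam ^+ 2; set v := (1 - th) * _ => hu hv.
  by field; rewrite hu hv.
have w1 : 1 <= w.
  rewrite /w ler_pdivlMr// mul1r.
  have : 0 <= (1 - q) * (lam ^+ 2 - 1) by rewrite mulr_ge0// subr_ge0// ltW.
  by lra.
have M3l : lam ^+ 2 <= M3.
  rewrite M3E (le_trans bz)// ler_peMl// (le_trans _ bz)//; lra.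
pose K := residual2 P nu A delta.
have pK : posop K := posop_residual2 mA delta0 minor.
have nuT := @probability_setT _ _ _ nu.
have surv := split_survival_bounds (posop_kop P) (kop1 P) mA pK (posfun_avg nuT)
  (avg1 nuT) (ltW q_gt0) q1 lam1 (fun f x _ => residual2_split P nu A delta f x) hb b_lt.
rewrite -/w -M3E in surv.
have zE j : (lam ^+ 2)^-1 ^+ j = lam ^- j.*2 by rewrite exprVn -exprM mul2n.
have hW j y : (lam ^+ 2) ^+ j * iter j K (fun=> 1) y <= M3 / lam.
  by rewrite -exprM mul2n; have [] := surv j y.
have hV y j : iter j K (fun=> 1) y <= M3 / lam * (lam ^+ 2)^-1 ^+ j.
  rewrite zE ler_pdivlMr ?exprn_gt0// mulrC.
  by have [] := surv j y.
have hV' y j : kop P (iter j K (fun=> 1)) y <= M3 / lam ^+ 2 * (lam ^+ 2)^-1 ^+ j.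
  rewrite zE ler_pdivlMr ?exprn_gt0// mulrC.
  have [_] := surv j y; rewrite exprS -mulrA -ler_pdivlMl//.
  move=> /le_trans; apply; rewrite le_eqVlt; apply/orP; left; apply/eqP.
  by field; rewrite gt_eqF.
have C30 : 0 <= C3 by exact: sqrtr_ge0.
pose mx := Num.max (2 - C3) 0.
have mx2 : 2 <= C3 + mx by rewrite -lerBlDl le_max lexx.
have mx0 : 0 <= mx by rewrite le_max lexx orbT.
have ppi := posfun_avg (@probability_setT _ _ _ pi).
have pi1 := avg1 (@probability_setT _ _ _ pi).
have M30 : 0 <= M3 by rewrite (le_trans _ M3l)// sqr_ge0.
have lam_inv : 0 <= lam - lam^-1.
  by rewrite subr_ge0 (le_trans _ (ltW lam1))// invf_le1// ltW.
have E30 : 0 <= E3.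
  apply: mulr_ge0; last by rewrite invr_ge0.
  by apply: mulr_ge0; [exact: mulr_ge0|exact: M30].
have D32 : 2 * lam <= D3.
  rewrite /D3 -/mx -mulrA.
  have : lam <= lam^-1 * M3 by rewrite ler_pdivlMl// -expr2.
  move=> hl; have := ler_wpM2l mx0 hl.
  by have := ler_wpM2r (ltW lam0) mx2; lra.
have b0 : `|iter 0 (kop P) f x - \int[pi]_y f y| <= 2.
  exact: (posfun_dist_le2 (posfun_at x) ppi).
rewrite -[n]odd_double_half; case: (odd n); case: n./2 => [|k].
- have b1 : `|kop P f x - \int[pi]_y f y| <= 2.
    by apply: (posfun_dist_le2 (posop_at (posop_kop P) x) ppi) => //; rewrite kop1.
  apply: (le_trans b1); rewrite addn0 expr1 mulr1 ler_pdivlMr//.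
  by apply: (le_trans D32); rewrite lerDl.
- rewrite add1n.
  have := @small_set_convergence _ _ _ P pi nu A delta hrev mA delta0 minor pA0
    (lam ^+ 2) (M3 / lam) q_gt0 z1 hW (fun g => kop P g x) (posop_at (posop_kop P) x)
    _ (M3 / lam ^+ 2) k f (hV' x) bf f1.
  rewrite kop1 => /(_ erefl).
  rewrite iter_two_step -iterS => h1; apply: (le_trans h1).
  exact: small_set_bound_odd.
- apply: (le_trans b0); rewrite addn0 expr0 invr1 mulr0 addr0 mulr1.
  by apply: le_trans D32; lra.
- rewrite add0n.
  have := @small_set_convergence _ _ _ P pi nu A delta hrev mA delta0 minor pA0
    (lam ^+ 2) (M3 / lam) q_gt0 z1 hW (fun g => g x) (posfun_at x)
    erefl (M3 / lam) k f (hV x) bf f1.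
  rewrite iter_two_step => h1; apply: (le_trans h1).
  exact: small_set_bound_even.
Qed.

End small_set_rate.
End chain_rates.

(** * Conclusion *)

(** The bounds of the theorem are the partial sums of the uniform convergence
    rates [beta] and their limit. *)
Lemma perturbation_bounds {R : realType} {d} {X : measurableType d}
    (P Pt : R.-pker X ~> X) (pi pit : probability X R)
    (beta closed : nat -> R) (S : R) :
  invariant_prob Pt pit ->
  (forall k x f, bounded_measurable f -> (forall y, `|f y| <= 1) ->
    `|iter k (kop P) f x - \int[pi]_y f y| <= beta k) ->
  (forall n, \sum_(k < n) beta k = closed n) -> closed @ \oo --> S ->
  (forall n, (1 <= n)%N ->
    (ker_dist (kiter Pt n) (kiter P n) <= (closed n)%:E * ker_dist Pt P)%E) /\
  (var_dist pit pi <= S%:E * ker_dist Pt P)%E.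
Proof.
move=> hpit hbeta sumE lim; split.
  by move=> n _; rewrite -sumE; exact: (ker_dist_iter_le Pt hbeta n).
apply: (invariant_dist_le hbeta hpit).
by under [X in X @ _]funext do rewrite sumE.
Qed.

Lemma cvg_affine_geometric {R : realType} (r D E : R) : 1 < r ->
  (fun n => r / (r - 1) * ((D + E / (r - 1)) - (D + E / (r - 1) + E * n%:R) * r ^- n))
    @ \oo --> r / (r - 1) * (D + E / (r - 1)).
Proof.
move=> r1; set a := D + E / (r - 1).
have lim : (fun n => (a + E * n%:R) * r ^- n) @ \oo --> a * 0 + E * 0.
  rewrite (_ : (fun n : nat => _) = fun n : nat => a * r ^- n + E * (n%:R * r ^- n));
    last first.
    by apply/funext => n; ring.
  by apply: cvgD; apply: cvgMr; [exact: cvg_inv_expr|exact: cvg_natr_inv_expr].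
have -> : r / (r - 1) * a = r / (r - 1) * (a - (a * 0 + E * 0)) by ring.
by apply: cvgMr; apply: cvgB => //; exact: cvg_cst.
Qed.

Lemma cvg_one_minus_geometric {R : realType} (r a : R) : 1 < r ->
  (fun n => a * (1 - r ^- n)) @ \oo --> a.
Proof.
move=> r1; have -> : (fun n => a * (1 - r ^- n)) @ \oo --> a =
    ((fun n => a * (1 - r ^- n)) @ \oo --> a * (1 - 0)) by rewrite subr0 mulr1.
by apply: cvgMr; apply: cvgB; [exact: cvg_cst|exact: cvg_inv_expr].
Qed.

Theorem theorem4p3 (R : realType) (d d' : measure_display)
    (X : measurableType d) (Omega : measurableType d')
    (P : R.-pker X ~> X) (pi : probability X R)
    (Pr : X -> probability Omega R) (Phi : nat -> Omega -> X)
    (Pt : R.-pker X ~> X) (pit : probability X R)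
    (hX : countably_generated X)
    (hchain : markov_chain P Pr Phi)
    (hpi : unique_invariant P pi)
    (hirr : irreducible P pi)
    (hac : forall n x, (1 <= n)%N -> kiter P n x `<< pi)
    (hrev : reversible P pi)
    (hpit : invariant_prob Pt pit) :
  (forall A : set X, accessible_atom P pi A ->
    (sup_mean_hit Pr Phi A < +oo)%E ->
    let M := fine (sup_mean_hit Pr Phi A) in
    let r := rho Pr Phi A in
    let C1 := Num.sqrt ((fine (pi A))^-1 - 1) in
    forall lambda : R, 1 < lambda ->
      (lambda%:E < exp_inv (sup_mean_hit Pr Phi A))%E ->
      let M1 := lambda * (1 - M * ln lambda)^-1 in
      let F1 := C1 * (1 - (r - 1) / (r - lambda) * M1) in
      let G1 := M1 * (Num.max (2 - C1) 0 * lambda^-1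
                      + (r - 1) / (r - lambda) * C1) in
      let J1 := C1 + Num.max (2 - C1) 0 * r^-1 * M1 in
      let K1 := C1 * (1 - r^-1) * M1 in
      (forall n : nat, (1 <= n)%N ->
        (ker_dist (kiter Pt n) (kiter P n) <=
          (if lambda != r then
             r / (r - 1) * F1 * (1 - r ^- n)
             + lambda / (lambda - 1) * G1 * (1 - lambda ^- n)
           else
             r / (r - 1) * ((J1 + K1 / (r - 1))
               - (J1 + K1 / (r - 1) + K1 * n%:R) * r ^- n))%:E
          * ker_dist Pt P)%E) /\
      (var_dist pit pi <=
        (if lambda != r then
           r / (r - 1) * F1 + lambda / (lambda - 1) * G1
         else
           r / (r - 1) * (J1 + K1 / (r - 1)))%:E
        * ker_dist Pt P)%E)
  /\
  (forall (A : set X) (delta : R) (nu : probability X R),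
    measurable A -> (0 < pi A)%E -> 0 < delta ->
    (forall x B, measurable B -> ((delta * \1_A x)%:E * nu B <= P x B)%E) ->
    (sup_mean_hit Pr Phi A < +oo)%E ->
    let M := fine (sup_mean_hit Pr Phi A) in
    let q := delta ^+ 2 * fine (nu A) in
    let C3 := Num.sqrt ((q * fine (pi A))^-1 - 1) in
    forall lambda theta : R, 1 < lambda ->
      (lambda%:E < exp_inv (sup_mean_hit Pr Phi A))%E ->
      theta < 1 ->
      (sup_even_return Pr Phi A lambda <= theta%:E)%E ->
      lambda ^+ 2 <
        (1 - theta) * (1 - M * ln lambda) ^+ 2 * (1 + q * lambda ^+ 2) ->
      let M3 := q * lambda ^+ 2 /
        ((1 - theta) * (1 - M * ln lambda) ^+ 2 * (1 + q * lambda ^+ 2)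
         - lambda ^+ 2) in
      let D3 := C3 * lambda + Num.max (2 - C3) 0 * lambda^-1 * M3 in
      let E3 := C3 * (lambda - lambda^-1) * M3 / 2 in
      (forall n : nat, (1 <= n)%N ->
        (ker_dist (kiter Pt n) (kiter P n) <=
          (lambda / (lambda - 1) * ((D3 + E3 / (lambda - 1))
             - (D3 + E3 / (lambda - 1) + E3 * n%:R) * lambda ^- n))%:E
          * ker_dist Pt P)%E) /\
      (var_dist pit pi <=
        (lambda / (lambda - 1) * (D3 + E3 / (lambda - 1)))%:E
        * ker_dist Pt P)%E).
Proof.
split.
  move=> A [[mA [nu atomA]] piA] fin M r C1 lambda lam1 hlam M1 F1 G1 J1 K1.
  have pA0 : 0 < fine (pi A).
    by rewrite fine_gt0// piA/= -ge0_fin_numE//; exact: fin_num_measure.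
  have [C1r [S0 rate]] := atom_rate hchain mA fin hrev hirr atomA pA0 lam1 hlam.
  rewrite -/M -/C1 -/r in C1r S0 rate.
  have C10 : 0 <= C1 by exact: sqrtr_ge0.
  have l0 : lambda != 0 by rewrite gt_eqF// (lt_trans _ lam1).
  (* rho may be at most 1 only when C1 vanishes, and then its terms drop out *)
  have [lr|lr] := eqVneq lambda r; last first.
    apply: (@perturbation_bounds _ _ _ P Pt pi pit
      (fun n => F1 * r ^- n + G1 * lambda ^- n)) => //.
    - move=> k x f bf f1; apply: (le_trans (rate k x f bf f1)).
      case: C1r => [C1z|r1]; last exact: atom_bound_neq.
      rewrite /F1 /G1 C1z !mul0r mulr0 add0r addr0 add0r le_eqVlt; apply/orP; left;
        apply/eqP.
      rewrite /M1 exprVn.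
      set S := (1 - M * ln lambda)^-1; set p := lambda ^- k; set mx := Num.max _ _.
      by field; rewrite l0.
    - move=> n; case: C1r => [C1z|r1]; last exact: sum_two_geometric.
      have F1z : F1 = 0 by rewrite /F1 C1z mul0r.
      have := sum_two_geometric 0 G1 n lam1 lam1; rewrite mulr0 mul0r add0r => e.
      by rewrite F1z mulr0 mul0r add0r -e; apply: eq_bigr => k _; rewrite !mul0r.
    case: C1r => [C1z|r1].
      have F1z : F1 = 0 by rewrite /F1 C1z mul0r.
      rewrite F1z mulr0 add0r.
      under [X in X @ _]funext do rewrite mul0r add0r.
      exact: cvg_one_minus_geometric.
    by apply: cvgD; exact: cvg_one_minus_geometric.
  have r1 : 1 < r by rewrite -lr.
  apply: (@perturbation_bounds _ _ _ P Pt pi pit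
    (fun n => (J1 + K1 * n%:R) * r ^- n)) => //.
  - move=> k x f bf f1; apply: (le_trans (rate k x f bf f1)).
    by rewrite /J1 /K1 /M1 -lr; exact: atom_bound_eq.
  - by move=> n; exact: sum_affine_geometric.
  - exact: cvg_affine_geometric.
move=> A delta nu mA piA delta0 minor fin M q C3 lambda theta lam1 hlam th1 hth hcond
  M3 D3 E3.
have pA0 : 0 < fine (pi A).
  by rewrite fine_gt0// piA/= -ge0_fin_numE//; exact: fin_num_measure.
apply: (@perturbation_bounds _ _ _ P Pt pi pit
  (fun n => (D3 + E3 * n%:R) * lambda ^- n)) => //.
- move=> k x f bf f1.
  exact: (small_set_rate hchain mA fin hrev delta0 minor pA0 lam1 hlam th1 hth hcond).
- by move=> n; exact: sum_affine_geometric.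
- exact: cvg_affine_geometric.
Qed.
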